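(* Let $f_{\min}>-\infty$. Assume that $K$ is closed at $\infty$ and that the ideal $\mathrm{Ideal}[\tilde c_{\mathcal E}]\subseteq\mathbb R[\tilde x]$ is real radical. If the LICQC, SCC and SOSC hold at every minimizer of (P), including every minimizer at infinity, then the hierarchy of relaxations (SOS$_k$)–(MOM$_k$) is tight, i.e., $f_k=f_k'=f_{\min}$ for all $k$ big enough.
   Context: **Problem.** $\mathcal E,\mathcal I$ are disjoint finite label sets; $f,c_i\ (i\in\mathcal E\cup\mathcal I)$ are real polynomials in $x=(x_1,\dots,x_n)$; $d=\deg f$. Problem (P): minimize $f(x)$ subject to $c_i(x)=0\ (i\in\mathcal E)$, $c_j(x)\ge 0\ (j\in\mathcal I)$. $K$ is its feasible set and $f_{\min}=\inf_K f$. ''Minimizer'' means global minimizer. It is not assumed that $K$ is bounded or that $f_{\min}$ is attained. **Homogenization.** $\tilde x=(x_0,x)\in\mathbb R^{n+1}$; $\tilde p(\tilde x)=x_0^{\deg p}p(x/x_0)$. Let $\widetilde K^h=\{\tilde x:\tilde c_i(\tilde x)=0\,(i\in\mathcal E),\ \tilde c_j(\tilde x)\ge0\,(j\in\mathcal I),\ x_0\ge0\}$, $\widetilde K^c=\widetilde K^h\cap\{x_0>0\}$, $\widetilde K=\widetilde K^h\cap\{\|\tilde x\|^2=1\}$. $K$ (with its given description) is closed at $\infty$ if the closure of $\widetilde K^c$ equals $\widetilde K^h$. Homogenized problem (H): minimize $F(\tilde x)=\tilde f(\tilde x)-f_{\min}x_0^d$ subject to $\tilde c_i(\tilde x)=0\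 (i\in\mathcal E)$, $\|\tilde x\|^2-1=0$, $\tilde c_j(\tilde x)\ge0\ (j\in\mathcal I)$, $x_0\ge0$. A point $x^*\in\mathbb R^n$ is a minimizer at infinity of (P) if $(0,x^* )\in\widetilde K$ and $F(0,x^* )=0$. **Optimality conditions.** For a problem $\min\phi(u)$ s.t. $h_i(u)=0\ (i\in E)$, $h_j(u)\ge0\ (j\in I)$ and a local minimizer $u^*$, let $J(u^* )=\{i\in E\cup I: h_i(u^* )=0\}$. LICQC: the gradients $\nabla h_i(u^* )$, $i\in J(u^* )$, are linearly independent. Under LICQC there are unique multipliers $\lambda_i$ with $\nabla\phi(u^* )=\sum_{i\in E\cup I}\lambda_i\nabla h_i(u^* )$, $\lambda_j\ge0$ and $\lambda_jh_j(u^* )=0$ for $j\in I$. SCC: $\lambda_j+h_j(u^* )>0$ for all $j\in I$. SOSC: $v^T\nabla^2\mathscr L(u^* )v>0$ for all $v\ne0$ orthogonal to all $\nabla h_i(u^* )$, $i\in J(u^* )$, where $\mathscr L=\phi-\sum_i\lambda_ih_i$. These conditions are said to hold at a minimizer at infinity $x^*$ of (P) if they hold for problem (H) at $(0,x^* )$. **Algebra.** $\tilde c_{\mathcal E}=\{\tilde c_i\}_{i\in\mathcal E}\cup\{\|\tilde x\|^2-1\}$, $\tilde c_{\mathcal I}=\{\tilde c_j\}_{j\in\mathcal I}\cup\{x_0\}$. For a tuple $h=(h_1,\dots,h_m)$, $\mathrm{Ideal}[h]=\sum_ih_i\mathbb R[\tilde x]$ and $\mathrm{Ideal}[h]_{2k}=\sum_ih_i\mathbb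 R[\tilde x]_{2k-\deg h_i}$. It is real radical if it equals the set of all polynomials vanishing on the real zero set of $h$. With $\Sigma[\tilde x]$ the sums of squares and $\Sigma[\tilde x]_{2k}$ those of degree $\le2k$, $\mathrm{QM}[g]_{2k}=\Sigma[\tilde x]_{2k}+\sum_jg_j\Sigma[\tilde x]_{2k-2\lceil\deg(g_j)/2\rceil}$. **Relaxations** ($k\ge\lceil d/2\rceil$). (SOS$_k$): $f_k=\sup\{\gamma:\tilde f-\gamma x_0^d\in\mathrm{Ideal}[\tilde c_{\mathcal E}]_{2k}+\mathrm{QM}[\tilde c_{\mathcal I}]_{2k}\}$. (MOM$_k$): $f_k'=\inf\langle\tilde f,y\rangle$ over real vectors $y=(y_\alpha)$ indexed by $\alpha\in\mathbb N^{n+1}$, $|\alpha|\le2k$, subject to $L_p^{(k)}[y]=0\ (p\in\tilde c_{\mathcal E})$, $L_q^{(k)}[y]\succeq0\ (q\in\tilde c_{\mathcal I})$, $M_k[y]\succeq0$, $\langle x_0^d,y\rangle=1$. Here $\langle\sum_\alpha p_\alpha\tilde x^\alpha,y\rangle=\sum_\alpha p_\alpha y_\alpha$; $L_p^{(k)}[y]$ is the symmetric matrix with $q^TL_p^{(k)}[y]q=\langle p\,(q^T[\tilde x]_t)^2,y\rangle$ for all $q$, where $t=k-\lceil\deg(p)/2\rceil$ and $[\tilde x]_t$ is the vector of monomials of degree $\le t$; $M_k[y]=L_1^{(k)}[y]$. *)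

(* Defs.v *)
From HB Require Import structures.
From mathcomp Require Import all_boot all_order all_algebra.
From mathcomp Require Import mpoly.
From mathcomp Require Import classical_sets reals constructive_ereal ereal.
From mathcomp Require Import topology normedtype.

Set Implicit Arguments.
Unset Strict Implicit.
Unset Printing Implicit Defensive.

Import Order.TTheory GRing.Theory Num.Theory.
Import numFieldNormedType.Exports.

Local Open Scope classical_set_scope.
Local Open Scope ring_scope.

(* [msize] is 1 + degree; the zero polynomial gets degree 0. *)
Definition mdegree (R : realType) (m : nat) (p : {mpoly R[m]}) : nat :=
  (msize p).-1.

(** * Polynomial optimization problems

  A problem in [m] variables is given by an objective [phi] and by constraints
  [h : E + I -> {mpoly R[m]}]: the label [inl i] stands for the equality
  [h (inl i) = 0] and [inr j] for the inequality [h (inr j) >= 0]. *)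

Section Problem.
Context {R : realType} {m : nat} {E I : finType}.
Implicit Types (phi : {mpoly R[m]}) (h : E + I -> {mpoly R[m]}) (u : 'rV[R]_m).

Definition feasible h : set 'rV[R]_m :=
  [set u | (forall i : E, (h (inl i)).@[u ord0] = 0) /\
           (forall j : I, 0 <= (h (inr j)).@[u ord0])].

Definition minimizer phi h u : Prop :=
  feasible h u /\ (forall v, feasible h v -> phi.@[u ord0] <= phi.@[v ord0]).

(* Equal to [+oo] when the feasible set is empty. *)
Definition inf_value phi h : \bar R :=
  ereal_inf [set (phi.@[u ord0])%:E | u in feasible h].

Definition grad phi u : 'rV[R]_m := \row_(i < m) (phi^`M(i)).@[u ord0].

Definition hessian phi u : 'M[R]_m :=
  \matrix_(i < m, j < m) (phi^`M(i)^`M(j)).@[u ord0].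

Definition active h u : pred (E + I) := [pred i | (h i).@[u ord0] == 0].

(* The gradients form a family indexed by the active labels: a repeated
   gradient counts as a dependency. *)
Definition LICQC h u : Prop := free [seq grad (h i) u | i in active h u].

Definition multipliers phi h u (lam : E + I -> R) : Prop :=
  [/\ grad phi u = \sum_i lam i *: grad (h i) u,
      forall j : I, 0 <= lam (inr j)
    & forall j : I, lam (inr j) * (h (inr j)).@[u ord0] = 0].

Definition SCC h u (lam : E + I -> R) : Prop :=
  forall j : I, 0 < lam (inr j) + (h (inr j)).@[u ord0].

Definition lagrangian phi h (lam : E + I -> R) : {mpoly R[m]} :=
  phi - \sum_i lam i *: h i.

Definition SOSC phi h u (lam : E + I -> R) : Prop :=
  forall v : 'rV[R]_m, v != 0 ->
    (forall i, i \in active h u -> (grad (h i) u *m v^T) ord0 ord0 = 0) ->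
    0 < (v *m hessian (lagrangian phi h lam) u *m v^T) ord0 ord0.

(* At a local minimizer satisfying LICQC there is exactly one vector of
   multipliers, so [forall lam] below refers to that vector; the existence of
   multipliers is not made part of the conditions. *)
Definition optimality_conditions phi h u : Prop :=
  LICQC h u /\
  (forall lam, multipliers phi h u lam -> SCC h u lam /\ SOSC phi h u lam).

End Problem.

(** * Homogenization *)

Section Homogenization.
Context {R : realType} {n : nat}.

(* Variable [ord0] is x_0 and variable [lift ord0 i] is the i-th one of x. *)
Definition homogenize (p : {mpoly R[n]}) : {mpoly R[n.+1]} :=
  \sum_(a <- msupp p)
    p@_a *: ('X_ord0 ^+ (mdegree p - mdeg a) *
             \prod_(i < n) 'X_(lift ord0 i) ^+ a i).

(* The point (x_0, x). *)
Definition hpoint (x0 : R) (x : 'rV[R]_n) : 'rV[R]_n.+1 :=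
  \row_(i < n.+1) oapp (x ord0) x0 (unlift ord0 i).

Lemma homogenizeE (p : {mpoly R[n]}) (x0 : R) (x : 'rV[R]_n) : x0 != 0 ->
  (homogenize p).@[hpoint x0 x ord0] = x0 ^+ mdegree p * p.@[(x0^-1 *: x) ord0].
Proof.
move=> x0N0; rewrite /homogenize raddf_sum /= mevalE mulr_sumr.
rewrite big_seq [RHS]big_seq; apply: eq_bigr => a a_supp.
rewrite mevalZ mevalM rmorphXn /= mevalXU mxE unlift_none /=.
rewrite [RHS]mulrCA; congr (_ * _); rewrite (big_morph _ (mevalM _) (meval1 _)).
under eq_bigr do rewrite rmorphXn /= mevalXU mxE liftK /=.
under [in RHS]eq_bigr do rewrite mxE exprMn exprVn.
rewrite big_split /= mulrA; congr (_ * _).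
have le_ad : (mdeg a <= mdegree p)%N.
  by have := msize_mdeg_lt a_supp; rewrite /mdegree; case: (msize p).
rewrite prodfV prodrXr -mdegE -{2}(subnK le_ad) exprD mulfK //.
exact: expf_neq0.
Qed.

Context {E I : finType} (f : {mpoly R[n]}) (c : E + I -> {mpoly R[n]}).

Definition sphere : {mpoly R[n.+1]} := \sum_(i < n.+1) 'X_i ^+ 2 - 1.

(* The equalities gain the unit sphere and the inequalities gain [x_0 >= 0],
   both with label [None]. *)
Definition hconstr (l : option E + option I) : {mpoly R[n.+1]} :=
  match l with
  | inl (Some i) => homogenize (c (inl i))
  | inl None => sphere
  | inr (Some j) => homogenize (c (inr j))
  | inr None => 'X_ord0
  end.

Definition hcone : set 'rV[R]_n.+1 :=
  [set u | [/\ forall i : E, (homogenize (c (inl i))).@[u ord0] = 0,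
               forall j : I, 0 <= (homogenize (c (inr j))).@[u ord0]
             & 0 <= u ord0 ord0]].

Definition hcone_pos : set 'rV[R]_n.+1 := hcone `&` [set u | 0 < u ord0 ord0].

Definition hsphere : set 'rV[R]_n.+1 :=
  hcone `&` [set u | \sum_(i < n.+1) u ord0 i ^+ 2 = 1].

Definition closed_at_infinity : Prop := closure hcone_pos = hcone.

Definition fmin : \bar R := inf_value f c.

Definition hobj : {mpoly R[n.+1]} :=
  homogenize f - fine fmin *: 'X_ord0 ^+ mdegree f.

Definition minimizer_at_infinity (x : 'rV[R]_n) : Prop :=
  hsphere (hpoint 0 x) /\ hobj.@[hpoint 0 x ord0] = 0.

End Homogenization.

(** * Ideals and quadratic modules *)

Section Algebra.
Context {R : realType} {m : nat}.
Implicit Types p : {mpoly R[m]}.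

Definition ideal (J : finType) (h : J -> {mpoly R[m]}) : set {mpoly R[m]} :=
  [set p | exists q : J -> {mpoly R[m]}, p = \sum_j h j * q j].

(* [msize q <= D.+1 - d] is the condition deg q <= D - d; it forces [q = 0]
   when D < d. *)
Definition ideal_trunc (J : finType) (h : J -> {mpoly R[m]}) (k : nat) :
    set {mpoly R[m]} :=
  [set p | exists q : J -> {mpoly R[m]},
     (forall j, (msize (q j) <= (2 * k).+1 - mdegree (h j))%N) /\
     p = \sum_j h j * q j].

Definition real_radical (J : finType) (h : J -> {mpoly R[m]}) : Prop :=
  ideal h = [set p | forall u : 'rV[R]_m,
                       (forall j, (h j).@[u ord0] = 0) -> p.@[u ord0] = 0].

Definition sos : set {mpoly R[m]} :=
  [set p | exists s : seq {mpoly R[m]}, p = \sum_(q <- s) q ^+ 2].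

Definition qmodule_trunc (J : finType) (g : J -> {mpoly R[m]}) (k : nat) :
    set {mpoly R[m]} :=
  [set p | exists (s0 : {mpoly R[m]}) (s : J -> {mpoly R[m]}),
     [/\ sos s0 /\ (msize s0 <= (2 * k).+1)%N,
         forall j, sos (s j) /\
           (msize (s j) <= (2 * k).+1 - 2 * uphalf (mdegree (g j)))%N
       & p = s0 + \sum_j g j * s j]].

End Algebra.

(** * Moments *)

Section Moments.
Context {R : realType} {m : nat}.

(* The bound in ['X_{1..m < b}] is strict. *)
Definition tms (k : nat) : Type := 'X_{1..m < (2 * k).+1} -> R.

(* Meaningful for polynomials of degree at most 2k. *)
Definition pairing (k : nat) (p : {mpoly R[m]}) (y : tms k) : R :=
  \sum_(a : 'X_{1..m < (2 * k).+1}) p@_a * y a.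

(* Monomials of degree at most [k - uphalf (mdegree p)]; there are none when
   this number is negative. *)
Definition locbasis (k : nat) (p : {mpoly R[m]}) : finType :=
  'X_{1..m < k.+1 - uphalf (mdegree p)}.

Definition locmx (k : nat) (p : {mpoly R[m]}) (y : tms k) :
    'M[R]_#|locbasis k p| :=
  \matrix_(i, j) pairing (p * 'X_[bmnm (enum_val i) + bmnm (enum_val j)]) y.

Definition locpoly (k : nat) (p : {mpoly R[m]})
    (q : 'rV[R]_#|locbasis k p|) : {mpoly R[m]} :=
  \sum_i q ord0 i *: 'X_[bmnm (enum_val i)].

Lemma locmxE (k : nat) (p : {mpoly R[m]}) (y : tms k)
    (q : 'rV[R]_#|locbasis k p|) :
  (q *m locmx p y *m q^T) ord0 ord0 = pairing (p * locpoly q ^+ 2) y.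
Proof.
have pairD : {morph (fun r => pairing r y) : a b / a + b}.
  by move=> a b; rewrite /pairing -big_split; apply: eq_bigr => i _;
     rewrite mcoeffD mulrDl.
have pair0 : pairing 0 y = 0.
  by rewrite /pairing big1 // => i _; rewrite mcoeff0 mul0r.
have pairZ c r : pairing (c *: r) y = c * pairing r y.
  by rewrite /pairing mulr_sumr; apply: eq_bigr => i _; rewrite mcoeffZ mulrA.
rewrite expr2 /locpoly mulr_suml mulr_sumr (big_morph _ pairD pair0) mxE.
under [RHS]eq_bigr do rewrite mulr_sumr mulr_sumr (big_morph _ pairD pair0).
rewrite exchange_big; apply: eq_bigr => j _; rewrite !mxE mulr_suml.
apply: eq_bigr => i _; rewrite !mxE.
by rewrite mpolyXD -[in RHS]scalerAl -!scalerAr !pairZ mulrAC -mulrA.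
Qed.

Lemma locmx_sym (k : nat) (p : {mpoly R[m]}) (y : tms k) :
  (locmx p y)^T = locmx p y.
Proof. by apply/matrixP => i j; rewrite !mxE addmC. Qed.

Definition psd (N : nat) (A : 'M[R]_N) : Prop :=
  forall v : 'rV[R]_N, 0 <= (v *m A *m v^T) ord0 ord0.

Definition mommx (k : nat) (y : tms k) := locmx 1 y.

End Moments.

(** * Relaxations of order k *)

Section Relaxations.
Context {R : realType} {n : nat} {E I : finType}.
Context (f : {mpoly R[n]}) (c : E + I -> {mpoly R[n]}) (k : nat).

Definition heq (l : option E) : {mpoly R[n.+1]} := hconstr c (inl l).
Definition hineq (l : option I) : {mpoly R[n.+1]} := hconstr c (inr l).

Definition sos_feasible : set R :=
  [set g : R | exists p q : {mpoly R[n.+1]},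
     [/\ ideal_trunc heq k p, qmodule_trunc hineq k q
       & homogenize f - g *: 'X_ord0 ^+ mdegree f = p + q]].

Definition sos_value : \bar R := ereal_sup [set g%:E | g in sos_feasible].

Definition mom_feasible : set (@tms R n.+1 k) :=
  [set y | [/\ forall l, locmx (heq l) y = 0,
               forall l, psd (locmx (hineq l) y),
               psd (mommx y)
             & pairing ('X_ord0 ^+ mdegree f) y = 1]].

Definition mom_value : \bar R :=
  ereal_inf [set (pairing (homogenize f) y)%:E | y in mom_feasible].

End Relaxations.

(* Main.v *)
(** Write [F] for the objective of (H), [K] for its compact feasible set and [M]
for the (untruncated) sum of the ideal and the quadratic module of (H). Closedness
at infinity gives [F >= 0] on [K], and it suffices to show [F \in M]: a fixed
certificate fits into all relaxations of large order, while points of the original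
feasible set bound both values by [fmin].

Putinar's theorem for [M] reduces, by penalizing the constraints, to polynomials
that are positive on the cube, which have nonnegative Bernstein coefficients. At a
zero [u] of [F] on [K] the optimality conditions (transported from (P) by Euler's
identities when [u] is not at infinity) and a second order Taylor expansion yield
[F - d |x - u|^2 + A |x - u|^4 \in M] with [d > 0]. Hence the zeros are isolated,
so finite in number, and the local certificates glue to
[F - D Y + B D^2 \in M], where [D] is the product of the [|x - u|^2] and [Y > 0] at
the zeros. From this, [F \in M] follows by writing [F] as a square times that
polynomial plus [D] times a polynomial that is positive on [K]. *)

Require Import Defs.
From mathcomp Require Import all_boot all_order all_algebra.
From mathcomp Require Import mpoly.
From mathcomp Require Import classical_sets reals constructive_ereal ereal.
From mathcomp Require Import topology normedtype.
From mathcomp Require Import boolp finmap.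
From mathcomp Require Import ring lra zify.
From mathcomp Require derive.

Set Implicit Arguments.
Unset Strict Implicit.
Unset Printing Implicit Defensive.

Import Order.TTheory GRing.Theory Num.Theory.
Import numFieldNormedType.Exports.

Local Open Scope classical_set_scope.
Local Open Scope ring_scope.

(** * Compactness *)

Section Compactness.
Context {R : realType} {m : nat}.
Implicit Types (p q : 'rV[R]_m -> R) (A : set 'rV[R]_m).

(** The obstacle is that F has zeros on K, so [putinar] does not apply to F itself. It is applied
    only to cofactors that are strictly positive on K, while the zeros are carried by explicit
    factors |x - u|^2. To keep remainders inside M, the local analysis consists of ring identities:
    [hadamard] gives Taylor expansions with polynomial remainder, [sos_lagrange] is Cauchy-Schwarz
    as a sum of squares, and a polynomial known to be positive only at u is made positive on the
    cube by adding a large multiple of |x - u|^2. The cube is the right domain because of the sphere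
    equation: modulo it (1 + x_i) / 2 and (1 - x_i) / 2 are sums of squares, and such elements,
    unlike those of M, may be multiplied. The optimality conditions speak of all multiplier vectors
    but provide none, so existence is derived from LICQC by a penalty method. If K is empty, f_min
    is +oo and the number subtracted in F is only the default value of [fine]; this case is settled
    separately, by infeasibility of (H). *)

Lemma continuous_constr (c : R) : continuous (fun _ : 'rV[R]_m => c).
Proof. by move=> x; exact: cst_continuous. Qed.

Lemma continuous_addr p q : continuous p -> continuous q ->
  continuous (fun x => p x + q x).
Proof. by move=> cp cq x; refine (@continuousD R R^o _ p q x (cp x) (cq x)). Qed.

Lemma continuous_mulr p q : continuous p -> continuous q ->
  continuous (fun x => p x * q x).
Proof. by move=> cp cq x; refine (@continuousM R _ p q x (cp x) (cq x)). Qed.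

Lemma continuous_sumr (J : Type) (s : seq J) (f : J -> 'rV[R]_m -> R) :
  (forall j, continuous (f j)) -> continuous (fun x => \sum_(j <- s) f j x).
Proof.
move=> cf; elim: s => [|j s IH].
  have -> : (fun x => \sum_(j <- [::]) f j x) = (fun=> 0).
    by apply/funext => x; rewrite big_nil.
  exact: continuous_constr.
have -> : (fun x => \sum_(i <- j :: s) f i x) =
          (fun x => f j x + \sum_(i <- s) f i x).
  by apply/funext => x; rewrite big_cons.
exact: continuous_addr.
Qed.

Lemma continuous_meval (p : {mpoly R[m]}) :
  continuous (fun u : 'rV[R]_m => p.@[u ord0]).
Proof.
have -> : (fun u : 'rV[R]_m => p.@[u ord0]) =
  (fun u => \sum_(a <- msupp p) p@_a * \prod_(i < m) u ord0 i ^+ a i).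
  by apply/funext => u; rewrite mevalE.
apply: continuous_sumr => a; apply: continuous_mulr.
  exact: continuous_constr.
elim: (index_enum _) => [|i s IH].
  have -> : (fun u : 'rV[R]_m => \prod_(i <- [::]) u ord0 i ^+ a i) = (fun=> 1).
    by apply/funext => x; rewrite big_nil.
  exact: continuous_constr.
have -> : (fun u : 'rV[R]_m => \prod_(i <- i :: s) u ord0 i ^+ a i) =
          (fun u => u ord0 i ^+ a i * \prod_(i <- s) u ord0 i ^+ a i).
  by apply/funext => x; rewrite big_cons.
apply: continuous_mulr => //; elim: (a i) => [|k IHk].
  exact: continuous_constr.
have -> : (fun u : 'rV[R]_m => u ord0 i ^+ k.+1) =
          (fun u => u ord0 i * u ord0 i ^+ k).
  by apply/funext => x; rewrite exprS.
by apply: continuous_mulr => //; exact: coord_continuous.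
Qed.

Lemma compact_pos_lb A p : compact A -> continuous p ->
  (forall x, A x -> 0 < p x) -> exists2 c, 0 < c & forall x, A x -> c <= p x.
Proof.
move=> cA cp pA; have [[a Aa]|A0] := pselect (A !=set0).
  have [|x Ax xm] := @derive.EVT_min_rV R m p A _ cA (continuous_subspaceT cp).
    by exists a.
  exists (p x) => [|y Ay]; first by apply: pA; exact/set_mem.
  by apply: xm; exact/mem_set.
by exists 1 => // x Ax; case: A0; exists x.
Qed.

Lemma compact_bound A p : compact A -> continuous p ->
  exists2 b, 0 < b & forall x, A x -> `|p x| <= b.
Proof.
move=> cA cp; have [[a Aa]|A0] := pselect (A !=set0).
  have [|x Ax xm] := @derive.EVT_min_rV R m p A _ cA (continuous_subspaceT cp).
    by exists a.
  have [|z Az zm] := @derive.EVT_max_rV R m p A _ cA (continuous_subspaceT cp).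
    by exists a.
  exists (`|p x| + `|p z| + 1) => [|y Ay]; first by rewrite ltr_wpDl.
  have := xm y (mem_set Ay); have := zm y (mem_set Ay).
  rewrite ler_norml => h1 h2.
  have := ler_norm (p z); have := ler_norm (- p x); rewrite normrN.
  by have := normr_ge0 (p z); have := normr_ge0 (p x); lra.
by exists 1 => // x Ax; case: A0; exists x.
Qed.

Lemma compact_sublevel A p c : compact A -> continuous p ->
  compact (A `&` [set x | p x <= c]).
Proof.
move=> cA cp; apply: compact_closedI => //.
have -> : [set x | p x <= c] = p @^-1` [set y | y <= c] by [].
exact: ((continuous_closedP p).1 cp _ (@closed_le _ c)).
Qed.

Lemma compact_level A p c : compact A -> continuous p ->
  compact (A `&` [set x | p x = c]).
Proof.
move=> cA cp; apply: compact_closedI => //.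
have -> : [set x | p x = c] = p @^-1` [set c].
  by apply/seteqP; split => x /=.
exact: ((continuous_closedP p).1 cp _ (@closed_eq _ c)).
Qed.

(** On the compact set where [p <= 0], [q] has no zero, hence a lower bound e > 0, and [p >= - b]:
    the weight (b + 1) / e lifts the sum above 0. Elsewhere [p] is positive already. *)
Lemma compact_penalty A p q : compact A -> continuous p -> continuous q ->
  (forall x, A x -> 0 <= q x) -> (forall x, A x -> q x = 0 -> 0 < p x) ->
  exists t c, [/\ 0 < t, 0 < c &
    forall s, t <= s -> forall x, A x -> c <= p x + s * q x].
Proof.
move=> cA cp cq q0 pq.
have [b b0 pb] := compact_bound cA cp.
have [e e0 qe] : exists2 e, 0 < e &
    forall x, (A `&` [set x | p x <= 0]) x -> e <= q x.
  apply: compact_pos_lb => //; first exact: compact_sublevel.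
  move=> x [Ax px]; rewrite lt_def q0 // andbT; apply/eqP => /(pq _ Ax).
  by rewrite ltNge px.
pose t := (b + 1) / e.
have t0 : 0 < t by rewrite divr_gt0 // addr_gt0.
have pos x : A x -> 0 < p x + t * q x.
  move=> Ax; have [px|px] := leP (p x) 0.
    have : t * e <= t * q x by rewrite ler_pM2l //; exact: qe.
    rewrite divfK ?gt_eqF //; have := pb _ Ax; rewrite ler_norml; lra.
  by rewrite ltr_pwDl // mulr_ge0 ?q0 // ltW.
have [|c c0 pc] := compact_pos_lb cA _ pos.
  by apply: continuous_addr => //; apply: continuous_mulr => //;
     exact: continuous_constr.
exists t, c; split=> // s ts x Ax; apply: le_trans (pc _ Ax) _.
by rewrite lerD2l ler_wpM2r // q0.
Qed.

End Compactness.

(** * Sums of squares and quadratic modules *)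

Section SumsOfSquares.
Context {R : realType} {m : nat}.
Implicit Types p q s : {mpoly R[m]}.

Lemma sos_sq p : sos (p ^+ 2).
Proof. by exists [:: p]; rewrite big_seq1. Qed.

Lemma sosD p q : sos p -> sos q -> sos (p + q).
Proof. by move=> [s ->] [t ->]; exists (s ++ t); rewrite big_cat. Qed.

Lemma sos0 : sos (0 : {mpoly R[m]}).
Proof. by exists [::]; rewrite big_nil. Qed.

Lemma sos_sum (J : Type) (r : seq J) (P : pred J) (f : J -> {mpoly R[m]}) :
  (forall j, P j -> sos (f j)) -> sos (\sum_(j <- r | P j) f j).
Proof. by move=> sf; apply: big_ind => //; [exact: sos0|exact: sosD]. Qed.

Lemma sosM p q : sos p -> sos q -> sos (p * q).
Proof.
move=> [s ->] [t ->]; rewrite mulr_suml; apply: sos_sum => a _.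
by rewrite mulr_sumr; apply: sos_sum => b _; rewrite -exprMn; exact: sos_sq.
Qed.

Lemma sosC (c : R) : 0 <= c -> sos (c%:MP : {mpoly R[m]}).
Proof. by move=> c0; rewrite -(sqr_sqrtr c0) rmorphXn; exact: sos_sq. Qed.

Lemma sos_prod (J : Type) (r : seq J) (P : pred J) (f : J -> {mpoly R[m]}) :
  (forall j, P j -> sos (f j)) -> sos (\prod_(j <- r | P j) f j).
Proof.
move=> sf; apply: big_ind => //; last exact: sosM.
by rewrite -(expr1n _ 2); exact: sos_sq.
Qed.

Lemma sos_ge0 p (u : 'I_m -> R) : sos p -> 0 <= p.@[u].
Proof.
move=> [s ->]; rewrite raddf_sum /=; apply: sumr_ge0 => q _.
by rewrite expr2 mevalM -expr2 sqr_ge0.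
Qed.

End SumsOfSquares.

Section QuadraticModule.
Context {R : realType} {m : nat} {E I : finType}.
Variable h : E + I -> {mpoly R[m]}.
Implicit Types p q s : {mpoly R[m]}.

(** Unlike the quadratic module, this set is closed under products: products of Bernstein factors
    stay inside it, and its elements may multiply members of the quadratic module. *)
Definition sos_mod_ideal p : Prop :=
  exists (q : E -> {mpoly R[m]}) (s : {mpoly R[m]}),
    sos s /\ p = \sum_i h (inl i) * q i + s.

Definition qmodule p : Prop :=
  exists (q : E -> {mpoly R[m]}) (s0 : {mpoly R[m]}) (s : I -> {mpoly R[m]}),
    [/\ sos s0, forall j, sos (s j) &
        p = \sum_i h (inl i) * q i + (s0 + \sum_j h (inr j) * s j)].

Lemma sos_smi p : sos p -> sos_mod_ideal p.
Proof.
move=> sp; exists (fun=> 0), p; split=> //.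
by rewrite big1 ?add0r // => i _; rewrite mulr0.
Qed.

Lemma ideal_smi i p : sos_mod_ideal (h (inl i) * p).
Proof.
exists (fun j => if j == i then p else 0), 0; split; first exact: sos0.
rewrite addr0 (bigD1 i) //= eqxx big1 ?addr0 // => j /negbTE ->.
by rewrite mulr0.
Qed.

Lemma smiD p q : sos_mod_ideal p -> sos_mod_ideal q -> sos_mod_ideal (p + q).
Proof.
move=> [q1 [s1 [ss1 ->]]] [q2 [s2 [ss2 ->]]].
exists (fun i => q1 i + q2 i), (s1 + s2); split; first exact: sosD.
under [in RHS]eq_bigr do rewrite mulrDr.
by rewrite big_split /=; ring.
Qed.

Lemma smiM p q : sos_mod_ideal p -> sos_mod_ideal q -> sos_mod_ideal (p * q).
Proof.
move=> [q1 [s1 [ss1 ->]]] [q2 [s2 [ss2 ->]]].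
exists (fun i => q1 i * (\sum_i h (inl i) * q2 i + s2) + s1 * q2 i), (s1 * s2).
split; first exact: sosM.
under [X in _ = X + _]eq_bigr do rewrite mulrDr mulrA mulrCA.
by rewrite big_split /= -mulr_suml -mulr_sumr; ring.
Qed.

Lemma smi_sum (J : Type) (r : seq J) (P : pred J) (f : J -> {mpoly R[m]}) :
  (forall j, P j -> sos_mod_ideal (f j)) ->
  sos_mod_ideal (\sum_(j <- r | P j) f j).
Proof.
move=> sf; apply: big_ind => //; first exact/sos_smi/sos0.
exact: smiD.
Qed.

Lemma smi_prod (J : Type) (r : seq J) (P : pred J) (f : J -> {mpoly R[m]}) :
  (forall j, P j -> sos_mod_ideal (f j)) ->
  sos_mod_ideal (\prod_(j <- r | P j) f j).
Proof.
move=> sf; apply: big_ind => //; last exact: smiM.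
by apply/sos_smi; rewrite -(expr1n _ 2); exact: sos_sq.
Qed.

Lemma smiX p k : sos_mod_ideal p -> sos_mod_ideal (p ^+ k).
Proof.
move=> sp; elim: k => [|k IH]; last by rewrite exprS; exact: smiM.
by apply: sos_smi; apply: sosC; exact: ler01.
Qed.

Lemma smi_qmodule p : sos_mod_ideal p -> qmodule p.
Proof.
move=> [q [s [ss ->]]]; exists q, s, (fun=> 0); split=> //.
  by move=> j; exact: sos0.
by rewrite [X in s + X]big1 ?addr0 // => j _; rewrite mulr0.
Qed.

Lemma sos_qmodule p : sos p -> qmodule p.
Proof. by move/sos_smi/smi_qmodule. Qed.

Lemma ideal_qmodule i p : qmodule (h (inl i) * p).
Proof. exact/smi_qmodule/ideal_smi. Qed.

Lemma qmoduleD p q : qmodule p -> qmodule q -> qmodule (p + q).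
Proof.
move=> [q1 [s1 [t1 [ss1 st1 ->]]]] [q2 [s2 [t2 [ss2 st2 ->]]]].
exists (fun i => q1 i + q2 i), (s1 + s2), (fun j => t1 j + t2 j); split.
- exact: sosD.
- by move=> j; exact: sosD.
under [X in _ = X + _]eq_bigr do rewrite mulrDr.
under [X in _ = _ + (_ + X)]eq_bigr do rewrite mulrDr.
by rewrite !big_split /=; ring.
Qed.

Lemma qmodule_sum (J : Type) (r : seq J) (P : pred J) (f : J -> {mpoly R[m]}) :
  (forall j, P j -> qmodule (f j)) -> qmodule (\sum_(j <- r | P j) f j).
Proof.
move=> sf; apply: big_ind => //; first exact/sos_qmodule/sos0.
exact: qmoduleD.
Qed.

Lemma ineq_qmodule j p : sos p -> qmodule (h (inr j) * p).
Proof.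
move=> sp; exists (fun=> 0), 0, (fun k => if k == j then p else 0); split.
- exact: sos0.
- by move=> k; case: ifP => // _; exact: sos0.
rewrite big1 ?add0r => [|i _]; last by rewrite mulr0.
by rewrite (bigD1 j) //= eqxx big1 ?addr0 // => k /negbTE ->; rewrite mulr0.
Qed.

Lemma sos_qmoduleM p q : sos p -> qmodule q -> qmodule (p * q).
Proof.
move=> sp [q1 [s1 [t1 [ss1 st1 ->]]]].
exists (fun i => p * q1 i), (p * s1), (fun j => p * t1 j); split.
- exact: sosM.
- by move=> j; exact: sosM.
rewrite !mulrDr !mulr_sumr; congr (_ + (_ + _)).
  by apply: eq_bigr => i _; rewrite mulrCA.
by apply: eq_bigr => i _; rewrite mulrCA.
Qed.

Lemma smi_qmoduleM p q : sos_mod_ideal p -> qmodule q -> qmodule (p * q).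
Proof.
move=> [q1 [s1 [ss1 ->]]] qq; rewrite mulrDl; apply: qmoduleD.
  rewrite mulr_suml; apply: qmodule_sum => i _; rewrite -mulrA.
  exact: ideal_qmodule.
exact: sos_qmoduleM.
Qed.

Lemma ineq_qmodule_smi j p : sos_mod_ideal p -> qmodule (h (inr j) * p).
Proof.
move=> sp; rewrite mulrC; apply: smi_qmoduleM => //.
rewrite -[h _]mulr1; apply: ineq_qmodule; rewrite -(expr1n _ 2); exact: sos_sq.
Qed.

Lemma qmodule_ge0 p u : feasible h u -> qmodule p -> 0 <= p.@[u ord0].
Proof.
move=> [hE hI] [q1 [s1 [t1 [ss1 st1 ->]]]].
rewrite !mevalD !raddf_sum /= big1 ?add0r => [|i _]; last by rewrite mevalM hE mul0r.
rewrite addr_ge0 ?(sos_ge0 _ ss1) //; apply: sumr_ge0 => j _.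
by rewrite mevalM mulr_ge0 ?hI // sos_ge0.
Qed.

End QuadraticModule.

(** * Polynomials positive on the cube *)

Section Bernstein.

(** Both sides are the multinomial coefficient N! / (k! i! (N - k - i)!). *)
Lemma mul_bin_bin (N k i : nat) : (k + i <= N)%N ->
  ('C(k + i, k) * 'C(N, k + i) = 'C(N, k) * 'C(N - k, i))%N.
Proof.
move=> kiN; have kN : (k <= N)%N := leq_trans (leq_addr _ _) kiN.
have h1 := bin_fact kiN; have h2 := bin_fact kN.
have h3 := bin_fact (leq_addr i k).
have iNk : (i <= N - k)%N by rewrite leq_subRL.
have h4 := bin_fact iNk; rewrite addKn in h3; rewrite -subnDA in h4.
apply/eqP; rewrite -(@eqn_pmul2r (k`! * i`! * (N - (k + i))`!)) ?muln_gt0 ?fact_gt0 //.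
apply/eqP; transitivity N`!.
  by rewrite -h1 -h3; ring.
by rewrite -h2 -h4; ring.
Qed.

(** Expand T^k (1 - T + T)^(N - k) by the binomial formula; the factor ['C(N, k)] clears
    denominators, so that any commutative ring will do. *)
Lemma bernstein_expr (A : comNzRingType) (T : A) (N k : nat) : (k <= N)%N ->
  T ^+ k *+ 'C(N, k) =
  \sum_(j < N.+1) (T ^+ j * (1 - T) ^+ (N - j)) *+ ('C(j, k) * 'C(N, j)).
Proof.
move=> kN; rewrite -(big_mkord xpredT
  (fun j => (T ^+ j * (1 - T) ^+ (N - j)) *+ ('C(j, k) * 'C(N, j)))).
rewrite (@big_cat_nat _ _ _ k) //= ?leqW // big_nat big1 ?add0r; last first.
  by move=> j /andP[_ jk]; rewrite bin_small.
have -> (F : nat -> A) :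
    \sum_(k <= j < N.+1) F j = \sum_(j < (N - k).+1) F (j + k)%N.
  by rewrite -{1}[k]add0n big_addn subSn // big_mkord.
transitivity (T ^+ k * (1 - T + T) ^+ (N - k) *+ 'C(N, k)).
  by rewrite subrK expr1n mulr1.
rewrite exprDn mulr_sumr -sumrMnl; apply: eq_bigr => i _.
have iNk : (i <= N - k)%N by rewrite -ltnS.
rewrite [(i + k)%N]addnC mul_bin_bin -?leq_subRL // exprD subnDA.
by rewrite mulrnAr -mulrnA mulnC; congr (_ *+ _); ring.
Qed.

Context {R : realType}.

(** The j-th Bernstein coefficient of T^k in degree N. *)
Definition binratio (N j k : nat) : R := 'C(j, k)%:R / 'C(N, k)%:R.

Lemma binratio_itv (N j k : nat) : (k <= N)%N -> (j <= N)%N ->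
  0 <= binratio N j k <= 1.
Proof.
move=> kN jN; rewrite /binratio divr_ge0 ?ler0n //=.
by rewrite ler_pdivrMr ?ltr0n ?bin_gt0 // mul1r ler_nat leq_bin2l.
Qed.

Lemma binratioS (N j k : nat) : (k < N)%N ->
  binratio N j k.+1 = binratio N j k * ((j - k)%:R / (N - k)%:R).
Proof.
move=> kN; rewrite /binratio.
have h1 := mul_bin_left j k; have h2 := mul_bin_left N k.
have NC0 : ('C(N, k)%:R : R) != 0 by rewrite pnatr_eq0 -lt0n bin_gt0 ltnW.
have NC1 : ('C(N, k.+1)%:R : R) != 0 by rewrite pnatr_eq0 -lt0n bin_gt0.
have Nk0 : ((N - k)%:R : R) != 0 by rewrite pnatr_eq0 subn_eq0 -ltnNge.
have k0 : (k.+1%:R : R) != 0 by rewrite pnatr_eq0.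
apply: (mulfI k0); rewrite mulrA -natrM h1.
apply: (mulIf NC1); rewrite divfK //.
transitivity ('C(j, k)%:R / 'C(N, k)%:R * ((j - k)%:R / (N - k)%:R) *
  (k.+1 * 'C(N, k.+1))%:R : R); last by rewrite natrM; ring.
by rewrite h2 !natrM; field; rewrite NC0 Nk0.
Qed.

(** What matters is uniformity in j: each new factor (j - k) / (N - k) differs from j / N by at most
    k / (N - k), also when j < k and the truncated difference is 0. *)
Lemma binratio_cvg (k : nat) (e : R) : 0 < e ->
  exists N0, forall N j, (N0 <= N)%N -> (j <= N)%N ->
    (k <= N)%N /\ `|binratio N j k - (j%:R / N%:R) ^+ k| <= e.
Proof.
elim: k e => [|k IH] e e0.
  by exists 0%N => N j _ _; rewrite /binratio !bin0 divr1 expr0 subrr normr0 ltW.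
have e20 : 0 < e / 2 by rewrite divr_gt0.
have [N0 HN0] := IH _ e20.
pose N1 := (Num.bound (k%:R / (e / 2))).
exists (N0 + (k + N1).+1)%N => N j; set M := (k + N1).+1 => N0N jN.
have [kN err] := HN0 N j (leq_trans (leq_addr _ _) N0N) jN.
have MN : (M <= N)%N := leq_trans (leq_addl _ _) N0N.
have kN' : (k < N)%N by apply: leq_trans MN; rewrite ltnS leq_addr.
split=> //; rewrite binratioS //.
have /andP[r0 r1] := binratio_itv kN jN.
set r := binratio N j k in err r0 r1 *; set x := _ / _ in err *.
set y := _ / _.
have N0' : 0 < N%:R :> R by rewrite ltr0n (leq_ltn_trans _ kN').
have Nk0 : 0 < (N - k)%:R :> R by rewrite ltr0n subn_gt0.
have x0 : 0 <= x by rewrite divr_ge0 ?ler0n.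
have x1 : x <= 1 by rewrite ler_pdivrMr // mul1r ler_nat.
have kb : k%:R / (N - k)%:R <= e / 2.
  rewrite ler_pdivrMr // mulrC -ler_pdivrMr //.
  apply: le_trans (_ : N1%:R <= _); last first.
    by rewrite ler_nat leq_subRL //; apply: ltnW.
  by apply: ltW; apply: archi_boundP; rewrite divr_ge0 // ltW.
have yx : `|y - x| <= e / 2.
  apply: le_trans kb; rewrite /y /x.
  have [kj|jk] := leqP k j.
    have -> : (j - k)%:R / (N - k)%:R - j%:R / N%:R =
       - (k%:R / (N - k)%:R * ((N - j)%:R / N%:R)) :> R.
      rewrite !natrB //; field.
      by rewrite -natrB // !gt_eqF.
    rewrite normrN ger0_norm; last by rewrite mulr_ge0 // divr_ge0 ?ler0n // ltW.
    rewrite ler_piMr ?divr_ge0 ?ler0n //.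
    by rewrite ler_pdivrMr // mul1r ler_nat leq_subr.
  have -> : (j - k)%N = 0%N by apply/eqP; rewrite subn_eq0 ltnW.
  rewrite mul0r sub0r normrN ger0_norm //.
  apply: ler_pM; rewrite ?ler0n ?invr_ge0 ?ler0n ?ler_nat 1?ltnW //.
  by rewrite lef_pV2 ?posrE // ler_nat leq_subr.
rewrite exprS.
have -> : r * y - x * x ^+ k = r * (y - x) + (r - x ^+ k) * x by ring.
apply: le_trans (ler_normD _ _) _; rewrite (normrM r) (normrM _ x).
rewrite (ger0_norm r0) (ger0_norm x0) [e]splitr.
apply: lerD.
  by apply: le_trans yx; rewrite ler_piMl.
by apply: le_trans err; rewrite ler_piMr.
Qed.

(** Telescoping, one factor at a time; with all factors in [0, 1] the errors add up without
    amplification. *)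
Lemma ler_norm_prod_sub (J : Type) (s : seq J) (a b : J -> R) (e : R) :
  (forall j, 0 <= a j <= 1) -> (forall j, 0 <= b j <= 1) ->
  (forall j, `|a j - b j| <= e) ->
  `|\prod_(j <- s) a j - \prod_(j <- s) b j| <= (size s)%:R * e.
Proof.
move=> a01 b01 ab; elim: s => [|j s IH].
  by rewrite !big_nil subrr normr0 mul0r.
rewrite !big_cons /=.
set A := \prod_(j <- s) a j in IH *; set B := \prod_(j <- s) b j in IH *.
have /andP[B0 B1] : 0 <= B <= 1.
  rewrite /B; apply: (big_ind (fun x => 0 <= x <= 1)) => //.
    by rewrite ler01 lexx.
  move=> x y /andP[x0 x1] /andP[y0 y1]; rewrite mulr_ge0 //=.
  by rewrite -[leRHS]mulr1 ler_pM.
have -> : a j * A - b j * B = a j * (A - B) + (a j - b j) * B by ring.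
apply: le_trans (ler_normD _ _) _; rewrite !normrM.
have /andP[a0 a1] := a01 j.
rewrite (ger0_norm a0) (ger0_norm B0) -natr1 mulrDl mul1r.
apply: lerD; first by apply: le_trans IH; rewrite ler_piMl.
by apply: le_trans (ab j); rewrite ler_piMr.
Qed.

End Bernstein.

Section BoxPositivity.
Context {R : realType} {m : nat} {E I : finType}.
Variables (h : E + I -> {mpoly R[m]}) (e0 : E).
Hypothesis he0 : h (inl e0) = \sum_(i < m) 'X_i ^+ 2 - 1.
Implicit Types p : {mpoly R[m]}.

Definition cube : set 'rV[R]_m := [set u | forall i, `|u ord0 i| <= 1].

Lemma compact_cube : compact cube.
Proof.
have -> : cube = [set u : 'rV[R]_m | forall i, `[(- 1), 1]%classic (u ord0 i)].
  apply/seteqP; split => u /= uc i; have := uc i;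
  by rewrite /= in_itv /= ler_norml.
have H : forall i : 'I_m, compact ((fun=> `[(- 1), 1]%classic : set R) i).
  by move=> i; exact: segment_compact.
exact: (rV_compact H).
Qed.

Lemma feasible_cube : feasible h `<=` cube.
Proof.
move=> u [/(_ e0) + _] i; rewrite he0 mevalB meval1 raddf_sum /=.
move/eqP; rewrite subr_eq0 (bigD1 i) //= expr2 mevalM mevalXU -expr2 => /eqP uu.
rewrite -(@expr_le1 _ 2) // real_normK ?num_real // -uu lerDl.
by apply: sumr_ge0 => j _; rewrite expr2 mevalM -expr2 sqr_ge0.
Qed.

Lemma smiZ c p : 0 <= c -> sos_mod_ideal h p -> sos_mod_ideal h (c *: p).
Proof.
by move=> c0 sp; rewrite -mul_mpolyC; apply: smiM => //; exact/sos_smi/sosC.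
Qed.

(* 2 (1 + e x_i) = (1 + e x_i)^2 + \sum_(j != i) x_j^2 on the sphere *)
Lemma smi_half (e : R) i : e ^+ 2 = 1 ->
  sos_mod_ideal h (2^-1%:MP * (1 + e *: 'X_i)).
Proof.
move=> e1.
have -> : 2^-1%:MP * (1 + e *: 'X_i) = (4^-1 : R) *: (h (inl e0) * (- 1) +
   ((1 + e *: 'X_i) ^+ 2 + \sum_(j < m | j != i) 'X_j ^+ 2)).
  rewrite he0 (bigD1 i) //=; set S := \sum_(j < m | _) _.
  have -> : (e *: 'X_i : {mpoly R[m]}) = e%:MP * 'X_i by rewrite mul_mpolyC.
  rewrite -[in RHS]mul_mpolyC.
  have -> : 2^-1%:MP = 4^-1%:MP * (2 : {mpoly R[m]}).
    rewrite -[2 in RHS]/(2%:R) -mpolyC_nat -mpolyCM; congr (_%:MP).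
    by field.
  have e2 : e%:MP ^+ 2 = 1 :> {mpoly R[m]} by rewrite -rmorphXn /= e1.
  rewrite -mulrA; congr (_ * _).
  transitivity (1 - 'X_i ^+ 2 + (1 + 2 * (e%:MP * 'X_i) + e%:MP ^+ 2 * 'X_i ^+ 2)
    : {mpoly R[m]}); last by ring.
  by rewrite e2; ring.
apply: smiZ; first by rewrite invr_ge0 ler0n.
apply: smiD; first exact: ideal_smi.
apply: sos_smi; apply: sosD; first exact: sos_sq.
by apply: sos_sum => j _; exact: sos_sq.
Qed.

(* In the variables [(1 + x_i) / 2] a polynomial that is positive on the cube has
   nonnegative Bernstein coefficients once the degree is large, and the factors
   [(1 + x_i) / 2] and [(1 - x_i) / 2] are sums of squares on the sphere. *)
Lemma cube_pos_smi p : (forall u, cube u -> 0 < p.@[u ord0]) ->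
  sos_mod_ideal h p.
Proof.
move=> ppos.
have [c c0 pc] := compact_pos_lb compact_cube (@continuous_meval R m p) ppos.
(* The substitution x = 2 t - 1 moves the cube to [0, 1]^m, where the Bernstein basis lives; [T i]
   is its inverse. *)
pose lq := [tuple (2 : R) *: 'X_i - 1 | i < m] : m.-tuple {mpoly R[m]}.
pose T i : {mpoly R[m]} := 2^-1%:MP * (1 + 1 *: 'X_i).
pose lt := [tuple T i | i < m].
pose q := p \mPo lq.
have TX i : (2 : R) *: T i - 1 = 'X_i.
  rewrite /T scale1r -mul_mpolyC mulrA -mpolyCM divff ?pnatr_eq0 // mul1r.
  by rewrite addrC addKr.
have qE : p = q \mPo lt.
  rewrite /q [X in X \mPo lt]comp_mpolyE raddf_sum /= {1}[p]mpolyE.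
  apply: eq_bigr => a _; rewrite comp_mpolyZ; congr (_ *: _).
  rewrite mpolyXE_id rmorph_prod /=; apply: eq_bigr => i _.
  rewrite rmorphXn /= tnth_mktuple comp_mpolyB comp_mpolyZ comp_mpolyXU comp_mpoly1.
  by rewrite -tnth_nth tnth_mktuple TX.
have qpos (t : 'rV[R]_m) : (forall i, 0 <= t ord0 i <= 1) -> c <= q.@[t ord0].
  move=> t01; rewrite /q comp_mpoly_meval.
  have -> : p.@[fun i => (tnth lq i).@[t ord0]] =
            p.@[(\row_i (2 * t ord0 i - 1)) ord0].
    apply: meval_eq => i; rewrite tnth_mktuple mxE mevalB meval1 mevalZ.
    by rewrite mevalXU.
  by apply: pc => i; rewrite mxE ler_norml; have := t01 i; lra.
pose B := \sum_(a <- msupp q) `|q@_a|.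
have B0 : 0 <= B by apply: sumr_ge0 => a _; exact: normr_ge0.
(* With m factors per monomial and B the sum of the absolute coefficients, this precision keeps the
   error m B e of a Bernstein coefficient below c. *)
pose e := c / (m%:R * B + 1).
have mB : 0 < m%:R * B + 1 by rewrite ltr_wpDl // mulr_ge0 ?ler0n.
have e0' : 0 < e by rewrite divr_gt0.
have [N HN] : exists N, forall a, a \in msupp q -> forall i j, (j <= N)%N ->
    (a i <= N)%N /\ `|binratio N j (a i) - (j%:R / N%:R) ^+ a i| <= e.
  have [N HN] : exists N, forall N' a, (N <= N')%N -> a \in msupp q ->
      forall i j, (j <= N')%N ->
      (a i <= N')%N /\ `|binratio N' j (a i) - (j%:R / N'%:R) ^+ a i| <= e.
    have [g gP] := choice (fun k => binratio_cvg k e0').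
    exists (\sum_(a <- msupp q) \sum_(i < m) g (a i))%N => N' a NN' aq i j jN.
    apply: gP => //; apply: leq_trans NN'.
    by rewrite (big_rem a) //= (bigD1 i) //= -addnA leq_addr.
  by exists N => a aq; exact: HN.
pose W (g : {ffun 'I_m -> 'I_N.+1}) : {mpoly R[m]} :=
  \prod_(i < m) ('C(N, g i)%:R%:MP * (T i ^+ g i * (1 - T i) ^+ (N - g i))).
pose b (g : {ffun 'I_m -> 'I_N.+1}) : R :=
  \sum_(a <- msupp q) q@_a * \prod_(i < m) binratio N (g i) (a i).
have pE : p = \sum_g b g *: W g.
  rewrite qE comp_mpolyE.
  under [RHS]eq_bigr do rewrite scaler_suml.
  rewrite exchange_big /= big_seq [RHS]big_seq; apply: eq_bigr => a aq.
  under [RHS]eq_bigr do rewrite -scalerA.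
  rewrite -scaler_sumr; congr (_ *: _).
  transitivity (\prod_(i < m) \sum_(j < N.+1) (binratio N j (a i) *:
     ('C(N, j)%:R%:MP * (T i ^+ j * (1 - T i) ^+ (N - j)))) : {mpoly R[m]}).
    apply: eq_bigr => i _; rewrite tnth_mktuple.
    have [aN _] := HN a aq i 0%N (leq0n _).
    have NC0 : ('C(N, a i)%:R : R) != 0 by rewrite pnatr_eq0 -lt0n bin_gt0.
    rewrite -[LHS](scalerK NC0) scaler_nat (bernstein_expr _ aN) scaler_sumr.
    apply: eq_bigr => j _; rewrite -(scaler_nat ('C(j, a i) * 'C(N, j))) scalerA natrM.
    rewrite (mul_mpolyC 'C(N, j)%:R) scalerA.
    by congr (_ *: _); rewrite /binratio; ring.
  rewrite bigA_distr_bigA /=; apply: eq_bigr => g _.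
  by rewrite scaler_prod.
rewrite pE; apply: smi_sum => g _; apply: smiZ; last first.
  apply: smi_prod => i _; apply: smiM; first exact/sos_smi/sosC/ler0n.
  apply: smiM; apply: smiX; first by apply: smi_half; rewrite expr1n.
  have -> : 1 - T i = 2^-1%:MP * (1 + (- 1) *: 'X_i).
    transitivity (2^-1%:MP * (1 - (2 *: T i - 1)) : {mpoly R[m]}); last first.
      by rewrite TX scaleN1r.
    have -> : 1 - ((2 : R) *: T i - 1) = 2%:MP * (1 - T i).
      by rewrite -mul_mpolyC (mpolyC_nat _ _ 2); ring.
    by rewrite mulrA -mpolyCM mulVf ?pnatr_eq0 // mul1r.
  by apply: smi_half; rewrite sqrrN expr1n.
(* Each Bernstein coefficient is within c of the value of [q] at its grid point, and that value is
   at least c. *)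
pose t : 'rV[R]_m := \row_i ((g i)%:R / N%:R).
have t01 i : 0 <= t ord0 i <= 1.
  rewrite mxE divr_ge0 ?ler0n //=.
  have gN : (g i <= N)%N by rewrite -ltnS.
  have [N0|N0] := posnP N.
    have -> : (N%:R : R)^-1 = 0 by rewrite N0 invr0.
    by rewrite mulr0 ler01.
  by rewrite ler_pdivrMr ?ltr0n // mul1r ler_nat.
have : `|b g - q.@[t ord0]| <= c.
  rewrite mevalE /b -sumrB.
  apply: le_trans (ler_norm_sum _ _ _) _.
  apply: (@le_trans _ _ (\sum_(a <- msupp q) `|q@_a| * (m%:R * e))).
    rewrite big_seq [leRHS]big_seq; apply: ler_sum => a aq.
    rewrite -mulrBr normrM ler_wpM2l ?normr_ge0 //.
    have := @ler_norm_prod_sub R _ (index_enum 'I_m)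
      (fun i => binratio N (g i) (a i)) (fun i => t ord0 i ^+ a i) e.
    have -> : size (index_enum 'I_m) = m.
      by rewrite [index_enum _]unlock -enumT size_enum_ord.
    apply.
    - move=> i; have gN : (g i <= N)%N by rewrite -ltnS.
      by have [aN _] := HN a aq i (g i) gN; exact: binratio_itv.
    - move=> i; have /andP[t0 t1] := t01 i.
      by rewrite exprn_ge0 //= exprn_ile1.
    - move=> i; have gN : (g i <= N)%N by rewrite -ltnS.
      by have [_] := HN a aq i (g i) gN; rewrite mxE.
  rewrite -mulr_suml -/B /e mulrA mulrCA mulrA ler_pdivrMr //.
  by have := mulr_ge0 (ler0n R m) B0; nra.
rewrite ler_norml => /andP[+ _]; have := qpos t t01; lra.
Qed.

End BoxPositivity.

(** * Putinar's theorem *)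

Lemma meval_sum {R : realType} {m : nat} (v : 'I_m -> R) (J : Type) (r : seq J)
    (P : pred J) (F : J -> {mpoly R[m]}) :
  (\sum_(j <- r | P j) F j).@[v] = \sum_(j <- r | P j) (F j).@[v].
Proof. exact: (raddf_sum (meval v)). Qed.

Lemma meval_prod {R : realType} {m : nat} (v : 'I_m -> R) (J : Type) (r : seq J)
    (P : pred J) (F : J -> {mpoly R[m]}) :
  (\prod_(j <- r | P j) F j).@[v] = \prod_(j <- r | P j) (F j).@[v].
Proof. exact: (rmorph_prod (meval v)). Qed.

Lemma mevalXn {R : realType} {m : nat} (v : 'I_m -> R) (p : {mpoly R[m]}) k :
  (p ^+ k).@[v] = p.@[v] ^+ k.
Proof. exact: (rmorphXn (meval v)). Qed.

Section Putinar.
Context {R : realType}.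

Lemma bernoulli_le (s : R) (M : nat) : 0 <= s -> 1 + M%:R * s <= (1 + s) ^+ M.
Proof.
move=> s0; elim: M => [|M IH]; first by rewrite mul0r addr0 expr0.
rewrite exprS -natr1; apply: (@le_trans _ _ ((1 + s) * (1 + M%:R * s))).
  by have := mulr_ge0 (ler0n R M) (mulr_ge0 s0 s0); nra.
by rewrite ler_pM2l // ltr_pwDl.
Qed.

(** Put M = 2 N and s = g / C. For g >= 0, Bernoulli and (1 - s)^M (1 + s)^M <= 1 give s (1 - s)^M
    <= 1 / M. For g < 0, Bernoulli gives (1 - s)^M >= 1 - M s, the source of the quadratic term. *)
Lemma penalty_le (C g : R) (N : nat) : 0 < C -> (0 < N)%N -> `|g| <= C ->
  g * (1 - g / C) ^+ (2 * N) <=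
    C / (2 * N)%:R - (2 * N)%:R / C * ((`|g| - g) / 2) ^+ 2.
Proof.
move=> C0 N0 gC; set M := (2 * N)%N.
have M0 : 0 < M%:R :> R by rewrite ltr0n muln_gt0.
have [g0|g0] := leP 0 g.
  rewrite ger0_norm // subrr mul0r expr0n /= mulr0 subr0.
  rewrite ger0_norm // in gC.
  set s := g / C; have s0 : 0 <= s by rewrite divr_ge0 // ltW.
  have s1 : s <= 1 by rewrite ler_pdivrMr // mul1r.
  have -> : g = C * s by rewrite mulrC divfK // gt_eqF.
  rewrite -mulrA ler_pM2l //.
  rewrite -[leRHS]div1r ler_pdivlMr //.
  have h1 : 0 <= (1 - s) ^+ M by rewrite exprn_ge0 // subr_ge0.
  apply: (@le_trans _ _ ((1 - s) ^+ M * (1 + M%:R * s))); first by nra.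
  apply: (@le_trans _ _ ((1 - s) ^+ M * (1 + s) ^+ M)).
    by rewrite ler_wpM2l // bernoulli_le.
  rewrite -exprMn; apply: exprn_ile1; nra.
rewrite ltr0_norm //.
have -> : (- g - g) / 2 = - g by field.
rewrite sqrrN.
have s0 : 0 <= - g / C by apply: divr_ge0; rewrite ?oppr_ge0; exact: ltW.
have := bernoulli_le M s0; rewrite mulNr => b.
apply: (@le_trans _ _ (g * (1 + M%:R * (- (g / C))))).
  by rewrite ler_nM2l // b.
have -> : g * (1 + M%:R * - (g / C)) = g - M%:R / C * g ^+ 2.
  by field; rewrite gt_eqF.
by rewrite lerD2r (le_trans (ltW g0)) // divr_ge0 // ltW.
Qed.

Context {m : nat} {E I : finType}.
Variables (h : E + I -> {mpoly R[m]}) (e0 : E).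
Hypothesis he0 : h (inl e0) = \sum_(i < m) 'X_i ^+ 2 - 1.
Implicit Types p : {mpoly R[m]}.

(** [(|t| - t) / 2] is the negative part of t, so this is the exterior quadratic penalty of the
    constraints. *)
Definition violation (u : 'rV[R]_m) : R :=
  \sum_(i : E) (h (inl i)).@[u ord0] ^+ 2 +
  \sum_(j : I) ((`|(h (inr j)).@[u ord0]| - (h (inr j)).@[u ord0]) / 2) ^+ 2.

Lemma continuous_violation : continuous violation.
Proof.
have cX (f : 'rV[R]_m -> R) : continuous f -> continuous (fun x => f x ^+ 2).
  move=> cf; have -> : (fun x => f x ^+ 2) = (fun x => f x * f x).
    by apply/funext => x; rewrite expr2.
  exact: continuous_mulr.
apply: continuous_addr; apply: continuous_sumr => i; apply: cX.
  exact: continuous_meval.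
apply: continuous_mulr; last exact: continuous_constr.
apply: continuous_addr => x.
  apply: (@continuous_comp _ _ _ (fun u : 'rV[R]_m => (h (inr i)).@[u ord0])
    (fun x : R => `|x|)).
    exact: continuous_meval.
  exact: norm_continuous.
have -> : (fun x : 'rV[R]_m => - (h (inr i)).@[x ord0]) =
          (fun x => (- h (inr i)).@[x ord0]).
  by apply/funext => y; rewrite mevalN.
exact: continuous_meval.
Qed.

Lemma violation_ge0 u : 0 <= violation u.
Proof. by rewrite addr_ge0 //; apply: sumr_ge0 => i _; exact: sqr_ge0. Qed.

Lemma violation_eq0 u : violation u = 0 -> feasible h u.
Proof.
move/eqP; rewrite paddr_eq0; first last.
- by apply: sumr_ge0 => i _; exact: sqr_ge0.
- by apply: sumr_ge0 => i _; exact: sqr_ge0.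
rewrite !psumr_eq0; try by move=> i _; exact: sqr_ge0.
case/andP => /allP h1 /allP h2; split => i.
  by have := h1 i (mem_index_enum i); rewrite /= sqrf_eq0 => /eqP.
have := h2 i (mem_index_enum i).
rewrite /= sqrf_eq0 mulf_eq0 invr_eq0 pnatr_eq0 orbF subr_eq0 => /eqP <-.
exact: normr_ge0.
Qed.

(* For large [N], [p - \sum_j g_j (1 - g_j / C)^(2 N) + N \sum_i h_i^2] is positive
   on the whole cube: the terms with [g_j >= 0] are small and those with [g_j < 0]
   are of order [N g_j^2]. *)
Theorem putinar p : (forall u, feasible h u -> 0 < p.@[u ord0]) -> qmodule h p.
Proof.
move=> ppos.
have cc := @compact_cube R m.
have [|t [c [t0 c0 tc]]] := compact_penalty cc (@continuous_meval R m p)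
    continuous_violation (fun x _ => violation_ge0 x).
  by move=> x _ /violation_eq0; exact: ppos.
have [C C2 hC] : exists2 C : R, 2 <= C &
    forall j u, cube u -> `|(h (inr j)).@[u ord0]| <= C.
  have /choice[b bP] : forall j : I, exists b : R, 0 < b /\
      forall u, cube u -> `|(h (inr j)).@[u ord0]| <= b.
    move=> j; have [b b0 hb] := compact_bound cc (@continuous_meval R m (h (inr j))).
    by exists b.
  exists (2 + \sum_j b j); first by rewrite lerDl sumr_ge0 // => j _; case: (bP j) => /ltW.
  move=> j u /(proj2 (bP j)) /le_trans; apply.
  rewrite (bigD1 j) //= addrCA lerDl addr_ge0 // sumr_ge0 // => k _.
  by case: (bP k) => /ltW.
have C0 : 0 < C by apply: lt_le_trans C2.
(* N > t C makes both penalty weights 2 N / C and N at least t, the second since C >= 2; N > #|I| C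
   / c keeps the #|I| error terms C / (2 N) below c in total. *)
pose N := (Num.bound (t * C + #|I|%:R * C / c)).+1.
have NB : t * C + #|I|%:R * C / c < N%:R.
  rewrite /N -natr1; apply: (@lt_trans _ _ (Num.bound (t * C + #|I|%:R * C / c))%:R).
    apply: archi_boundP; rewrite addr_ge0 ?mulr_ge0 ?invr_ge0 ?ler0n //; exact: ltW.
  by rewrite ltrDl.
have NC0 : 0 <= #|I|%:R * C / c by rewrite !mulr_ge0 ?invr_ge0 ?ler0n // ltW.
have tC0 : 0 <= t * C by rewrite mulr_ge0 // ltW.
pose G j : {mpoly R[m]} := h (inr j) * ((1 - C^-1%:MP * h (inr j)) ^+ N) ^+ 2.
pose P : {mpoly R[m]} := p - \sum_j G j + N%:R%:MP * \sum_i h (inl i) ^+ 2.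
have -> : p = P + (\sum_j G j + \sum_i h (inl i) * (- (N%:R%:MP * h (inl i)))).
  rewrite /P; under [X in _ = _ + (_ + X)]eq_bigr do
    rewrite mulrN mulrCA -expr2.
  by rewrite sumrN -mulr_sumr; ring.
apply: qmoduleD; last first.
  apply: qmoduleD; apply: qmodule_sum => j _; last exact: ideal_qmodule.
  by apply: ineq_qmodule; exact: sos_sq.
apply: smi_qmodule; apply: (cube_pos_smi he0) => u uc.
have N0 : 0 < N%:R :> R by rewrite ltr0n.
have PE : P.@[u ord0] = p.@[u ord0] - \sum_j (h (inr j)).@[u ord0] *
    (1 - (h (inr j)).@[u ord0] / C) ^+ (2 * N) +
    N%:R * \sum_i (h (inl i)).@[u ord0] ^+ 2.
  rewrite /P mevalD mevalB mevalM mevalC !meval_sum; congr (_ - _ + _ * _).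
    apply: eq_bigr => j _; rewrite /G mevalM !mevalXn mevalB meval1 mevalM mevalC.
    by rewrite -exprM [(N * 2)%N]mulnC [C^-1 * _]mulrC.
  by apply: eq_bigr => i _; rewrite mevalXn.
rewrite PE; set S := \sum_(i : E) _; set T := \sum_(j : I) _.
set V := \sum_(j : I) ((`|(h (inr j)).@[u ord0]| - (h (inr j)).@[u ord0]) / 2) ^+ 2.
have TV : T <= #|I|%:R * (C / (2 * N)%:R) - (2 * N)%:R / C * V.
  rewrite mulrC mulr_natr /T /V mulr_sumr -sumr_const -sumrB.
  by apply: ler_sum => j _; apply: penalty_le => //; exact: hC.
have VT : c <= p.@[u ord0] + t * (S + V) by exact: (tc t (lexx t) u uc).
have S0 : 0 <= S by apply: sumr_ge0 => i _; exact: sqr_ge0.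
have V0 : 0 <= V by apply: sumr_ge0 => i _; exact: sqr_ge0.
have a1 : t <= (2 * N)%:R / C by rewrite ler_pdivlMr // natrM; nra.
have a2 : t <= N%:R by nra.
have a3 : #|I|%:R * (C / (2 * N)%:R) < c.
  rewrite mulrA ltr_pdivrMr ?ltr0n // natrM.
  move: NB; rewrite -ltrBrDl ltr_pdivrMr //; nra.
have := ler_wpM2r V0 a1; have := ler_wpM2r S0 a2; lra.
Qed.

End Putinar.

(** * From local to global certificates *)

Section Division.
Context {R : realType} {m : nat} {E I : finType}.
Variables (h : E + I -> {mpoly R[m]}) (e0 : E).
Hypothesis he0 : h (inl e0) = \sum_(i < m) 'X_i ^+ 2 - 1.
Implicit Types p : {mpoly R[m]}.

Lemma compact_feasible : compact (feasible h).
Proof.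
have -> : feasible h = cube `&` [set u | violation h u = 0].
  apply/seteqP; split => u /=; last by case=> _ /violation_eq0.
  move=> fu; split; first exact: (feasible_cube he0).
  case: fu => hE hI; rewrite /violation !big1 ?addr0 // => i _.
    by rewrite ger0_norm // subrr mul0r expr0n.
  by rewrite hE expr0n.
by apply: compact_level; [exact: compact_cube|exact: continuous_violation].
Qed.

Lemma expr_lt_eps (s e : R) : 0 < s <= 1 -> 0 < e ->
  exists N, (1 - s) ^+ N < e.
Proof.
move=> /andP[s0 s1] e0'; pose N := Num.bound ((e * s)^-1); exists N.
have NB : (e * s)^-1 < N%:R.
  by apply: archi_boundP; rewrite invr_ge0 mulr_ge0 // ltW.
have b := bernoulli_le N (ltW s0).
have x0 : 0 <= (1 - s) ^+ N by rewrite exprn_ge0 // subr_ge0.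
have : (1 - s) ^+ N * (1 + s) ^+ N <= 1.
  by rewrite -exprMn; apply: exprn_ile1; nra.
have es : 0 < e * s by exact: mulr_gt0.
move: NB; rewrite -div1r ltr_pdivrMr // => NB xy.
rewrite ltNge; apply/negP => ex.
have Ns : 0 <= N%:R * s by rewrite mulr_ge0 // ltW.
have := ler_wpM2l x0 b; have := ler_wpM2r Ns ex; lra.
Qed.

(* With [w = (1 - D / C)^L] and [1 - w^2 = D v],
   [F = w^2 (F - D Y + B D^2) + D (v F + w^2 (Y - B D))],
   and the last bracket is positive on the feasible set for large [L]. *)
Theorem qmodule_of_local (F D Y : {mpoly R[m]}) (B : R) : sos D ->
  (forall u, feasible h u -> 0 <= F.@[u ord0]) ->
  (forall u, feasible h u -> F.@[u ord0] = 0 -> D.@[u ord0] = 0) ->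
  (forall u, feasible h u -> D.@[u ord0] = 0 -> 0 < Y.@[u ord0]) ->
  qmodule h (F - D * Y + B%:MP * D ^+ 2) -> qmodule h F.
Proof.
move=> sD F0 FD DY QF; have cK := compact_feasible.
have [b b0 Db] := compact_bound cK (@continuous_meval R m D).
have D0 (u : 'rV[R]_m) : 0 <= D.@[u ord0] by exact: sos_ge0.
(* Twice the bound of [D], so that 1 - D / C lies between 1/2 and 1 on the feasible set. *)
pose C := 2 * b; have C0 : 0 < C by rewrite mulr_gt0.
(* [Z] is where Y - B D may be negative. It contains no zero of [D], hence none of [F], so both are
   bounded below there. *)
have cZ := compact_sublevel (c := 0) cK (@continuous_meval R m (Y - B%:MP * D)).
set Z := _ `&` _ in cZ.
have [eta eta0 Deta] : exists2 c, 0 < c & forall x, Z x -> c <= D.@[x ord0].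
  apply: compact_pos_lb cZ (@continuous_meval R m D) _ => x [Kx /= Yx].
  rewrite lt_def D0 andbT; apply/eqP => Dx.
  have := DY _ Kx Dx; move: Yx; rewrite mevalB mevalM Dx mulr0; lra.
have [c c0 Fc] : exists2 c, 0 < c & forall x, Z x -> c <= F.@[x ord0].
  apply: compact_pos_lb cZ (@continuous_meval R m F) _ => x Zx.
  have [Kx _] := Zx; rewrite lt_def F0 // andbT; apply/eqP => /(FD _ Kx) Dx.
  by have := Deta _ Zx; rewrite Dx; lra.
have [b' b0' Yb] := compact_bound cZ (@continuous_meval R m (Y - B%:MP * D)).
pose s := Num.min 1 (eta / C).
have s01 : 0 < s <= 1 by rewrite lt_min ltr01 divr_gt0 //= ge_min lexx.
(* On [Z], 1 - D / C <= 1 - s pushes w^2 below this threshold, whence w^2 |Y - B D| < c / C <= v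
   F. *)
have e0' : 0 < c / C / b' by rewrite !divr_gt0.
have [L HL] := expr_lt_eps s01 e0'.
pose r : {mpoly R[m]} := 1 - C^-1%:MP * D.
pose v : {mpoly R[m]} := C^-1%:MP * \sum_(i < 2 * L.+1) r ^+ i.
have vD : 1 - (r ^+ L.+1) ^+ 2 = D * v.
  rewrite -exprM mulnC.
  have := subrX1 r (2 * L.+1) => H.
  transitivity (- ((r - 1) * \sum_(i < 2 * L.+1) r ^+ i)).
    by rewrite -H; ring.
  by rewrite /v /r; ring.
have -> : F = (r ^+ L.+1) ^+ 2 * (F - D * Y + B%:MP * D ^+ 2) +
    D * (v * F + (r ^+ L.+1) ^+ 2 * (Y - B%:MP * D)).
  transitivity ((r ^+ L.+1) ^+ 2 * F + (D * v) * F); last by ring.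
  by rewrite -vD; ring.
apply: qmoduleD; apply: sos_qmoduleM => //; first exact: sos_sq.
apply: (putinar he0) => u Ku.
have ru : r.@[u ord0] = 1 - D.@[u ord0] / C.
  by rewrite /r mevalB meval1 mevalM mevalC mulrC.
have Du1 : D.@[u ord0] / C <= 2^-1.
  rewrite ler_pdivrMr // /C mulrA mulVf ?pnatr_eq0 // mul1r.
  by apply: le_trans (ler_norm _) _; exact: Db.
have Du0 : 0 <= D.@[u ord0] / C by rewrite divr_ge0 // ltW.
have vu : C^-1 <= v.@[u ord0].
  rewrite /v mevalM mevalC meval_sum mulnS big_ord_recl /= expr0 meval1.
  rewrite mulrDr mulr1 lerDl mulr_ge0 ?invr_ge0 ?(ltW C0) // sumr_ge0 // => i _.
  by rewrite mevalXn exprn_ge0 // ru; lra.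
rewrite mevalD (mevalM _ v F) (mevalM _ ((r ^+ L.+1) ^+ 2)).
rewrite (mevalXn _ (r ^+ L.+1)) (mevalXn _ r).
have Fu := F0 _ Ku.
have Ci : 0 < C^-1 by rewrite invr_gt0.
have vF : C^-1 * F.@[u ord0] <= v.@[u ord0] * F.@[u ord0] by rewrite ler_wpM2r.
have [Yu|Yu] := leP (Y - B%:MP * D).@[u ord0] 0; last first.
  apply: ltr_wpDl.
    by apply: le_trans vF; apply: mulr_ge0 => //; exact: ltW.
  by apply: mulr_gt0 => //; rewrite !exprn_gt0 // ru; lra.
have Zu : Z u by [].
have := Deta _ Zu; have := Fc _ Zu; have := Yb _ Zu.
rewrite ler_norml => /andP[Yb' _] Fc' De.
have rs : 0 <= r.@[u ord0] <= 1 - s.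
  rewrite ru; apply/andP; split; first by lra.
  rewrite lerD2l lerN2 ge_min; apply/orP; right.
  by rewrite ler_pM2r ?invr_gt0.
have /andP[r0 r1] := rs; have /andP[sp sl] := s01.
have rL : (r.@[u ord0] ^+ L.+1) ^+ 2 < c / C / b'.
  apply: le_lt_trans HL; rewrite -exprM.
  have s1 : 0 <= 1 - s by lra.
  apply: (@le_trans _ _ (r.@[u ord0] ^+ L)).
    by apply: ler_wiXn2l; [lra|lra|exact: (leq_trans (leqnSn L) (leq_pmulr _ _))].
  by apply: lerXn2r.
set w2 := (r.@[u ord0] ^+ L.+1) ^+ 2 in rL *.
have w20 : 0 <= w2 by exact: sqr_ge0.
have : w2 * b' < c / C by rewrite -ltr_pdivlMr.
have : C^-1 * c <= C^-1 * F.@[u ord0] by rewrite ler_pM2l.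
have := ler_wpM2l w20 Yb'.
rewrite [c / C]mulrC mulrN; lra.
Qed.

End Division.

(** * Polynomial expansions around a point *)

Section LocalCoordinates.
Context {R : realType} {m : nat}.
Implicit Types (p : {mpoly R[m]}) (u : 'rV[R]_m).

Definition centered u (a : 'I_m) : {mpoly R[m]} := 'X_a - (u ord0 a)%:MP.

Definition dist2 u : {mpoly R[m]} := \sum_a centered u a ^+ 2.

Lemma meval_centered u (v : 'rV[R]_m) a : (centered u a).@[v ord0] = v ord0 a - u ord0 a.
Proof. by rewrite mevalB mevalXU mevalC. Qed.

Lemma meval_dist2 u (v : 'rV[R]_m) :
  (dist2 u).@[v ord0] = \sum_a (v ord0 a - u ord0 a) ^+ 2.
Proof. by rewrite meval_sum; apply: eq_bigr => a _; rewrite mevalXn meval_centered. Qed.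

Lemma dist2_sos u : sos (dist2 u).
Proof. by apply: sos_sum => a _; exact: sos_sq. Qed.

Lemma dist2_eq0 u (v : 'rV[R]_m) : (dist2 u).@[v ord0] = 0 -> v = u.
Proof.
rewrite meval_dist2 => /eqP; rewrite psumr_eq0; last by move=> i _; exact: sqr_ge0.
move=> /allP H; apply/rowP => a; have := H a (mem_index_enum a).
by rewrite /= sqrf_eq0 subr_eq0 => /eqP.
Qed.

Lemma dist2_id u : (dist2 u).@[u ord0] = 0.
Proof. by rewrite meval_dist2 big1 // => a _; rewrite subrr expr0n. Qed.

(** The polynomials with such an expansion include constants and variables and are closed under sums
    and products. *)
Lemma hadamard p u : exists r : 'I_m -> {mpoly R[m]},
  p = (p.@[u ord0])%:MP + \sum_a centered u a * r a.
Proof.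
pose P q := exists r : 'I_m -> {mpoly R[m]},
  q = (q.@[u ord0])%:MP + \sum_a centered u a * r a.
have PC c : P c%:MP.
  exists (fun=> 0); rewrite mevalC big1 ?addr0 // => a _; exact: mulr0.
have PD q1 q2 : P q1 -> P q2 -> P (q1 + q2).
  move=> [r1 e1] [r2 e2]; exists (fun a => r1 a + r2 a).
  rewrite mevalD mpolyCD {1}e1 {1}e2; under [in RHS]eq_bigr do rewrite mulrDr.
  by rewrite big_split /=; ring.
have PM q1 q2 : P q1 -> P q2 -> P (q1 * q2).
  move=> [r1 e1] [r2 e2].
  exists (fun a => r1 a * q2 + (q1.@[u ord0])%:MP * r2 a).
  under [in RHS]eq_bigr do rewrite mulrDr mulrA mulrCA.
  rewrite big_split /= -mulr_suml -mulr_sumr mevalM mpolyCM.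
  have -> : \sum_a centered u a * r1 a = q1 - (q1.@[u ord0])%:MP.
    by rewrite {1}e1 addrC addKr.
  have -> : \sum_a centered u a * r2 a = q2 - (q2.@[u ord0])%:MP.
    by rewrite {1}e2 addrC addKr.
  by ring.
have PX i : P 'X_i.
  exists (fun a => (a == i)%:R).
  rewrite (bigD1 i) //= eqxx mulr1 big1 ?addr0.
    by rewrite mevalXU /centered addrC subrK.
  by move=> a /negbTE ->; rewrite mulr0.
suff : P p by [].
rewrite [p]mpolyE; apply: big_ind; [by have := PC 0; rewrite mpolyC0|exact: PD|].
move=> a _; rewrite -mul_mpolyC; apply: (PM) => //.
rewrite mpolyXE_id; apply: big_ind; [by have := PC 1; rewrite mpolyC1|exact: PM|].
move=> i _; move: (a i) => k; elim: k => [|k IH]; first by have := PC 1; rewrite mpolyC1 expr0.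
by rewrite exprS; exact: PM.
Qed.

(** Lagrange's identity: the difference is half the sum of the (x_a y_b - x_b y_a)^2. *)
Lemma sos_lagrange (x y : 'I_m -> {mpoly R[m]}) :
  sos ((\sum_a x a ^+ 2) * (\sum_a y a ^+ 2) - (\sum_a x a * y a) ^+ 2).
Proof.
have -> : (\sum_a x a ^+ 2) * (\sum_a y a ^+ 2) - (\sum_a x a * y a) ^+ 2 =
  2^-1%:MP * \sum_a \sum_b (x a * y b - x b * y a) ^+ 2.
  have E : \sum_a \sum_b (x a * y b - x b * y a) ^+ 2 =
    2%:MP * ((\sum_a x a ^+ 2) * (\sum_a y a ^+ 2) - (\sum_a x a * y a) ^+ 2).
    transitivity (\sum_a \sum_b (x a ^+ 2 * y b ^+ 2) +
       \sum_a \sum_b (y a ^+ 2 * x b ^+ 2) -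
       2 * \sum_a \sum_b ((x a * y a) * (x b * y b))).
      rewrite mulr_sumr -sumrN -!big_split /=; apply: eq_bigr => a _.
      rewrite mulr_sumr -sumrN -!big_split /=; apply: eq_bigr => b _.
      by ring.
    under eq_bigr do rewrite -mulr_sumr.
    under [X in _ + X - _]eq_bigr do rewrite -mulr_sumr.
    under [X in _ - _ * X]eq_bigr do rewrite -mulr_sumr.
    rewrite -!mulr_suml (mpolyC_nat _ _ 2).
    by ring.
  by rewrite E mulrA -mpolyCM mulVf ?pnatr_eq0 // mul1r.
apply: sosM; first by apply: sosC; rewrite invr_ge0.
by apply: sos_sum => a _; apply: sos_sum => b _; exact: sos_sq.
Qed.

(** Cauchy-Schwarz applied to the expansion given by [hadamard]. *)
Lemma vanish_sq_le p u : p.@[u ord0] = 0 ->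
  exists2 s, sos s & sos (dist2 u * s - p ^+ 2).
Proof.
move=> pu; have [r rE] := hadamard p u.
exists (\sum_a r a ^+ 2); first by apply: sos_sum => a _; exact: sos_sq.
rewrite {1}rE pu mpolyC0 add0r; exact: sos_lagrange.
Qed.

Lemma vanish_prod_sq_le (Z : seq 'rV[R]_m) (k : 'rV[R]_m -> {mpoly R[m]}) :
  (forall u, u \in Z -> (k u).@[u ord0] = 0) ->
  exists2 s, sos s &
    sos ((\prod_(u <- Z) dist2 u) * s - (\prod_(u <- Z) k u) ^+ 2).
Proof.
elim: Z => [|w Z IH] kZ.
  exists 1; first by rewrite -(expr1n _ 2); exact: sos_sq.
  by rewrite !big_nil mulr1 expr1n subrr; exact: sos0.
have [|s ss ds] := IH; first by move=> u uZ; apply: kZ; rewrite inE uZ orbT.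
have [t st dt] := vanish_sq_le (kZ w (mem_head w Z)).
exists (t * s); first exact: sosM.
rewrite !big_cons; set D := \prod_(u <- Z) _ in ds *; set P := \prod_(u <- Z) _ in ds *.
have -> : dist2 w * D * (t * s) - (k w * P) ^+ 2 =
  (dist2 w * t - k w ^+ 2) * (D * s) + k w ^+ 2 * (D * s - P ^+ 2) by ring.
apply: sosD; apply: sosM => //; last exact: sos_sq.
by apply: sosM => //; apply: sos_prod => u _; exact: dist2_sos.
Qed.

(** Telescoping: the cofactor of t_u is the product of the 1 - t_w over the w preceding u in the
    list; it is 1 at u since those t_w vanish there. *)
Lemma one_sub_prod (Z : seq 'rV[R]_m) (t : 'rV[R]_m -> {mpoly R[m]}) :
  uniq Z -> (forall u w, u \in Z -> w \in Z -> u != w -> (t u).@[w ord0] = 0) ->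
  exists c : 'rV[R]_m -> {mpoly R[m]},
    1 - \prod_(u <- Z) (1 - t u) = \sum_(u <- Z) t u * c u /\
    forall u, u \in Z -> (c u).@[u ord0] = 1.
Proof.
elim: Z => [|x Z IH] /=.
  by move=> _ _; exists (fun=> 0); rewrite !big_nil subrr.
case/andP => xZ uZ tZ; have [|c [cE c1]] := IH uZ.
  by move=> u w uZ' wZ'; apply: tZ; rewrite inE ?uZ' ?wZ' orbT.
exists (fun u => if u == x then 1 else (1 - t x) * c u); split.
  rewrite !big_cons eqxx mulr1.
  transitivity (t x + (1 - t x) * (1 - \prod_(u <- Z) (1 - t u))); first by ring.
  rewrite cE mulr_sumr; congr (_ + _); rewrite big_seq [RHS]big_seq.
  apply: eq_bigr => u uZ'; case: eqP => [ux|_]; last by rewrite mulrCA.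
  by move: xZ; rewrite -ux uZ'.
move=> u; rewrite inE; case: eqP => [_ _|/eqP ux /= uZ']; first exact: meval1.
rewrite mevalM c1 // mulr1 mevalB meval1 tZ ?subr0 ?mem_head //.
  by rewrite inE uZ' orbT.
by rewrite eq_sym.
Qed.

End LocalCoordinates.

(** * Gluing the certificates at finitely many zeros *)

Section Gluing.
Context {R : realType} {m : nat} {E I : finType}.
Variables (h : E + I -> {mpoly R[m]}) (e0 : E).
Hypothesis he0 : h (inl e0) = \sum_(i < m) 'X_i ^+ 2 - 1.
Implicit Types p : {mpoly R[m]}.

Definition locally_quadratic (F : {mpoly R[m]}) (u : 'rV[R]_m) : Prop :=
  exists d A : R, 0 < d /\ qmodule h (F - d%:MP * dist2 u + A%:MP * dist2 u ^+ 2).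

(* With [Q_u] the product of the [|x - w|^2] over [w != u] and [k_u] a polynomial
   vanishing at [u] such that [Q_u^2] divides [1 - k_u], one can write
   [1 - (\prod_u k_u)^4 = \sum_u Q_u^2 g_u] with [g_u > 0] at [u]; the remainder
   [(\prod_u k_u)^4 F] is absorbed by [D^2] because [k_u^2 <= |x - u|^2 s_u]. *)
Lemma glue_locally_quadratic (F : {mpoly R[m]}) (Z : seq 'rV[R]_m) : uniq Z ->
  (forall u, u \in Z -> F.@[u ord0] = 0) ->
  (forall u, u \in Z -> locally_quadratic F u) ->
  let D := \prod_(u <- Z) dist2 u in
  exists Y B, qmodule h (F - D * Y + B%:MP * D ^+ 2) /\
    forall u, u \in Z -> 0 < Y.@[u ord0].
Proof.
move=> uZ FZ good D.
have /choice[dA gA] : forall u : 'rV[R]_m, exists dA : R * R, u \in Z -> 0 < dA.1 /\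
    qmodule h (F - dA.1%:MP * dist2 u + dA.2%:MP * dist2 u ^+ 2).
  move=> u; have [uZ'|_] := boolP (u \in Z); last by exists (0, 0).
  by have [d [A H]] := good u uZ'; exists (d, A).
pose d (u : 'rV[R]_m) := (dA u).1; pose A (u : 'rV[R]_m) := (dA u).2.
pose Q (u : 'rV[R]_m) : {mpoly R[m]} := \prod_(w <- Z | w != u) dist2 w.
have DQ u : u \in Z -> D = dist2 u * Q u by move=> uZ'; rewrite /D (bigD1_seq u).
have sQ u : sos (Q u) by apply: sos_prod => w _; exact: dist2_sos.
have Q0 u w : w \in Z -> u != w -> (Q u).@[w ord0] = 0.
  move=> wZ uw; rewrite /Q (big_rem w) //= eq_sym uw.
  by rewrite mevalM dist2_id mul0r.
pose rho (u : 'rV[R]_m) := (Q u).@[u ord0].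
have rho0 u : u \in Z -> 0 < rho u.
  move=> _; rewrite /rho /Q meval_prod; apply: prodr_gt0 => w wu.
  rewrite lt_def (sos_ge0 _ (dist2_sos _)) andbT.
  by apply: contra wu => /eqP /dist2_eq0 ->.
(* Normalized by rho = Q_u(u): 1 - k_u = (Q_u / rho)^2 equals 1 at u and 0 at the other points of
   [Z]. *)
pose k (u : 'rV[R]_m) : {mpoly R[m]} := 1 - ((rho u)^-1 ^+ 2)%:MP * Q u ^+ 2.
have ku u : u \in Z -> (k u).@[u ord0] = 0.
  move=> /rho0 ru; rewrite mevalB meval1 mevalM mevalC mevalXn -/(rho u) -exprMn.
  by rewrite mulVf ?gt_eqF // expr1n subrr.
(* The fourth power serves the remainder: with P the product of the k_u, P^2 is bounded by D S, so
   it is P^4 that D^2 can absorb. *)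
have [|c [cE c1]] := @one_sub_prod _ _ Z (fun u => 1 - k u ^+ 4) uZ.
  move=> u w _ wZ uw.
  rewrite mevalB meval1 mevalXn mevalB meval1 mevalM mevalXn Q0 //.
  by rewrite expr0n /= mulr0 subr0 expr1n subrr.
pose g (u : 'rV[R]_m) : {mpoly R[m]} :=
  ((rho u)^-1 ^+ 2)%:MP * (1 + k u) * (1 + k u ^+ 2) * c u.
have tE u : (1 - k u ^+ 4) * c u = Q u ^+ 2 * g u.
  have kk : ((rho u)^-1 ^+ 2)%:MP * Q u ^+ 2 = 1 - k u by rewrite subKr.
  rewrite /g; transitivity ((((rho u)^-1 ^+ 2)%:MP * Q u ^+ 2) *
    ((1 + k u) * (1 + k u ^+ 2) * c u)); last by ring.
  by rewrite kk; ring.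
have gu u : u \in Z -> 0 < (g u).@[u ord0].
  move=> uZ'; rewrite /g !mevalM mevalC c1 // mulr1 (mevalD _ 1 (k u)) (mevalD _ 1 (k u ^+ 2)).
  rewrite meval1 mevalXn ku //.
  by rewrite expr0n /= !addr0 !mulr1 exprn_gt0 // invr_gt0 rho0.
(* g_u is known to be positive only at u; the added term makes it positive on the cube, hence an
   admissible factor for the certificate at u. *)
have /choice[al gal] : forall u : 'rV[R]_m, exists al, u \in Z ->
    sos_mod_ideal h (g u + al%:MP * dist2 u).
  move=> u; have [uZ'|_] := boolP (u \in Z); last by exists 0.
  have [||al [c' [_ c'0 H]]] := compact_penalty (@compact_cube R m)
      (@continuous_meval R m (g u)) (@continuous_meval R m (dist2 u)).
  - by move=> x _; apply: sos_ge0; exact: dist2_sos.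
  - by move=> x _ /dist2_eq0 ->; exact: gu.
  exists al => _; apply: (cube_pos_smi he0) => x cx.
  rewrite (mevalD _ (g u)) (mevalM _ al%:MP) mevalC; apply: lt_le_trans c'0 _; exact: H.
(* Read off by expanding Q_u^2 (g_u + al |x - u|^2) (F - d |x - u|^2 + A |x - u|^4): apart from
   Q_u^2 g_u F, every term is a multiple of Q_u^2 |x - u|^2 = D Q_u. *)
pose Y : {mpoly R[m]} := \sum_(u <- Z) Q u *
  ((g u + (al u)%:MP * dist2 u) * ((d u)%:MP - (A u)%:MP * dist2 u) - (al u)%:MP * F).
pose P : {mpoly R[m]} := \prod_(u <- Z) k u.
have [S sS DS] := vanish_prod_sq_le ku; rewrite -/P -/D in DS.
have sD : sos D by apply: sos_prod => u _; exact: dist2_sos.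
have q1 : qmodule h (F - D * Y - P ^+ 4 * F).
  have -> : F - D * Y - P ^+ 4 * F = \sum_(u <- Z) Q u ^+ 2 *
     ((g u + (al u)%:MP * dist2 u) *
      (F - (d u)%:MP * dist2 u + (A u)%:MP * dist2 u ^+ 2)).
    transitivity ((1 - \prod_(u <- Z) (1 - (1 - k u ^+ 4))) * F - D * Y).
      under [X in (1 - X) * F]eq_bigr do rewrite subKr.
      by rewrite prodrXl -/P; ring.
    rewrite cE mulr_suml /Y mulr_sumr -sumrB big_seq [RHS]big_seq.
    apply: eq_bigr => u uZ'; rewrite tE (DQ u uZ'); ring.
  rewrite big_seq; apply: qmodule_sum => u uZ'.
  apply: sos_qmoduleM; first exact: sos_sq.
  by apply: smi_qmoduleM; [exact: gal | have [] := gA u uZ'].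
have cK := compact_feasible he0.
have [b b0 Fb] := compact_bound cK (@continuous_meval R m F).
pose b1 := b + 1.
have [B B0 SB] := compact_bound cK (@continuous_meval R m (b1%:MP * S ^+ 2)).
exists Y, (B + 1); split.
  (* P^4 F = P^4 (F + b1) - b1 P^4 with F + b1 > 0 on the feasible set, and - b1 P^4 is a sum of
     squares minus b1 D^2 S^2, which (B + 1) D^2 dominates there. *)
  have -> : F - D * Y + (B + 1)%:MP * D ^+ 2 = (F - D * Y - P ^+ 4 * F) +
    ((P ^+ 2) ^+ 2 * (F + b1%:MP) + (b1%:MP * ((D * S - P ^+ 2) * (D * S + P ^+ 2)) +
     D ^+ 2 * ((B + 1)%:MP - b1%:MP * S ^+ 2))) by ring.
  apply: qmoduleD => //; apply: qmoduleD; last apply: qmoduleD.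
  - apply: sos_qmoduleM; first exact: sos_sq.
    apply: (putinar he0) => u Ku; rewrite mevalD mevalC /b1.
    by have := Fb u Ku; rewrite ler_norml => /andP[+ _]; lra.
  - apply: sos_qmodule; apply: sosM; first by apply: sosC; rewrite /b1; lra.
    apply: sosM => //; apply: sosD; [exact: sosM|exact: sos_sq].
  - apply: sos_qmoduleM; first exact: sos_sq.
    apply: (putinar he0) => u Ku; rewrite mevalB mevalC.
    by have := SB u Ku; rewrite ler_norml => /andP[_]; lra.
move=> w wZ; rewrite /Y meval_sum (bigD1_seq w) //= big1_seq ?addr0; last first.
  by move=> u /andP[uw _]; rewrite mevalM Q0 // mul0r.
rewrite mevalM mulr_gt0 //; first exact: rho0.
rewrite mevalB (mevalM _ (_ + _)) (mevalD _ (g w)) mevalB !(mevalM _ _%:MP).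
rewrite !mevalC dist2_id FZ // !mulr0 addr0 !subr0 mulr_gt0 ?gu //.
by case: (gA w wZ).
Qed.

End Gluing.

(** * Local certificates from second order conditions *)

Section Cholesky.
Context {R : realType}.

(** Induction by eliminating the first coordinate: testing on the vectors (- a^-1 v b^T, v) shows
    that the Schur complement is positive definite. The factor B displays the form as a sum of
    squares of linear forms. *)
Lemma cholesky N (M : 'M[R]_N) : M^T = M ->
  (forall v : 'rV[R]_N, v != 0 -> 0 < (v *m M *m v^T) ord0 ord0) ->
  exists B : 'M[R]_N, M = B^T *m B.
Proof.
elim: N M => [|N IH] M symM pdM; first by exists 0; apply/matrixP => -[].
move: M symM pdM; rewrite -[N.+1]/(1 + N)%N => M.
rewrite -[M]submxK; move: (ulsubmx M) (ursubmx M) (dlsubmx M) (drsubmx M).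
move=> a b b' C; rewrite tr_block_mx => /eq_block_mx [_ _ <- symC] pdM.
have [al aE] : exists al, a = al%:M by exists (a 0 0); exact: mx11_scalar.
have al0 : 0 < al.
  have := pdM (row_mx 1%:M 0); rewrite mul_row_block !mul1mx !mul0mx !addr0.
  rewrite tr_row_mx mul_row_col trmx0 mulmx0 addr0 trmx1 mulmx1 aE mxE eqxx mulr1n.
  apply; apply/eqP => /(congr1 (fun v : 'rV[R]_(1 + N) => lsubmx v 0 0)).
  by rewrite row_mxKl !mxE /=; apply/eqP; exact: oner_neq0.
have alN : al != 0 by rewrite gt_eqF.
pose C' := C - al^-1 *: (b^T *m b).
have [||B BE] := IH C'.
- by rewrite /C' raddfB /= linearZ /= trmx_mul trmxK symC.
- move=> v v0; have := pdM (row_mx (- (al^-1 *: (v *m b^T))) v).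
  rewrite mul_row_block tr_row_mx mul_row_col aE mul_mx_scalar scalerN scalerA.
  rewrite divff // scale1r addNr mul0mx add0r mulmxDl.
  rewrite /C' mulmxBr mulmxBl addrC mulNmx mulNmx -!scalemxAl -scalemxAr -!scalemxAl !mulmxA.
  apply; apply: contra v0 => /eqP /(congr1 (@rsubmx _ _ _ _)).
  by rewrite row_mxKr => ->; rewrite /rsubmx; apply/eqP/rowP => i; rewrite !mxE.
exists (block_mx (Num.sqrt al)%:M ((Num.sqrt al)^-1 *: b) 0 B).
have sN : Num.sqrt al != 0 by rewrite gt_eqF // sqrtr_gt0.
rewrite tr_block_mx mulmx_block tr_scalar_mx !trmx0 !mulmx0 !mul0mx !addr0.
rewrite -scalar_mxM -expr2 sqr_sqrtr ?ltW // aE; set r := Num.sqrt al in sN *.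
have -> : (r^-1 *: b)^T = r^-1 *: b^T by apply/matrixP => i j; rewrite !mxE.
rewrite mul_scalar_mx mul_mx_scalar !scalerA divff // !scale1r.
rewrite -scalemxAl -scalemxAr scalerA -invfM -expr2 sqr_sqrtr ?ltW //.
by rewrite -BE /C' addrC subrK.
Qed.

End Cholesky.

(** * Second order expansion with polynomial remainder *)

Section Taylor.
Context {R : realType} {m : nat}.
Implicit Types (p : {mpoly R[m]}) (u : 'rV[R]_m).

Lemma mderiv_sum (a : 'I_m) (J : Type) (r : seq J) (P : pred J)
    (f : J -> {mpoly R[m]}) :
  (\sum_(j <- r | P j) f j)^`M(a) = \sum_(j <- r | P j) (f j)^`M(a).
Proof. exact: (raddf_sum (mderiv a)). Qed.

Lemma mderiv_centered u (a b : 'I_m) : (centered u a)^`M(b) = (a == b)%:R.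
Proof.
rewrite mderivB mderivC subr0 mderivX mnm1E.
have [->|_] := eqVneq a b; last by rewrite scale0r.
have -> : (U_(b) - U_(b))%MM = 0%MM by apply/mnmP => i; rewrite mnmBE subnn mnm0E.
by rewrite scale1r mpolyX0.
Qed.

Lemma mderiv_centered_sum u (r : 'I_m -> {mpoly R[m]}) (c : 'I_m) :
  (\sum_a centered u a * r a)^`M(c) = r c + \sum_a centered u a * (r a)^`M(c).
Proof.
rewrite mderiv_sum; under eq_bigr do rewrite mderivM mderiv_centered.
rewrite big_split /=; congr (_ + _).
rewrite (bigD1 c) //= eqxx mul1r big1 ?addr0 // => a /negbTE ->.
by rewrite mul0r.
Qed.

Lemma meval_centered_sum u (r : 'I_m -> {mpoly R[m]}) :
  (\sum_a centered u a * r a).@[u ord0] = 0.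
Proof.
by rewrite meval_sum big1 // => a _; rewrite mevalM meval_centered subrr mul0r.
Qed.

Lemma taylor1 p u : p.@[u ord0] = 0 -> exists r : 'I_m -> {mpoly R[m]},
  p = \sum_a centered u a * r a /\
  forall c, (r c).@[u ord0] = (p^`M(c)).@[u ord0].
Proof.
move=> pu; have [r rE] := hadamard p u; exists r.
rewrite pu mpolyC0 add0r in rE; split=> // c.
by rewrite rE mderiv_centered_sum mevalD meval_centered_sum addr0.
Qed.

(** Applying [taylor1] twice gives coefficients s_ab. The second derivative at u determines only
    s_ab + s_ba, hence the symmetrization. *)
Lemma taylor2 p u : p.@[u ord0] = 0 -> (forall a, (p^`M(a)).@[u ord0] = 0) ->
  exists k : 'I_m -> 'I_m -> {mpoly R[m]},
    (forall a b, (k a b).@[u ord0] = 0) /\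
    p = \sum_a \sum_b centered u a * centered u b *
        ((2^-1 * (p^`M(a)^`M(b)).@[u ord0])%:MP + k a b).
Proof.
move=> pu dpu; have [r [rE r1]] := taylor1 pu.
have /choice[s sP] : forall a, exists s : 'I_m -> {mpoly R[m]},
    r a = \sum_b centered u b * s b /\
    forall c, (s c).@[u ord0] = ((r a)^`M(c)).@[u ord0].
  by move=> a; apply: taylor1; rewrite r1.
have ss a b : (s a b).@[u ord0] + (s b a).@[u ord0] = (p^`M(a)^`M(b)).@[u ord0].
  rewrite rE mderiv_centered_sum mderivD mderiv_centered_sum !mevalD.
  by rewrite meval_centered_sum addr0 !(proj2 (sP _)).
pose t a b : {mpoly R[m]} := 2^-1%:MP * (s a b + s b a).
exists (fun a b => t a b - (2^-1 * (p^`M(a)^`M(b)).@[u ord0])%:MP); split.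
  move=> a b; rewrite mevalB mevalC (mevalM _ 2^-1%:MP) mevalC mevalD ss.
  by rewrite subrr.
transitivity (\sum_a \sum_b centered u a * centered u b * t a b); last first.
  by apply: eq_bigr => a _; apply: eq_bigr => b _; ring.
have E : p = \sum_a \sum_b centered u a * centered u b * s a b.
  rewrite {1}rE; apply: eq_bigr => a _; rewrite (proj1 (sP a)) mulr_sumr.
  by apply: eq_bigr => b _; rewrite mulrA.
have E' : p = \sum_a \sum_b centered u a * centered u b * s b a.
  rewrite {1}E exchange_big /=; apply: eq_bigr => a _; apply: eq_bigr => b _.
  by rewrite [centered u b * _]mulrC.
have h2 : (2^-1%:MP + 2^-1%:MP : {mpoly R[m]}) = 1.
  rewrite -mpolyCD -mpolyC1; congr (_%:MP); by field.
rewrite -[p]mul1r -h2 mulrDl {1}E E' !mulr_sumr -big_split /=.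
apply: eq_bigr => a _; rewrite !mulr_sumr -big_split /=; apply: eq_bigr => b _.
by rewrite /t; ring.
Qed.

End Taylor.

Section QuadraticForms.
Context {R : realType} {m : nat}.
Implicit Types (v : 'rV[R]_m) (H : 'M[R]_m).

Lemma quadratic_formE H v :
  (v *m H *m v^T) ord0 ord0 = \sum_a \sum_b v ord0 a * v ord0 b * H a b.
Proof.
rewrite mxE exchange_big /=; apply: eq_bigr => b _; rewrite !mxE mulr_suml.
by apply: eq_bigr => a _; ring.
Qed.

Lemma continuous_quadratic_form H :
  continuous (fun v : 'rV[R]_m => (v *m H *m v^T) ord0 ord0).
Proof.
under eq_fun do rewrite quadratic_formE.
apply: continuous_sumr => a; apply: continuous_sumr => b.
apply: continuous_mulr; last exact: continuous_constr.
by apply: continuous_mulr; exact: coord_continuous.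
Qed.

(** Finsler's lemma: [compact_penalty] on the unit sphere, extended to all vectors by homogeneity of
    degree 2. *)
Lemma finsler (J : finType) (P : pred J) (c : J -> 'rV[R]_m) H :
  (forall v, v != 0 -> (forall j, P j -> (c j *m v^T) ord0 ord0 = 0) ->
    0 < (v *m H *m v^T) ord0 ord0) ->
  exists t e, [/\ 0 < t, 0 < e & forall v, e * \sum_a v ord0 a ^+ 2 <=
    (v *m H *m v^T) ord0 ord0 + t * \sum_(j | P j) (c j *m v^T) ord0 ord0 ^+ 2].
Proof.
move=> Hpd; pose nrm2 v := \sum_a v ord0 a ^+ 2.
have nrm2E v : nrm2 v = (v *m 1%:M *m v^T) ord0 ord0.
  by rewrite mulmx1 mxE; apply: eq_bigr => a _; rewrite mxE.
have cnrm : continuous nrm2.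
  by rewrite (funext nrm2E); exact: continuous_quadratic_form.
have cS : compact (cube `&` [set v : 'rV[R]_m | nrm2 v = 1]).
  by apply: compact_level => //; exact: compact_cube.
pose q v := \sum_(j | P j) (c j *m v^T) ord0 ord0 ^+ 2.
have qE v : q v = \sum_(j | P j) (v *m ((c j)^T *m c j) *m v^T) ord0 ord0.
  apply: eq_bigr => j _.
  have -> : v *m ((c j)^T *m c j) *m v^T = (c j *m v^T)^T *m (c j *m v^T).
    by rewrite trmx_mul trmxK !mulmxA.
  by rewrite [RHS]mxE big_ord1 [X in _ = X * _]mxE.
have cq : continuous q.
  rewrite (funext qE); under eq_fun do rewrite big_mkcond.
  apply: continuous_sumr => j; case: (P j); last exact: continuous_constr.
  exact: continuous_quadratic_form.
have q0 v : 0 <= q v by apply: sumr_ge0 => j _; exact: sqr_ge0.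
have [||t [e [t0 e0 te]]] := compact_penalty cS (continuous_quadratic_form (H := H)) cq.
- by move=> v _; exact: q0.
- move=> v [_ /= v1] /eqP; rewrite psumr_eq0 => [/allP qv|j _]; last exact: sqr_ge0.
  apply: Hpd.
    apply/eqP => v0; move: v1; rewrite /nrm2 big1 => [/eqP|a _].
      by rewrite eq_sym oner_eq0.
    by rewrite v0 mxE expr0n.
  move=> j Pj; have := qv j (mem_index_enum j).
  by rewrite Pj /= sqrf_eq0 => /eqP.
exists t, e; split=> // v.
have [->|v0] := eqVneq v 0.
  rewrite mul0mx mul0mx mxE add0r big1 => [|a _]; last by rewrite mxE expr0n.
  by rewrite mulr0; apply: mulr_ge0; [exact: ltW|exact: q0].
have n0 : 0 < nrm2 v.
  rewrite lt_def sumr_ge0 ?andbT => [|a _]; last exact: sqr_ge0.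
  apply: contra v0; rewrite psumr_eq0 => [/allP va|a _]; last exact: sqr_ge0.
  apply/eqP/rowP => a; have := va a (mem_index_enum a).
  by rewrite /= sqrf_eq0 mxE => /eqP.
pose s := (Num.sqrt (nrm2 v))^-1.
have s0 : 0 < s by rewrite invr_gt0 sqrtr_gt0.
have s2 : s ^+ 2 * nrm2 v = 1.
  by rewrite exprVn sqr_sqrtr ?ltW // mulVf // gt_eqF.
have sv1 : nrm2 (s *: v) = 1.
  by rewrite -s2 /nrm2 mulr_sumr; apply: eq_bigr => a _; rewrite mxE exprMn.
have sc : (cube `&` [set v : 'rV[R]_m | nrm2 v = 1]) (s *: v).
  split=> // a; rewrite -(@expr_le1 _ 2) // real_normK ?num_real // -sv1.
  by rewrite /nrm2 (bigD1 a) //= lerDl sumr_ge0 // => b _; exact: sqr_ge0.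
have := te t (lexx t) _ sc.
have -> : (s *: v *m H *m (s *: v)^T) ord0 ord0 = s ^+ 2 * (v *m H *m v^T) ord0 ord0.
  by rewrite linearZ /= -!scalemxAl -scalemxAr scalerA mxE expr2.
have -> : q (s *: v) = s ^+ 2 * q v.
  rewrite /q mulr_sumr; apply: eq_bigr => j _.
  by rewrite linearZ /= -scalemxAr mxE exprMn.
rewrite -/(nrm2 v) -/(q v) mulrCA -mulrDr => ineq.
have s20 : 0 < s ^+ 2 by rewrite exprn_gt0.
rewrite -(ler_pM2l s20); apply: le_trans ineq.
by rewrite mulrCA s2 mulr1.
Qed.

End QuadraticForms.

Section LocalForm.
Context {R : realType} {m : nat} {E I : finType}.
Variables (h : E + I -> {mpoly R[m]}) (e0 : E).
Hypothesis he0 : h (inl e0) = \sum_(i < m) 'X_i ^+ 2 - 1.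
Implicit Types (p : {mpoly R[m]}) (u : 'rV[R]_m).

(* A cubic term is absorbed by completing the square in
   [e y_a^2 + y_a (y_b k)] and bounding [(y_b k)^2] by [|x - u|^4]. *)
Lemma young_cubic u (a b : 'I_m) (k : {mpoly R[m]}) (e : R) :
  0 < e -> k.@[u ord0] = 0 -> exists A : R,
  qmodule h (e%:MP * centered u a ^+ 2 + centered u a * centered u b * k +
             A%:MP * dist2 u ^+ 2).
Proof.
move=> e_gt0 ku; set y := centered u a; set z := centered u b; set D := dist2 u.
have [s ss Ds] := vanish_sq_le ku.
have zD : sos (D - z ^+ 2).
  rewrite /D /dist2 (bigD1 b) //= addrAC subrr add0r.
  by apply: sos_sum => c _; exact: sos_sq.
have e4 : 0 < 4^-1 / e by rewrite divr_gt0 // invr_gt0.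
have [A A0 hA] := compact_bound (@compact_cube R m)
  (@continuous_meval R m ((4^-1 / e)%:MP * s)).
exists (A + 1).
have -> : e%:MP * y ^+ 2 + y * z * k + (A + 1)%:MP * D ^+ 2 =
  e%:MP * (y + (2^-1 / e)%:MP * (z * k)) ^+ 2 +
  ((4^-1 / e)%:MP * (D * (D * s - k ^+ 2) + k ^+ 2 * (D - z ^+ 2)) +
   D ^+ 2 * ((A + 1)%:MP - (4^-1 / e)%:MP * s)).
  have E1 : e%:MP * (2^-1 / e)%:MP = 2^-1%:MP :> {mpoly R[m]}.
    by rewrite -mpolyCM; congr (_%:MP); field; rewrite gt_eqF.
  have E2 : 2^-1%:MP * (2^-1 / e)%:MP = (4^-1 / e)%:MP :> {mpoly R[m]}.
    by rewrite -mpolyCM; congr (_%:MP); field; rewrite gt_eqF.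
  have E3 : 2^-1%:MP * 2 = 1 :> {mpoly R[m]}.
    by rewrite -(mpolyC_nat _ _ 2) -mpolyCM mulVf ?pnatr_eq0 // mpolyC1.
  transitivity (e%:MP * y ^+ 2 + (2^-1%:MP * 2) * (y * z * k) + (A + 1)%:MP * D ^+ 2).
    by rewrite E3; ring.
  rewrite -E2 -E1; ring.
apply: qmoduleD; last apply: qmoduleD.
- by apply/sos_qmodule/sosM; [exact/sosC/ltW|exact: sos_sq].
- apply/sos_qmodule/sosM; first exact/sosC/ltW.
  by apply: sosD; apply: sosM => //; [exact: dist2_sos|exact: sos_sq].
apply: sos_qmoduleM; first exact: sos_sq.
apply: smi_qmodule; apply: (cube_pos_smi he0) => x cx.
rewrite mevalB mevalC; have := hA x cx; rewrite ler_norml => /andP[_]; lra.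
Qed.

(** Half the Hessian minus e / 4 is still positive definite, hence a sum of squares by [cholesky];
    the reserved (e / 4) |x - u|^2 pays for the remainder terms and for the gap. *)
Lemma pd_locally_quadratic (G : {mpoly R[m]}) u (e : R) : G.@[u ord0] = 0 ->
  (forall a, (G^`M(a)).@[u ord0] = 0) -> 0 < e ->
  (forall v : 'rV[R]_m,
    e * \sum_a v ord0 a ^+ 2 <= (v *m hessian G u *m v^T) ord0 ord0) ->
  locally_quadratic h G u.
Proof.
move=> Gu dGu e_gt0 He; have [k [ku GE]] := taylor2 Gu dGu.
pose M := 2^-1 *: hessian G u - (e / 4)%:M.
have [||B BE] := @cholesky R m M.
- rewrite /M raddfB /= linearZ /= tr_scalar_mx; congr (_ *: _ - _).
  by apply/matrixP => i j; rewrite !mxE mderiv_comm.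
- move=> v v0; rewrite /M mulmxBr mulmxBl -scalemxAr -scalemxAl mul_mx_scalar -scalemxAl.
  have n0 : 0 < \sum_a v ord0 a ^+ 2.
    rewrite lt_def sumr_ge0 ?andbT => [|a _]; last exact: sqr_ge0.
    apply: contra v0; rewrite psumr_eq0 => [/allP va|a _]; last exact: sqr_ge0.
    apply/eqP/rowP => a; have := va a (mem_index_enum a).
    by rewrite /= sqrf_eq0 mxE => /eqP.
  have entry (P Q : 'M[R]_1) (c1 c2 : R) : (c1 *: P - c2 *: Q) ord0 ord0 =
      c1 * P ord0 ord0 - c2 * Q ord0 ord0 by rewrite !mxE.
  have := He v; rewrite entry.
  have -> : (v *m v^T) ord0 ord0 = \sum_a v ord0 a ^+ 2.
    by rewrite mxE; apply: eq_bigr => a _; rewrite mxE.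
  by nra.
(* The reserve is cut into m + 1 shares: m of them give d y_a^2 to each pair (a, b), the last one is
   the gap d |x - u|^2. *)
pose d := e / 4 / m.+1%:R.
have d0 : 0 < d by rewrite !divr_gt0 // ltr0n.
have /choice[A hA] : forall ab : 'I_m * 'I_m, exists A : R,
    qmodule h (d%:MP * centered u ab.1 ^+ 2 +
      centered u ab.1 * centered u ab.2 * k ab.1 ab.2 + A%:MP * dist2 u ^+ 2).
  by move=> ab; apply: young_cubic.
exists d, (\sum_a \sum_b A (a, b)); split=> //.
have -> : G - d%:MP * dist2 u + (\sum_a \sum_b A (a, b))%:MP * dist2 u ^+ 2 =
  \sum_i (\sum_a (B i a)%:MP * centered u a) ^+ 2 +
  \sum_a \sum_b (d%:MP * centered u a ^+ 2 + centered u a * centered u b * k a b +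
     (A (a, b))%:MP * dist2 u ^+ 2).
  have e1 : \sum_i (\sum_a (B i a)%:MP * centered u a) ^+ 2 =
      \sum_a \sum_b centered u a * centered u b * (M a b)%:MP.
    under eq_bigr do rewrite expr2 mulr_suml.
    rewrite exchange_big /=; apply: eq_bigr => a _.
    under eq_bigr do rewrite mulr_sumr.
    rewrite exchange_big /=; apply: eq_bigr => b _.
    rewrite BE mxE rmorph_sum /= mulr_sumr; apply: eq_bigr => i _.
    by rewrite !mxE; ring.
  have e2 : \sum_a \sum_b centered u a * centered u b * (M a b)%:MP =
      \sum_a \sum_b centered u a * centered u b *
        (2^-1 * (G^`M(a)^`M(b)).@[u ord0])%:MP - (e / 4)%:MP * dist2 u.
    rewrite /dist2 mulr_sumr -sumrB; apply: eq_bigr => a _.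
    rewrite (bigD1 a) //= [in RHS](bigD1 a) //= addrAC; congr (_ + _).
      by rewrite !mxE eqxx mulr1n; ring.
    apply: eq_bigr => b /negbTE ba; rewrite !mxE eq_sym ba mulr0n subr0.
    by [].
  have e3 : \sum_a \sum_(b < m) d%:MP * centered u a ^+ 2 = m%:R%:MP * d%:MP * dist2 u.
    rewrite /dist2 mulr_sumr; apply: eq_bigr => a _.
    by rewrite sumr_const card_ord mpolyC_nat; ring.
  have e4 : \sum_a \sum_b (A (a, b))%:MP * dist2 u ^+ 2 =
      (\sum_a \sum_b A (a, b))%:MP * dist2 u ^+ 2.
    rewrite rmorph_sum /= mulr_suml; apply: eq_bigr => a _.
    by rewrite rmorph_sum /= mulr_suml.
  have e5 : (e / 4)%:MP = d%:MP + m%:R%:MP * d%:MP :> {mpoly R[m]}.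
    rewrite -mpolyCM -mpolyCD; congr (_%:MP); rewrite /d -natr1; field.
    by rewrite nat1r pnatr_eq0.
  have split3 (x y z : 'I_m -> 'I_m -> {mpoly R[m]}) :
      \sum_a \sum_b (x a b + y a b + z a b) =
      \sum_a \sum_b x a b + \sum_a \sum_b y a b + \sum_a \sum_b z a b.
    by rewrite -!big_split /=; apply: eq_bigr => a _; rewrite -!big_split.
  have e6 : G = \sum_a \sum_b centered u a * centered u b *
        (2^-1 * (G^`M(a)^`M(b)).@[u ord0])%:MP +
      \sum_a \sum_b centered u a * centered u b * k a b.
    rewrite {1}GE -big_split /=; apply: eq_bigr => a _; rewrite -big_split /=.
    by apply: eq_bigr => b _; rewrite mulrDr.
  rewrite split3 e3 e4 e1 e2 e5 {1}e6; ring.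
apply: qmoduleD; first by apply/sos_qmodule/sos_sum => i _; exact: sos_sq.
by apply: qmodule_sum => a _; apply: qmodule_sum => b _; exact: (hA (a, b)).
Qed.

End LocalForm.

Section StrictKKT.
Context {R : realType} {m : nat} {E I : finType}.
Variables (h : E + I -> {mpoly R[m]}).
Implicit Types (p F : {mpoly R[m]}) (u : 'rV[R]_m) (lam : E + I -> R).

(** Complementarity and SCC merged into a distinction between active and inactive labels; the
    multipliers stay explicit so that they can be rescaled under homogenization. *)
Definition strict_kkt F u lam : Prop :=
  [/\ grad F u = \sum_i lam i *: grad (h i) u,
      forall j, (h (inr j)).@[u ord0] = 0 -> 0 < lam (inr j),
      forall j, (h (inr j)).@[u ord0] != 0 -> lam (inr j) = 0
    & SOSC F h u lam].

Variable e0 : E.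
Hypothesis he0 : h (inl e0) = \sum_(i < m) 'X_i ^+ 2 - 1.

Lemma mderiv_dist2 u a : ((dist2 u)^`M(a)).@[u ord0] = 0.
Proof.
rewrite /dist2; under eq_bigr do rewrite expr2.
rewrite mderiv_centered_sum mevalD meval_centered_sum addr0 meval_centered.
by rewrite subrr.
Qed.

(* Replacing [lam i] by [lam i - t h_i + B |x - u|^2], nonnegative on the cube
   for large [B], adds [2 t \sum (grad h_i) (grad h_i)^T] to the Hessian. *)
Lemma strict_kkt_locally_quadratic F u lam : feasible h u -> F.@[u ord0] = 0 ->
  strict_kkt F u lam -> locally_quadratic h F u.
Proof.
move=> fu Fu [gradF lam_pos lam0 sosc].
pose act := [pred i | i \in active h u].
have actE i : act i = ((h i).@[u ord0] == 0) by [].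
have [t [e [t_gt0 e_gt0 Ht]]] := finsler (P := act) (c := fun i => grad (h i) u)
  (H := hessian (lagrangian F h lam) u) sosc.
have lam_act i : ~~ act i -> lam i = 0.
  rewrite actE; case: i => [i|j]; first by case: fu => -> _; rewrite eqxx.
  exact: lam0.
(* The weight is t / 2 because at a zero of h_i the Hessian of h_i^2 is twice (grad h_i)^T (grad
   h_i), of which [finsler] requires t copies. *)
pose s0 i : {mpoly R[m]} := (lam i)%:MP - (t / 2)%:MP * h i.
have /choice[B hB] : forall i, exists B : R, act i ->
    (if i is inr j then sos_mod_ideal h (s0 i + B%:MP * dist2 u) else True).
  case=> [i|j]; first by exists 0.
  have [aj|_] := boolP (act (inr j)); last by exists 0.
  (* SCC enters here: the polynomial multiplier is positive at u, so a multiple of |x - u|^2 makes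
     it positive on the whole cube. *)
  have lj : 0 < lam (inr j) by apply: lam_pos; apply/eqP; rewrite -actE.
  have [||B [c' [_ c'0 H]]] := compact_penalty (@compact_cube R m)
      (@continuous_meval R m (s0 (inr j))) (@continuous_meval R m (dist2 u)).
  - by move=> x _; apply: sos_ge0; exact: dist2_sos.
  - move=> x _ /dist2_eq0 ->; rewrite mevalB mevalC mevalM.
    by move: aj; rewrite actE => /eqP ->; rewrite mulr0 subr0.
  exists B => _; apply: (cube_pos_smi he0) => x cx.
  rewrite (mevalD _ (s0 _)) (mevalM _ B%:MP) mevalC; apply: lt_le_trans c'0 _.
  exact: H.
pose s i : {mpoly R[m]} := s0 i + (B i)%:MP * dist2 u.
pose m1 := \sum_(i | act i) h i * s i.
have qm1 : qmodule h m1.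
  apply: qmodule_sum => -[i|j] ai; first exact: ideal_qmodule.
  by apply: ineq_qmodule_smi; exact: (hB _ ai).
have hu i : act i -> (h i).@[u ord0] = 0 by rewrite actE => /eqP.
have su i : act i -> (s i).@[u ord0] = lam i.
  move=> ai; rewrite /s /s0 mevalD mevalB !mevalM !mevalC dist2_id hu //.
  by rewrite !mulr0 subr0 addr0.
have ds i a : act i -> ((s i)^`M(a)).@[u ord0] = - (t / 2) * ((h i)^`M(a)).@[u ord0].
  move=> ai; rewrite /s /s0 mderivD mderivB !mderiv_mulC mderivC sub0r.
  by rewrite mevalD mevalN !mevalM !mevalC mderiv_dist2 mulr0 addr0 mulNr.
have sum_act (f : E + I -> R) : \sum_i lam i * f i = \sum_(i | act i) lam i * f i.
  rewrite [RHS]big_mkcond; apply: eq_bigr => i _; case: ifPn => // /lam_act ->.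
  by rewrite mul0r.
pose G := F - m1.
have Gu : G.@[u ord0] = 0.
  rewrite mevalB Fu meval_sum big1 ?subr0 // => i ai.
  by rewrite mevalM hu // mul0r.
have dm1 a : m1^`M(a) = \sum_(i | act i) (h i * s i)^`M(a) by exact: mderiv_sum.
have dG a : (G^`M(a)).@[u ord0] = 0.
  rewrite mderivB mevalB dm1 (meval_sum _ (index_enum _) act).
  have -> : (F^`M(a)).@[u ord0] = \sum_i lam i * ((h i)^`M(a)).@[u ord0].
    transitivity (grad F u ord0 a); first by rewrite mxE.
    by rewrite gradF summxE; apply: eq_bigr => i _; rewrite !mxE.
  rewrite sum_act -sumrB big1 // => i ai.
  by rewrite mderivM mevalD !mevalM su // hu // mul0r addr0 mulrC subrr.
have ddG a b : (G^`M(a)^`M(b)).@[u ord0] =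
   hessian (lagrangian F h lam) u a b +
   t * \sum_(i | act i) ((h i)^`M(a)).@[u ord0] * ((h i)^`M(b)).@[u ord0].
  rewrite mxE /lagrangian /G !mderivB !mevalB dm1.
  rewrite (mderiv_sum b (index_enum _) act) (meval_sum _ (index_enum _) act).
  rewrite (mderiv_sum a (index_enum _) xpredT) (mderiv_sum b (index_enum _) xpredT).
  rewrite (meval_sum _ (index_enum _) xpredT).
  have -> : \sum_i ((lam i *: h i)^`M(a)^`M(b)).@[u ord0] =
     \sum_(i | act i) lam i * ((h i)^`M(a)^`M(b)).@[u ord0].
    by rewrite -sum_act; apply: eq_bigr => i _; rewrite !mderivZ mevalZ.
  rewrite -addrA; congr (_ + _); rewrite mulr_sumr -!sumrN -big_split /=.
  apply: eq_bigr => i ai; rewrite mderivM mderivD !mderivM !mevalD !mevalM.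
  rewrite su // hu // !ds //. by field.
have lqG : locally_quadratic h G u.
  apply: (pd_locally_quadratic he0 Gu dG e_gt0) => v.
  apply: le_trans (Ht v) _; rewrite !quadratic_formE.
  rewrite le_eqVlt; apply/orP; left; apply/eqP; rewrite mulr_sumr.
  under [RHS]eq_bigr do under eq_bigr do rewrite mxE ddG mulrDr.
  under [RHS]eq_bigr do rewrite big_split /=.
  rewrite big_split /=; congr (_ + _).
  transitivity (\sum_(i | act i) \sum_a \sum_b
     t * (v ord0 a * v ord0 b * ((h i)^`M(a)).@[u ord0] * ((h i)^`M(b)).@[u ord0])).
    apply: eq_bigr => i _; rewrite mxE expr2 mulr_suml mulr_sumr.
    apply: eq_bigr => a _; rewrite !mulr_sumr; apply: eq_bigr => b _.
    by rewrite !mxE; ring.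
  rewrite exchange_big /=; apply: eq_bigr => a _.
  rewrite exchange_big /=; apply: eq_bigr => b _.
  by rewrite !mulr_sumr; apply: eq_bigr => i _; ring.
have [d [A [d_gt0 qG]]] := lqG; exists d, A; split=> //.
have -> : F - d%:MP * dist2 u + A%:MP * dist2 u ^+ 2 =
  (G - d%:MP * dist2 u + A%:MP * dist2 u ^+ 2) + m1 by rewrite /G; ring.
exact: qmoduleD.
Qed.

End StrictKKT.

(** * Existence of multipliers *)

Section Stationarity.
Context {R : realType} {m : nat}.
Implicit Types (p : {mpoly R[m]}) (u x : 'rV[R]_m).

Definition box u (e : R) : set 'rV[R]_m :=
  [set x | forall a, `|x ord0 a - u ord0 a| <= e].

Lemma compact_box u e : compact (box u e).
Proof.
have -> : box u e =
    [set x : 'rV[R]_m | forall i, `[u ord0 i - e, u ord0 i + e]%classic (x ord0 i)].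
  apply/seteqP; split => x /= xu i; have := xu i;
  by rewrite /= in_itv /= ler_norml => /andP[x1 x2]; apply/andP; split; lra.
have H : forall i : 'I_m,
    compact ((fun i => `[u ord0 i - e, u ord0 i + e]%classic : set R) i).
  by move=> i; exact: segment_compact.
exact: (rV_compact H).
Qed.

Lemma meval_hadamard p u x (r : 'I_m -> {mpoly R[m]}) :
  p = (p.@[u ord0])%:MP + \sum_a centered u a * r a ->
  p.@[x ord0] - p.@[u ord0] =
    \sum_a (x ord0 a - u ord0 a) * (r a).@[x ord0].
Proof.
move=> {1}->; rewrite mevalD mevalC meval_sum addrC addKr.
by apply: eq_bigr => a _; rewrite mevalM meval_centered.
Qed.

Lemma meval_lipschitz p u : exists2 C, 0 < C & forall e x, 0 <= e <= 1 ->
  box u e x -> `|p.@[x ord0] - p.@[u ord0]| <= C * e.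
Proof.
have [r rE] := hadamard p u.
have /choice[B hB] : forall a, exists B : R, 0 < B /\
    forall x, box u 1 x -> `|(r a).@[x ord0]| <= B.
  move=> a; have [B B0 hB] := compact_bound (compact_box (u := u) (e := 1))
     (@continuous_meval R m (r a)).
  by exists B.
exists (\sum_a B a + 1).
  by apply: ltr_wpDl => //; apply: sumr_ge0 => a _; apply: ltW; exact: (hB a).1.
move=> e x /andP[e0 e1] xe; rewrite (meval_hadamard x rE).
have x1 : box u 1 x by move=> a; apply: le_trans e1; exact: xe.
apply: (@le_trans _ _ (\sum_a e * B a)).
  apply: le_trans (ler_norm_sum _ _ _) _; apply: ler_sum => a _.
  by rewrite normrM; apply: ler_pM => //; exact: (hB a).2.
by rewrite -mulr_sumr mulrC mulrDl mul1r lerDl.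
Qed.

Lemma meval_lipschitz_fam (J : finType) (p : J -> {mpoly R[m]}) u :
  exists2 C, 0 < C & forall j e x, 0 <= e <= 1 -> box u e x ->
    `|(p j).@[x ord0] - (p j).@[u ord0]| <= C * e.
Proof.
have /choice[C hC] : forall j, exists C : R, 0 < C /\ forall e x, 0 <= e <= 1 ->
    box u e x -> `|(p j).@[x ord0] - (p j).@[u ord0]| <= C * e.
  by move=> j; have [C C0 H] := meval_lipschitz (p j) u; exists C.
exists (\sum_j C j + 1).
  by apply: ltr_wpDl => //; apply: sumr_ge0 => j _; apply: ltW; exact: (hC j).1.
move=> j e x e01 xe; apply: le_trans ((hC j).2 e x e01 xe) _.
have /andP[e0 _] := e01; apply: ler_wpM2r => //.
rewrite (bigD1 j) //= -addrA lerDl; apply: addr_ge0 => //.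
by apply: sumr_ge0 => i _; apply: ltW; exact: (hC i).1.
Qed.

(** Fermat's rule: during a step of length at most |g| / (2 C) against the sign of the derivative g,
    the cofactor [r a] stays within |g| / 2 of g, so [p] would decrease. *)
Lemma grad_local_min p x (e : R) : 0 < e ->
  (forall z, box x e z -> p.@[x ord0] <= p.@[z ord0]) ->
  forall a, (p^`M(a)).@[x ord0] = 0.
Proof.
move=> e_gt0 pmin a; have [r [rE r1]] : exists r : 'I_m -> {mpoly R[m]},
    p = (p.@[x ord0])%:MP + \sum_a centered x a * r a /\
    (r a).@[x ord0] = (p^`M(a)).@[x ord0].
  have [r rE] := hadamard p x; exists r; split=> //.
  rewrite [in RHS]rE mderivD mderivC add0r mderiv_centered_sum mevalD.
  by rewrite meval_centered_sum addr0.
have [C C0 hC] := meval_lipschitz (r a) x.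
rewrite -r1; apply/eqP; apply/negPn/negP => rn0; set g := (r a).@[x ord0] in hC rn0.
have g0 : 0 < `|g| by rewrite normr_gt0.
pose s := Num.min e (Num.min 1 (`|g| / (2 * C))).
have s0 : 0 < s by rewrite !lt_min e_gt0 ltr01 divr_gt0 // mulr_gt0.
have se : s <= e by rewrite ge_min lexx.
have s1 : s <= 1 by rewrite !ge_min lexx orbT.
have sg : s <= `|g| / (2 * C) by rewrite !ge_min lexx !orbT.
pose t := - Num.sg g * s.
have tn : `|t| = s by rewrite normrM normrN normr_sg rn0 mul1r gtr0_norm.
pose z : 'rV[R]_m := \row_b (x ord0 b + (if b == a then t else 0)).
have zx b : z ord0 b - x ord0 b = if b == a then t else 0.
  by rewrite mxE addrC addKr.
have zs : box x s z by move=> b; rewrite zx; case: ifP; rewrite ?tn ?normr0 // ltW.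
have := pmin z (fun b => le_trans (zs b) se).
rewrite -subr_ge0 (meval_hadamard z rE) (bigD1 a) //= zx eqxx big1 ?addr0.
  have := hC s z; rewrite (ltW s0) s1 => /(_ isT zs).
  rewrite ler_norml => /andP[h1 h2].
  have Cs : C * s <= `|g| / 2.
    move: sg; rewrite ler_pdivlMr ?mulr_gt0 //; lra.
  rewrite /t; case: (sgrP g) h1 h2 g0 Cs => [->|gp|gn] h1 h2 g0 Cs.
  - by rewrite ltxx in g0.
  - by nra.
  - by nra.
by move=> b /negbTE ba; rewrite zx ba mul0r.
Qed.

Context {E I : finType}.
Variables (phi : {mpoly R[m]}) (h : E + I -> {mpoly R[m]}).

(** The squared negative part has derivative -2 times the negative part, which is 2-Lipschitz; the
    right-hand side is the resulting quadratic majorant at r. *)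
Lemma neg_part_sq_le (r s : R) :
  ((`|s| - s) / 2) ^+ 2 <= ((`|r| - r) / 2) ^+ 2 -
    2 * ((`|r| - r) / 2) * (s - r) + (s - r) ^+ 2.
Proof.
have h1 := sqr_ge0 (s - r); have h2 := sqr_ge0 s; have h3 := sqr_ge0 r.
have [r0|r0] := leP 0 r; have [s0|s0] := leP 0 s;
  rewrite ?(ger0_norm r0) ?(ltr0_norm r0) ?(ger0_norm s0) ?(ltr0_norm s0).
- lra.
- have := mulr_ge0 r0 (ltW (_ : 0 < - s)); rewrite oppr_gt0 => /(_ s0); lra.
- lra.
- lra.
Qed.

(* [x] minimizes a quadratic penalty function over a small box. The penalty of an
   inequality is not polynomial, so it is majorized by a quadratic polynomial in
   the constraint with equality at [x]. *)
Lemma approximate_multipliers u (e : R) : minimizer phi h u -> 0 < e ->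
  exists x (lam : E + I -> R),
    [/\ box u e x,
        forall a, (phi^`M(a) + 2 * centered u a).@[x ord0] =
          \sum_i lam i * ((h i)^`M(a)).@[x ord0],
        forall j, 0 <= lam (inr j)
      & forall j, 0 < (h (inr j)).@[x ord0] -> lam (inr j) = 0].
Proof.
move=> [fu umin] e_gt0.
(* The term |x - u|^2 makes [p] positive at every feasible point other than u; inside the box, [bd]
   vanishes exactly on the faces. *)
pose p : {mpoly R[m]} := phi - (phi.@[u ord0])%:MP + dist2 u.
pose bd : {mpoly R[m]} := \prod_a ((e ^+ 2)%:MP - centered u a ^+ 2).
have cB := compact_box (u := u) (e := e).
have cbd := compact_level (c := 0) cB (@continuous_meval R m bd).
have pu : p.@[u ord0] = 0.
  by rewrite /p mevalD mevalB mevalC subrr dist2_id addr0.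
have vu : violation h u = 0.
  case: fu => hE hI; rewrite /violation !big1 ?addr0 // => i _.
    by rewrite ger0_norm // subrr mul0r expr0n.
  by rewrite hE expr0n.
have [||t [c [t0 c0 tc]]] := compact_penalty cbd (@continuous_meval R m p)
    (continuous_violation (h := h)).
- by move=> x _; exact: violation_ge0.
- move=> x [xB /= xbd] /violation_eq0 fx.
  rewrite /p mevalD mevalB mevalC.
  have := umin x fx; suff : 0 < (dist2 u).@[x ord0] by lra.
  have /eqP := xbd; rewrite /bd meval_prod prodf_seq_eq0 => /hasP[a _ /=].
  rewrite mevalB mevalC mevalXn meval_centered subr_eq0 => /eqP xa.
  rewrite meval_dist2 (bigD1 a) //= -xa ltr_wpDr ?exprn_gt0 //.
  by apply: sumr_ge0 => b _; exact: sqr_ge0.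
have cPhi : continuous (fun x => p.@[x ord0] + t * violation h x).
  apply: continuous_addr; first exact: continuous_meval.
  apply: continuous_mulr; first exact: continuous_constr.
  exact: continuous_violation.
have uB : box u e u by move=> a; rewrite subrr normr0 ltW.
have [|x xB xmin] := @derive.EVT_min_rV R m _ (box u e) _ cB (continuous_subspaceT cPhi).
  by exists u.
move/set_mem: xB => xB.
(* The penalized function is 0 at u, hence at most 0 at its minimizer, but at least c on the faces:
   the minimizer is interior and Fermat's rule applies. *)
have xle : p.@[x ord0] + t * violation h x <= 0.
  by apply: le_trans (xmin u (mem_set uB)) _; rewrite pu vu mulr0 addr0.
have xint a : `|x ord0 a - u ord0 a| < e.
  rewrite lt_def xB andbT; apply/eqP => xa.
  have : c <= 0.
    apply: le_trans xle; apply: tc => //; split=> //=.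
    rewrite /bd meval_prod (bigD1 a) //= mevalB mevalC mevalXn meval_centered.
    by rewrite xa real_normK ?num_real // subrr mul0r.
  by rewrite leNgt c0.
have [e' e'0 he'] : exists2 e', 0 < e' & forall a, `|x ord0 a - u ord0 a| + e' <= e.
  exists (e - \big[Num.max/0]_a `|x ord0 a - u ord0 a|).
    by rewrite subr_gt0; apply/bigmax_ltP; split=> // a _; exact: xint.
  by move=> a; rewrite addrCA gerDl subr_le0; apply: le_bigmax.
pose w j := (`|(h (inr j)).@[x ord0]| - (h (inr j)).@[x ord0]) / 2.
pose d j : {mpoly R[m]} := h (inr j) - ((h (inr j)).@[x ord0])%:MP.
pose Q : {mpoly R[m]} := p + t%:MP * (\sum_i h (inl i) * h (inl i) +
  \sum_j ((w j ^+ 2)%:MP - (2 * w j)%:MP * d j + d j * d j)).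
have Qge (z : 'rV[R]_m) : p.@[z ord0] + t * violation h z <= Q.@[z ord0].
  rewrite /Q (mevalD _ p) lerD2l mevalM mevalC ler_pM2l // mevalD !meval_sum.
  apply: lerD; apply: ler_sum => i _; first by rewrite mevalM expr2.
  apply: le_trans (neg_part_sq_le (h (inr i)).@[x ord0] _) _.
  rewrite mevalD mevalB mevalC !mevalM mevalC mevalB mevalC -expr2.
  by rewrite /w; lra.
have Qx : Q.@[x ord0] = p.@[x ord0] + t * violation h x.
  rewrite /Q (mevalD _ p) (mevalM _ t%:MP) mevalC (mevalD _ (\sum_i _)).
  rewrite !(meval_sum _ (index_enum _)); congr (_ + _ * (_ + _)).
    by apply: eq_bigr => i _; rewrite mevalM expr2.
  apply: eq_bigr => i _; rewrite mevalD mevalB mevalC !mevalM mevalC mevalB mevalC.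
  by rewrite subrr !mulr0 addr0 subr0.
have dQ := @grad_local_min Q x e' e'0 _.
have {}dQ a : (Q^`M(a)).@[x ord0] = 0.
  apply: dQ => z zx; rewrite Qx; apply: le_trans (Qge z).
  apply: xmin; apply/mem_set => b.
  have -> : z ord0 b - u ord0 b = (z ord0 b - x ord0 b) + (x ord0 b - u ord0 b) by ring.
  by apply: le_trans (ler_normD _ _) _; have := he' b; have := zx b; lra.
exists x, (fun i => match i with inl i => - (2 * t) * (h (inl i)).@[x ord0]
                               | inr j => 2 * t * w j end); split=> //.
- move=> a; have := dQ a.
  have -> : Q^`M(a) = phi^`M(a) + (dist2 u)^`M(a) + t%:MP *
      (\sum_i (h (inl i) * h (inl i))^`M(a) +
       \sum_j ((w j ^+ 2)%:MP - (2 * w j)%:MP * d j + d j * d j)^`M(a)).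
    rewrite /Q mderivD mderiv_mulC (mderivD _ (\sum_i _)) -!mderiv_sum.
    by rewrite /p mderivD mderivB mderivC subr0.
  rewrite mevalD mevalD (mevalM _ t%:MP) mevalC (mevalD _ (\sum_i _)).
  rewrite !(meval_sum _ (index_enum _)) mevalD big_sumType /=.
  have -> : ((dist2 u)^`M(a)).@[x ord0] = (2 * centered u a).@[x ord0].
    rewrite /dist2 mderiv_sum meval_sum (bigD1 a) //= big1 ?addr0.
      by rewrite expr2 mderivM mderiv_centered eqxx mul1r mulr1; congr (_.@[_]); ring.
    move=> b /negbTE ba; rewrite expr2 mderivM mderiv_centered ba mul0r mulr0.
    by rewrite addr0 meval0.
  have -> : \sum_(i : E) ((h (inl i) * h (inl i))^`M(a)).@[x ord0] =
    \sum_(i : E) 2 * (h (inl i)).@[x ord0] * ((h (inl i))^`M(a)).@[x ord0].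
    by apply: eq_bigr => i _; rewrite mderivM mevalD !mevalM; ring.
  have -> : \sum_j (((w j ^+ 2)%:MP - (2 * w j)%:MP * d j + d j * d j)^`M(a)).@[x ord0] =
     \sum_j - (2 * w j * ((h (inr j))^`M(a)).@[x ord0]).
    apply: eq_bigr => j _.
    rewrite mderivD mderivB mderivC sub0r mderiv_mulC mderivM.
    rewrite mevalD mevalN mevalM mevalC mevalD !mevalM.
    have -> : (d j).@[x ord0] = 0 by rewrite mevalB mevalC subrr.
    rewrite /d mderivB mderivC subr0; ring.
  rewrite sumrN => H.
  have -> : \sum_(i : E) - (2 * t) * (h (inl i)).@[x ord0] * ((h (inl i))^`M(a)).@[x ord0] =
     - t * \sum_(i : E) 2 * (h (inl i)).@[x ord0] * ((h (inl i))^`M(a)).@[x ord0].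
    by rewrite mulr_sumr; apply: eq_bigr => i _; ring.
  have -> : \sum_(j : I) 2 * t * w j * ((h (inr j))^`M(a)).@[x ord0] =
     t * \sum_(j : I) 2 * w j * ((h (inr j))^`M(a)).@[x ord0].
    by rewrite mulr_sumr; apply: eq_bigr => i _; ring.
  by move: H; lra.
- move=> j; rewrite mulr_ge0 //; first by rewrite mulr_ge0 // ltW.
  by rewrite /w divr_ge0 // subr_ge0 ler_norm.
- by move=> j hj; rewrite /w gtr0_norm // subrr mul0r mulr0.
Qed.

End Stationarity.

(** * Passage to the limit under LICQC *)

Section Multipliers.
Context {R : realType} {m : nat} {E I : finType}.
Variables (phi : {mpoly R[m]}) (h : E + I -> {mpoly R[m]}).
Implicit Types (u x : 'rV[R]_m).

(** [coord] of a free family gives linear forms on the whole space; their values on the standard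
    basis are the vectors dual to the active gradients. *)
Lemma licq_dual u : LICQC h u -> exists w : E + I -> 'I_m -> R,
  forall i j, i \in active h u -> j \in active h u ->
    \sum_a w j a * ((h i)^`M(a)).@[u ord0] = (i == j)%:R.
Proof.
rewrite /LICQC; set s := [seq _ | _ in _] => fs.
pose A := enum (active h u).
have sE : s = [seq grad (h i) u | i <- A] by [].
have szs : size s = size A by rewrite sE size_map.
pose X := in_tuple s.
pose w i a : R := if insub (index i A) is Some k then coord X k (delta_mx 0 a) else 0.
exists w => i j iA jA.
have jlt : (index j A < size s)%N by rewrite szs index_mem mem_enum.
have ilt : (index i A < size s)%N by rewrite szs index_mem mem_enum.
have wj a : w j a = coord X (Ordinal jlt) (delta_mx 0 a) by rewrite /w insubT.
transitivity (coord X (Ordinal jlt) (grad (h i) u)).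
  rewrite [grad _ _]row_sum_delta linear_sum /=; apply: eq_bigr => a _.
  by rewrite linearZ /= wj mxE mulrC.
have -> : grad (h i) u = X`_(Ordinal ilt).
  rewrite /= sE (nth_map i) ?index_mem ?mem_enum // nth_index // mem_enum //.
rewrite coord_free //.
have -> : (Ordinal ilt == Ordinal jlt) = (i == j) => //.
apply/eqP/eqP => [[e]|ij]; last by apply: val_inj; rewrite /= ij.
by have := congr1 (nth i A) e; rewrite !nth_index ?mem_enum.
Qed.

(* Pairing the approximate stationarity equations with a dual basis of the active
   gradients shows that the approximate multipliers converge. *)
Lemma licq_multipliers u : minimizer phi h u -> LICQC h u ->
  exists lam, multipliers phi h u lam.
Proof.
move=> umin licq; have [w wE] := licq_dual licq; have [fu _] := umin.
pose act i := i \in active h u.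
have actE i : act i = ((h i).@[u ord0] == 0) by [].
(* Pairing exact stationarity at u with the dual vectors forces these values, so the limit is
   explicit and no subsequence is extracted. *)
pose lim i : R := if act i then \sum_a w i a * (phi^`M(a)).@[u ord0] else 0.
pose b j : {mpoly R[m]} := \sum_a (w j a)%:MP * (phi^`M(a) + 2 * centered u a).
pose g i j : {mpoly R[m]} := \sum_a (w j a)%:MP * (h i)^`M(a).
have bu j : (b j).@[u ord0] = \sum_a w j a * (phi^`M(a)).@[u ord0].
  rewrite meval_sum; apply: eq_bigr => a _.
  by rewrite mevalM mevalC mevalD mevalM meval_centered subrr mulr0 addr0.
have gu i j : act i -> act j -> (g i j).@[u ord0] = (i == j)%:R.
  move=> ai aj; rewrite -wE // meval_sum; apply: eq_bigr => a _.
  by rewrite mevalM mevalC.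
have [C1 C1_0 hC1] := meval_lipschitz_fam h u.
have [C2 C2_0 hC2] := meval_lipschitz_fam (fun ia : (E + I) * 'I_m => (h ia.1)^`M(ia.2)) u.
have [C3 C3_0 hC3] := meval_lipschitz_fam (fun a => phi^`M(a) + 2 * centered u a) u.
have [C4 C4_0 hC4] := meval_lipschitz_fam b u.
have [C5 C5_0 hC5] := meval_lipschitz_fam (fun ij : (E + I) * (E + I) => g ij.1 ij.2) u.
have [C [C_0 C1C C2C C3C [C4C C5C]]] : exists C, [/\ 0 < C, C1 <= C, C2 <= C, C3 <= C &
    C4 <= C /\ C5 <= C] by exists (C1 + C2 + C3 + C4 + C5); split; [| | | |split]; lra.
pose T := \sum_j (`|lim j| + C).
have T0 : 0 <= T by apply: sumr_ge0 => j _; rewrite addr_ge0 // ltW.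
pose N : R := #|{: E + I}|%:R.
have N0 : 0 <= N by exact: ler0n.
have [eta eta0 heta] : exists2 eta, 0 < eta &
    forall j, ~~ act (inr j) -> eta <= (h (inr j)).@[u ord0].
  pose F (j : I) : R := if act (inr j) then 1 else (h (inr j)).@[u ord0].
  exists (\big[Num.min/1]_j F j).
    apply/bigmin_gtP; split=> // j _; rewrite /F; case: ifPn => // aj.
    by rewrite lt_def -actE aj; case: fu => _ ->.
  move=> j aj; have <- : F j = (h (inr j)).@[u ord0] by rewrite /F (negbTE aj).
  exact: bigmin_le_cond.
have key (e : R) : 0 < e <= 1 -> C * e < eta -> N * (C * e) <= 2^-1 ->
  exists lam : E + I -> R, [/\ forall j, 0 <= lam (inr j),
    forall i, `|lam i - lim i| <= (1 + 2 * T) * (C * e) &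
    forall a, `|(phi^`M(a)).@[u ord0] - \sum_i lim i * ((h i)^`M(a)).@[u ord0]| <=
      (1 + 2 * T + (1 + 2 * T) * \sum_i `|((h i)^`M(a)).@[u ord0]|) * (C * e)].
Proof.
  move=> /andP[e0 e1] Ce NCe.
  have [x [lam [xe gradx lam0 lamI]]] := approximate_multipliers umin e0.
  have e01 : 0 <= e <= 1 by rewrite ltW.
  have lamact i : ~~ act i -> lam i = 0.
    case: i => [i|j] ai; first by move: ai; rewrite actE; case: fu => -> _; rewrite eqxx.
    apply: lamI; have := heta j ai.
    have := hC1 (inr j) e x e01 xe; rewrite ler_norml => /andP[+ _].
    have : C1 * e <= C * e by rewrite ler_pM2r.
    lra.
  pose S := \sum_i `|lam i|.
  have S0 : 0 <= S by apply: sumr_ge0.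
  have dlam j : act j -> `|lam j - lim j| <= C * e + S * (C * e).
    move=> aj.
    have bx : (b j).@[x ord0] = \sum_i lam i * (g i j).@[x ord0].
      rewrite meval_sum; under eq_bigr do rewrite mevalM mevalC gradx mulr_sumr.
      rewrite exchange_big /=; apply: eq_bigr => i _.
      rewrite meval_sum mulr_sumr; apply: eq_bigr => a _.
      by rewrite mevalM mevalC mulrCA.
    have lamj : lam j = \sum_i lam i * (if act i then (g i j).@[u ord0] else 0).
      rewrite (bigD1 j) //= aj gu // eqxx mulr1 big1 ?addr0 // => i ij.
      by case: ifPn => ai; rewrite ?mulr0 // gu // (negbTE ij) mulr0.
    have -> : lam j - lim j = ((b j).@[x ord0] - (b j).@[u ord0]) -
        \sum_i lam i * (if act i then (g i j).@[x ord0] - (g i j).@[u ord0] else 0).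
      rewrite bu /lim aj bx {1}lamj -[RHS]addrA [- _ - _]addrC addrA; congr (_ - _).
      rewrite -sumrB; apply: eq_bigr => i _; case: ifPn => ai; first by ring.
      by rewrite lamact // !mul0r subrr.
    apply: le_trans (ler_normB _ _) _; apply: lerD.
      apply: le_trans (hC4 j e x e01 xe) _; by rewrite ler_pM2r.
    apply: le_trans (ler_norm_sum _ _ _) _; rewrite /S mulr_suml.
    apply: ler_sum => i _; rewrite normrM; apply: ler_wpM2l => //.
    case: ifPn => _; last by rewrite normr0 mulr_ge0 // ltW.
    apply: le_trans (hC5 (i, j) e x e01 xe) _; by rewrite ler_pM2r.
  (* The error bound involves the sum S of the absolute multipliers itself; after summation over the
     N labels, N C e <= 1/2 absorbs it and leaves S <= 2 T. *)
  have ST : S <= T + N * (S * (C * e)).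
    have -> : N * (S * (C * e)) = \sum_(j : E + I) (S * (C * e)).
      by rewrite sumr_const mulr_natl.
    rewrite {1}/S /T -big_split /=; apply: ler_sum => j _.
    have SC : 0 <= S * (C * e) by rewrite mulr_ge0 // mulr_ge0 // ltW.
    have [aj|aj] := boolP (act j); last first.
      by rewrite lamact // normr0 addr_ge0 // addr_ge0 // ltW.
    have := dlam j aj; have := ler_normD (lam j - lim j) (lim j); rewrite subrK.
    have : C * e <= C by rewrite ger_pMr.
    lra.
  have S2T : S <= 2 * T by have := ler_wpM2l S0 NCe; rewrite mulrCA; lra.
  have CSe : S * (C * e) <= 2 * T * (C * e) by rewrite ler_wpM2r // mulr_ge0 // ltW.
  have dlam2 i : `|lam i - lim i| <= (1 + 2 * T) * (C * e).
    have [ai|ai] := boolP (act i); last first.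
      by rewrite lamact // /lim (negbTE ai) subrr normr0 !mulr_ge0 ?addr_ge0 ?mulr_ge0 // ltW.
    by apply: le_trans (dlam i ai) _; rewrite (mulrDl 1) mul1r lerD2l.
  exists lam; split=> // a.
  have -> : (phi^`M(a)).@[u ord0] - \sum_i lim i * ((h i)^`M(a)).@[u ord0] =
    - ((phi^`M(a) + 2 * centered u a).@[x ord0] - (phi^`M(a) + 2 * centered u a).@[u ord0])
    + (\sum_i lam i * (((h i)^`M(a)).@[x ord0] - ((h i)^`M(a)).@[u ord0])
       + \sum_i (lam i - lim i) * ((h i)^`M(a)).@[u ord0]).
    rewrite -big_split /= [(phi^`M(a) + _).@[u ord0]]mevalD mevalM meval_centered subrr.
    rewrite mulr0 addr0 opprB gradx -addrA; congr (_ + _).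
    by rewrite -!sumrN -big_split /=; apply: eq_bigr => i _; ring.
  apply: le_trans (ler_normD _ _) _; rewrite normrN.
  set Y := \sum_(i : E + I) `|_|.
  have -> : (1 + 2 * T + (1 + 2 * T) * Y) * (C * e) =
    C * e + (2 * T * (C * e) + (1 + 2 * T) * Y * (C * e)) by ring.
  apply: lerD.
    apply: le_trans (hC3 a e x e01 xe) _; by rewrite ler_pM2r.
  apply: le_trans (ler_normD _ _) _; apply: lerD.
    apply: le_trans CSe; apply: le_trans (ler_norm_sum _ _ _) _; rewrite /S mulr_suml.
    apply: ler_sum => i _; rewrite normrM; apply: ler_wpM2l => //.
    apply: le_trans (hC2 (i, a) e x e01 xe) _; by rewrite ler_pM2r.
  apply: le_trans (ler_norm_sum _ _ _) _; rewrite mulrAC mulr_sumr.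
  by apply: ler_sum => i _; rewrite normrM; apply: ler_wpM2r.
have small (K x : R) : 0 <= K -> (forall e, 0 < e <= 1 -> C * e < eta ->
    N * (C * e) <= 2^-1 -> x <= K * (C * e)) -> x <= 0.
  move=> K0 H; rewrite leNgt; apply/negP => x0.
  pose e := Num.min 1 (Num.min (eta / (2 * C))
    (Num.min ((2 * (N + 1) * C)^-1) (x / (2 * (K + 1) * C)))).
  have e0 : 0 < e.
    rewrite !lt_min ltr01 !divr_gt0 ?invr_gt0 ?mulr_gt0 //=; lra.
  have e1 : e <= 1 by rewrite ge_min lexx.
  have e2 : e <= eta / (2 * C) by rewrite !ge_min lexx !orbT.
  have e3 : e <= (2 * (N + 1) * C)^-1 by rewrite !ge_min lexx !orbT.
  have e4 : e <= x / (2 * (K + 1) * C) by rewrite !ge_min lexx !orbT.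
  rewrite ler_pdivlMr ?mulr_gt0 // in e2.
  rewrite -div1r ler_pdivlMr ?mulr_gt0 ?ltr_wpDl // in e3.
  rewrite ler_pdivlMr ?mulr_gt0 ?ltr_wpDl // in e4.
  have Ce0 : 0 < C * e by exact: mulr_gt0.
  have /(_ _ _ _) := H e; rewrite e0 e1 => /(_ isT).
  have h1 : C * e < eta by lra.
  have h2 : N * (C * e) <= 2^-1 by nra.
  by move=> /(_ h1 h2); nra.
exists lim; split.
- apply/rowP => a; rewrite mxE summxE; apply/eqP; rewrite -subr_eq0.
  under eq_bigr do rewrite !mxE; rewrite -normr_le0.
  apply: (small (1 + 2 * T + (1 + 2 * T) * \sum_i `|((h i)^`M(a)).@[u ord0]|)).
    have := sumr_ge0 (F := fun i => `|((h i)^`M(a)).@[u ord0]|) (index_enum (E + I)%type)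
       (P := xpredT) (fun i _ => normr_ge0 _) => s0; nra.
  by move=> e e1 e2 e3; have [lam [_ _]] := key e e1 e2 e3; apply.
- move=> j; rewrite -oppr_le0; apply: (small (1 + 2 * T)); first by lra.
  move=> e e1 e2 e3; have [lam [l0 /(_ (inr j)) + _]] := key e e1 e2 e3.
  by rewrite ler_norml => /andP[]; have := l0 j; lra.
- move=> j; rewrite /lim actE; case: eqP => [->|_]; first by rewrite mulr0.
  by rewrite mul0r.
Qed.

End Multipliers.

(** * Homogenization *)

Section EulerIdentities.
Context {R : realType} {n : nat}.
Implicit Types (p : {mpoly R[n]}) (P Q : {mpoly R[n.+1]}) (u : 'rV[R]_n.+1).

Definition hmonom (e : nat) (a : 'X_{1..n}) : 'X_{1..n.+1} :=
  [multinom oapp a e (unlift ord0 i) | i < n.+1].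

Lemma hmonom0 e a : hmonom e a ord0 = e.
Proof. by rewrite mnmE unlift_none. Qed.

Lemma hmonom_lift e a i : hmonom e a (lift ord0 i) = a i.
Proof. by rewrite mnmE liftK. Qed.

Lemma mdeg_hmonom e a : mdeg (hmonom e a) = (e + mdeg a)%N.
Proof.
rewrite !mdegE big_ord_recl hmonom0; congr (_ + _)%N.
by apply: eq_bigr => i _; rewrite hmonom_lift.
Qed.

Lemma hmonomB e a i : (hmonom e a - U_(lift ord0 i))%MM = hmonom e (a - U_(i))%MM.
Proof.
apply/mnmP => j; rewrite mnmBE; case: (unliftP ord0 j) => [k ->|->].
  by rewrite !hmonom_lift mnmBE !mnm1E; congr (_ - _)%N.
by rewrite !hmonom0 mnm1E subn0.
Qed.

Lemma homogenizeX p : homogenize p =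
  \sum_(a <- msupp p) p@_a *: 'X_[hmonom (mdegree p - mdeg a) a].
Proof.
apply: eq_bigr => a _; congr (_ *: _); rewrite [RHS]mpolyXE_id big_ord_recl hmonom0.
by congr (_ * _); apply: eq_bigr => i _; rewrite hmonom_lift.
Qed.

Lemma mdeg_mdegree p a : a \in msupp p -> (mdeg a <= mdegree p)%N.
Proof. by move=> /msize_mdeg_lt; rewrite /mdegree; case: (msize p). Qed.

Definition tail u : 'rV[R]_n := \row_i u ord0 (lift ord0 i).

Lemma hpoint_tail u : hpoint (u ord0 ord0) (tail u) = u.
Proof.
apply/rowP => i; rewrite mxE; case: (unliftP ord0 i) => [j ->|->] //=.
by rewrite mxE.
Qed.

Lemma meval_hmonom e a u : u ord0 ord0 != 0 -> 'X_[hmonom e a].@[u ord0] =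
  u ord0 ord0 ^+ (e + mdeg a) * 'X_[a].@[((u ord0 ord0)^-1 *: tail u) ord0].
Proof.
move=> u0; rewrite !mevalX big_ord_recl hmonom0 exprD -mulrA; congr (_ * _).
rewrite mdegE -prodrXr -big_split /=; apply: eq_bigr => i _.
by rewrite hmonom_lift !mxE -exprMn mulrA divff // mul1r.
Qed.

(** The factor u_0 stays on the left because an exponent deg p - 1 would be truncated for constant
    p. *)
Lemma mderiv_homogenize p u a : u ord0 ord0 != 0 ->
  u ord0 ord0 * ((homogenize p)^`M(lift ord0 a)).@[u ord0] =
  u ord0 ord0 ^+ mdegree p *
    (p^`M(a)).@[((u ord0 ord0)^-1 *: tail u) ord0].
Proof.
move=> u0; rewrite homogenizeX mderiv_sum meval_sum /mderiv (meval_sum _ (msupp p)).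
rewrite !mulr_sumr big_seq [RHS]big_seq; apply: eq_bigr => m mp.
rewrite -/(mderiv (lift ord0 a) _) mderivZ mderivX hmonom_lift !mevalZ hmonomB meval_hmonom //.
have [->|ma] := posnP (m a); first by rewrite !(mul0r, mulr0).
have dm : mdeg m = (mdeg (m - U_(a))%MM).+1.
  by rewrite -{1}(@submK _ U_(a) m) ?mdegD ?mdeg1 ?addn1 // lep1mP -lt0n.
have mD := mdeg_mdegree mp.
have -> : u ord0 ord0 ^+ mdegree p =
    u ord0 ord0 * u ord0 ord0 ^+ (mdegree p - mdeg m + mdeg (m - U_(a))%MM).
  by rewrite -exprS -addnS -dm subnK.
move: (p@_m) ((m a)%:R : R) (_ ^+ _) ('X_[_].@[_]) => x y z t.
by ring.
Qed.

Lemma mderiv2_homogenize p u a b : u ord0 ord0 != 0 ->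
  u ord0 ord0 ^+ 2 * ((homogenize p)^`M(lift ord0 a)^`M(lift ord0 b)).@[u ord0] =
  u ord0 ord0 ^+ mdegree p *
    (p^`M(a)^`M(b)).@[((u ord0 ord0)^-1 *: tail u) ord0].
Proof.
move=> u0; rewrite homogenizeX (mderiv_sum (lift ord0 a) (msupp p)).
rewrite (mderiv_sum (lift ord0 b) (msupp p)) (meval_sum (u ord0) (msupp p)).
have -> : p^`M(a) = \sum_(m <- msupp p) ((m a)%:R * p@_m) *: 'X_[m - U_(a)] by [].
rewrite mderiv_sum (meval_sum _ (msupp p)).
rewrite !mulr_sumr big_seq [RHS]big_seq; apply: eq_bigr => m mp.
rewrite !mderivZ mderivX mderivZ mderivX hmonom_lift hmonomB hmonom_lift hmonomB.
rewrite mderivX !mevalZ meval_hmonom //.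
have [->|ma] := posnP (m a); first by rewrite !(mul0r, mulr0).
have [->|mb] := posnP ((m - U_(a))%MM b); first by rewrite !(mul0r, mulr0).
have dm : mdeg m = (mdeg (m - U_(a))%MM).+1.
  by rewrite -{1}(@submK _ U_(a) m) ?mdegD ?mdeg1 ?addn1 // lep1mP -lt0n.
have dm2 : mdeg (m - U_(a))%MM = (mdeg (m - U_(a) - U_(b))%MM).+1.
  by rewrite -{1}(@submK _ U_(b) (m - U_(a))%MM) ?mdegD ?mdeg1 ?addn1 // lep1mP -lt0n.
have mD := mdeg_mdegree mp.
have -> : u ord0 ord0 ^+ mdegree p =
    u ord0 ord0 ^+ 2 * u ord0 ord0 ^+ (mdegree p - mdeg m + mdeg (m - U_(a) - U_(b))%MM).
  by rewrite -exprD addnCA add2n -dm2 -dm subnK.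
move: (p@_m) ((m a)%:R : R) (((m - U_(a))%MM b)%:R : R) => x y z.
move: (_ ^+ (_ + _)) ('X_[_].@[_]) => t w.
by ring.
Qed.

(** Homogeneity of degree D encoded by Euler's identity, a form that passes to linear combinations
    and can be differentiated. *)
Definition eulerian D P : Prop := \sum_i 'X_i * P^`M(i) = D%:R%:MP * P.

Lemma eulerianX (a : 'X_{1..n.+1}) : eulerian (mdeg a) 'X_[a].
Proof.
rewrite /eulerian mpolyC_nat -mulrC mulr_natr mdegE -sumrMnr.
apply: eq_bigr => i _; rewrite mderivX.
have [->|ai] := posnP (a i); first by rewrite scale0r mulr0 mulr0n.
rewrite -scalerAr -mpolyXD addmC submK ?lep1mP -?lt0n //.
by rewrite scaler_nat.
Qed.

Lemma eulerian_sum D (J : eqType) (r : seq J) (c : J -> R) (f : J -> {mpoly R[n.+1]}) :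
  (forall j, j \in r -> eulerian D (f j)) -> eulerian D (\sum_(j <- r) c j *: f j).
Proof.
move=> ef; rewrite /eulerian mulr_sumr.
under eq_bigr do rewrite mderiv_sum mulr_sumr.
rewrite exchange_big /= big_seq [RHS]big_seq; apply: eq_bigr => j jr.
under eq_bigr do rewrite mderivZ -scalerAr.
by rewrite -scaler_sumr (ef j jr) -scalerAr.
Qed.

Lemma eulerianB D P Q : eulerian D P -> eulerian D Q -> eulerian D (P - Q).
Proof.
move=> eP eQ; rewrite /eulerian; under eq_bigr do rewrite mderivB mulrBr.
by rewrite sumrB eP eQ mulrBr.
Qed.

Lemma eulerianZ D c P : eulerian D P -> eulerian D (c *: P).
Proof.
move=> eP; rewrite /eulerian; under eq_bigr do rewrite mderivZ -scalerAr.
by rewrite -scaler_sumr eP -scalerAr.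
Qed.

Lemma eulerian_homogenize p : eulerian (mdegree p) (homogenize p).
Proof.
rewrite homogenizeX; apply: eulerian_sum => a ap.
rewrite -[X in eulerian X](subnK (mdeg_mdegree ap)) -mdeg_hmonom.
exact: eulerianX.
Qed.

Lemma eulerianX0 D : eulerian D ('X_ord0 ^+ D).
Proof.
rewrite mpolyXn; have := eulerianX (U_(ord0) *+ D)%MM.
by rewrite mdegMn mdeg1 mul1n.
Qed.

Lemma euler1 D P u : eulerian D P ->
  \sum_i u ord0 i * (P^`M(i)).@[u ord0] = D%:R * P.@[u ord0].
Proof.
move/(congr1 (meval (u ord0))); rewrite mevalM mevalC meval_sum => <-.
by apply: eq_bigr => i _; rewrite mevalM mevalXU.
Qed.

(** Euler's identity differentiated once; the derivative of the factor ['X_a] accounts for the -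
    1. *)
Lemma euler2 D P u a : eulerian D P ->
  \sum_i u ord0 i * (P^`M(a)^`M(i)).@[u ord0] = (D%:R - 1) * (P^`M(a)).@[u ord0].
Proof.
move/(congr1 (mderiv a)); rewrite mderiv_mulC mderiv_sum.
move/(congr1 (meval (u ord0))); rewrite mevalM mevalC meval_sum mulrBl mul1r => <-.
rewrite -[RHS]addr0; apply/eqP; rewrite eq_sym addr0 subr_eq; apply/eqP.
transitivity (\sum_i (u ord0 i * (P^`M(a)^`M(i)).@[u ord0] +
    (i == a)%:R * (P^`M(i)).@[u ord0])).
  apply: eq_bigr => i _; rewrite mderivM mevalD !mevalM mevalXU mderiv_comm addrC.
  congr (_ + _ * _); rewrite mderivX mnm1E.
  have [->|_] := eqVneq i a; last by rewrite scale0r meval0.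
  have -> : (U_(a) - U_(a))%MM = 0%MM by apply/mnmP => j; rewrite mnmBE subnn mnm0E.
  by rewrite scale1r mpolyX0 meval1.
rewrite big_split /=; congr (_ + _); rewrite (bigD1 a) //= eqxx mul1r big1 ?addr0 //.
by move=> i /negbTE ->; rewrite mul0r.
Qed.

End EulerIdentities.

(** * Transport of the optimality conditions from (P) to (H) *)

Section Transfer.
Context {R : realType} {n : nat} {E I : finType}.
Variables (f : {mpoly R[n]}) (c : E + I -> {mpoly R[n]}).
Implicit Types (u : 'rV[R]_n.+1).

Lemma meval_sphere u : (sphere : {mpoly R[n.+1]}).@[u ord0] = \sum_i u ord0 i ^+ 2 - 1.
Proof.
rewrite /sphere mevalB meval1 (meval_sum _ (index_enum _)); congr (_ - _).
by apply: eq_bigr => i _; rewrite mevalXn mevalXU.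
Qed.

Lemma feasible_hsphere u : feasible (hconstr c) u <-> hsphere c u.
Proof.
split=> [[hE hI]|[[hE hI u0] us]].
  split; first split.
  - by move=> i; exact: (hE (Some i)).
  - by move=> j; exact: (hI (Some j)).
  - by have := hI None; rewrite /= mevalXU.
  - by have /eqP := hE None; rewrite [hconstr _ _]/= meval_sphere subr_eq0 => /eqP.
split=> [[i|]|[j|]] /=; [exact: hE| |exact: hI|by rewrite mevalXU].
by rewrite meval_sphere us subrr.
Qed.

Lemma meval_homogenize (p : {mpoly R[n]}) u : u ord0 ord0 != 0 ->
  (homogenize p).@[u ord0] =
    u ord0 ord0 ^+ mdegree p * p.@[((u ord0 ord0)^-1 *: tail u) ord0].
Proof. by move=> u0; rewrite -{1}(hpoint_tail u) homogenizeE. Qed.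

Lemma eulerian_hobj : eulerian (mdegree f) (hobj f c).
Proof.
apply: eulerianB; first exact: eulerian_homogenize.
by apply: eulerianZ; exact: eulerianX0.
Qed.

Lemma mderiv_X0_lift D (a : 'I_n) :
  ('X_ord0 ^+ D : {mpoly R[n.+1]})^`M(lift ord0 a) = 0.
Proof. by rewrite mpolyXn mderivX mulmnE mnm1E /= mul0n scale0r. Qed.

Lemma mderiv_hobj (a : 'I_n) :
  (hobj f c)^`M(lift ord0 a) = (homogenize f)^`M(lift ord0 a).
Proof. by rewrite /hobj mderivB mderivZ mderiv_X0_lift scaler0 subr0. Qed.

(* The multipliers are scaled by [u_0^(d - d_i)]. By Euler's identities [u] is
   orthogonal to the active gradients of the [c_i] and lies in the kernel of the
   Hessian form restricted to their orthogonal complement; the sphere constraint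
   removes precisely this direction. *)
Lemma strict_kkt_homogenize u lam : 0 < u ord0 ord0 ->
  feasible (hconstr c) u -> (hobj f c).@[u ord0] = 0 ->
  strict_kkt c f ((u ord0 ord0)^-1 *: tail u) lam ->
  exists lam', strict_kkt (hconstr c) (hobj f c) u lam'.
Proof.
set x := _^-1 *: _; set u0 := u ord0 ord0 => u0_gt0 fu Fu [gradf lam_pos lam0 sosc].
have u0N : u0 != 0 by rewrite gt_eqF.
pose d := mdegree f; pose dc i := mdegree (c i).
pose mu i := lam i * (u0 ^+ d / u0 ^+ dc i).
have mu_fac i : 0 < u0 ^+ d / u0 ^+ dc i by rewrite divr_gt0 // exprn_gt0.
have mu_mul i t : mu i * (u0 ^+ dc i * t) = u0 ^+ d * (lam i * t).
  rewrite /mu; have := expf_neq0 (dc i) u0N.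
  move: (u0 ^+ d) (u0 ^+ dc i) (lam i) => y z l zN; by field.
(* [x_0] gets 0 because it is inactive; the sphere gets 0 because, by Euler's identity, u pairs to 0
   with the gradient of F and the active gradients of the c_i, but not with that of the sphere. *)
pose lam' (l : option E + option I) : R := match l with
  | inl (Some i) => mu (inl i) | inr (Some j) => mu (inr j) | _ => 0 end.
pose hc (l : E + I) : option E + option I := match l with
  | inl i => inl (Some i) | inr j => inr (Some j) end.
have hcE i : hconstr c (hc i) = homogenize (c i) by case: i.
have sum_lam (V : lmodType R) (g : option E + option I -> V) :
    \sum_l lam' l *: g l = \sum_i mu i *: g (hc i).
  rewrite !big_sumType /=; congr (_ + _).
    rewrite (bigD1 None) //= scale0r add0r.
    rewrite (reindex_omap Some id) /=; last by case.
    by apply: eq_bigl => i; rewrite eqxx.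
  rewrite (bigD1 None) //= scale0r add0r.
  rewrite (reindex_omap Some id) /=; last by case.
  by apply: eq_bigl => i; rewrite eqxx.
have cu i : (homogenize (c i)).@[u ord0] = u0 ^+ dc i * (c i).@[x ord0].
  by rewrite meval_homogenize.
have cu0 i : ((homogenize (c i)).@[u ord0] == 0) = ((c i).@[x ord0] == 0).
  by rewrite cu mulf_eq0 expf_eq0 (negbTE u0N) andbF.
have mu_act i : mu i = 0 \/ (homogenize (c i)).@[u ord0] = 0.
  have [/eqP ->|] := boolP ((homogenize (c i)).@[u ord0] == 0); first by right.
  case: i => [i|j]; first by case: fu => /(_ (Some i)) /= -> _; rewrite eqxx.
  by rewrite cu0 => /lam0 l0; left; rewrite /mu l0 mul0r.
have dF a : u0 * ((hobj f c)^`M(lift ord0 a)).@[u ord0] =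
    u0 ^+ d * (f^`M(a)).@[x ord0] by rewrite mderiv_hobj mderiv_homogenize.
have dC i a : u0 * ((homogenize (c i))^`M(lift ord0 a)).@[u ord0] =
    u0 ^+ dc i * ((c i)^`M(a)).@[x ord0] by rewrite mderiv_homogenize.
(* The stationarity residual. Its x-components vanish by stationarity in (P); Euler's identities
   give sum u_a W_a = 0, and u_0 != 0 yields the x_0-component. *)
pose W a := ((hobj f c)^`M(a)).@[u ord0] -
  \sum_i mu i * ((homogenize (c i))^`M(a)).@[u ord0].
have Wl a : W (lift ord0 a) = 0.
  apply: (mulfI u0N); rewrite mulr0 /W mulrBr dF.
  have -> : (f^`M(a)).@[x ord0] = \sum_i lam i * ((c i)^`M(a)).@[x ord0].
    transitivity (grad f x ord0 a); first by rewrite mxE.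
    by rewrite gradf summxE; apply: eq_bigr => i _; rewrite !mxE.
  rewrite 2!mulr_sumr -sumrB big1 // => i _; rewrite [u0 * _]mulrCA dC mu_mul.
  by rewrite subrr.
have W0 : W ord0 = 0.
  apply: (mulfI u0N); rewrite mulr0.
  transitivity (\sum_a u ord0 a * W a).
    by rewrite big_ord_recl big1 ?addr0 // => a _; rewrite Wl mulr0.
  rewrite /W; under eq_bigr do rewrite mulrBr.
  rewrite sumrB (euler1 _ eulerian_hobj) Fu mulr0 sub0r.
  under eq_bigr do rewrite mulr_sumr; rewrite exchange_big /=.
  rewrite big1 ?oppr0 // => i _; under eq_bigr do rewrite mulrCA.
  rewrite -mulr_sumr (euler1 _ (eulerian_homogenize (c i))).
  by case: (mu_act i) => ->; rewrite ?mulr0 ?mul0r.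
have Wz a : W a = 0 by case: (unliftP ord0 a) => [b ->|->].
have gradE : grad (hobj f c) u = \sum_l lam' l *: grad (hconstr c l) u.
  rewrite sum_lam; apply/rowP => a; rewrite mxE summxE.
  have /eqP := Wz a; rewrite /W subr_eq0 => /eqP ->.
  by apply: eq_bigr => i _; rewrite hcE !mxE.
exists lam'; split=> //.
- move=> [j|] /=; last by rewrite mevalXU => u00; case/eqP: u0N.
  move=> /eqP; rewrite cu0 => /eqP /lam_pos lj; exact: mulr_gt0.
- move=> [j|] //=; rewrite cu0 => /lam0 lj; by rewrite /mu lj mul0r.
set L := lagrangian (hobj f c) (hconstr c) lam'.
set H := hessian L u => v v0 vact.
have LE : L = hobj f c - \sum_i mu i *: homogenize (c i).
  by rewrite /L /lagrangian sum_lam; under eq_bigr do rewrite hcE.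
pose B (y z : 'rV[R]_n.+1) := (y *m H *m z^T) ord0 ord0.
pose gc i := grad (homogenize (c i)) u.
have HE a b : H a b = ((hobj f c)^`M(a)^`M(b)).@[u ord0] -
    \sum_i mu i * ((homogenize (c i))^`M(a)^`M(b)).@[u ord0].
  rewrite mxE LE !mderivB mevalB; congr (_ - _).
  rewrite (mderiv_sum a (index_enum (E + I)%type)).
  rewrite (mderiv_sum b (index_enum (E + I)%type)).
  rewrite (meval_sum _ (index_enum (E + I)%type)).
  by apply: eq_bigr => i _; rewrite !mderivZ mevalZ.
have symH : H^T = H.
  apply/matrixP => a b; rewrite mxE !HE; congr (_ - _).
    by rewrite mderiv_comm.
  by apply: eq_bigr => i _; rewrite [X in mu i * X.@[_]]mderiv_comm.
have Hs a b : H a b = H b a by rewrite -[in LHS]symH mxE.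
have Bsym y z : B y z = B z y.
  rewrite /B; transitivity ((y *m H *m z^T)^T ord0 ord0); first by rewrite [RHS]mxE.
  by rewrite !trmx_mul trmxK symH mulmxA.
(* The factors d - 1 and d_i - 1 of [euler2] meet through stationarity, leaving d - d_i; so u H lies
   in the span of the active gradients. *)
have uH : u *m H = \sum_i (mu i * (d%:R - (dc i)%:R)) *: gc i.
  apply/rowP => a; rewrite mxE summxE.
  under eq_bigr do rewrite Hs HE mulrBr.
  rewrite sumrB (euler2 _ a eulerian_hobj).
  under [X in _ - X]eq_bigr do rewrite mulr_sumr.
  rewrite [X in _ - X]exchange_big /=.
  have -> : ((hobj f c)^`M(a)).@[u ord0] =
      \sum_i mu i * ((homogenize (c i))^`M(a)).@[u ord0].
    by have /eqP := Wz a; rewrite /W subr_eq0 => /eqP.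
  rewrite mulr_sumr -sumrB; apply: eq_bigr => i _.
  under eq_bigr do rewrite mulrCA.
  rewrite -mulr_sumr (euler2 _ a (eulerian_homogenize (c i))) !mxE -/d -/(dc i).
  move: (mu i) (_.@[_]) (d%:R : R) ((dc i)%:R : R) => y z t1 t2; by ring.
have Bu z : (forall i, (homogenize (c i)).@[u ord0] = 0 ->
    (gc i *m z^T) ord0 ord0 = 0) -> B u z = 0.
  move=> gz; rewrite /B uH mulmx_suml summxE big1 // => i _.
  rewrite -scalemxAl mxE.
  by case: (mu_act i) => [->|/gz ->]; rewrite ?mul0r ?mulr0.
have gu i : (homogenize (c i)).@[u ord0] = 0 -> (gc i *m u^T) ord0 ord0 = 0.
  move=> ci; rewrite mxE; under eq_bigr do rewrite !mxE mulrC.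
  by rewrite (euler1 _ (eulerian_homogenize (c i))) ci mulr0.
have gv i : (homogenize (c i)).@[u ord0] = 0 -> (gc i *m v^T) ord0 ord0 = 0.
  move=> ci; rewrite /gc -hcE; apply: vact; rewrite unfold_in /active /=.
  by rewrite hcE; apply/eqP.
(* Chosen to cancel the x_0-coordinate of [om], which then comes from a vector of the original
   space; the form takes the same value on v and [om]. *)
pose al := v ord0 ord0 / u0.
pose om := v - al *: u.
have vE : v = al *: u + om by rewrite addrC subrK.
have gom i : (homogenize (c i)).@[u ord0] = 0 -> (gc i *m om^T) ord0 ord0 = 0.
  move=> ci; rewrite /om linearB /= linearZ /= mulmxBr -scalemxAr.
  have -> (P Q : 'M[R]_1) (k : R) : (P - k *: Q) ord0 ord0 = P ord0 ord0 - k * Q ord0 ord0.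
    by rewrite !mxE.
  by rewrite gv // gu // mulr0 subrr.
have BE : B v v = B om om.
  have BD y1 y2 z : B (al *: y1 + y2) z = al * B y1 z + B y2 z.
    by rewrite /B mulmxDl mulmxDl -!scalemxAl !mxE.
  rewrite {1}vE BD Bu // mulr0 add0r Bsym {1}vE BD Bu // mulr0 add0r.
  by [].
have om0 : om ord0 ord0 = 0.
  by rewrite !mxE -/u0 /al divfK // subrr.
pose w := tail om.
(* Otherwise v = al u, and the sphere gradient 2 u pairs with it to 2 al; tangency would force v =
   0. *)
have w0 : w != 0.
  apply/eqP => wz; have omz : om = 0.
    rewrite -(hpoint_tail om) -/w wz om0; apply/rowP => i; rewrite !mxE.
    by case: unliftP => [j _|_] //=; rewrite mxE.
  have := vact (inl None); rewrite unfold_in /active /=.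
  case: fu => /(_ None) /= sph _; rewrite sph eqxx => /(_ isT).
  rewrite vE omz addr0 linearZ /= -scalemxAr mxE [X in _ * X]mxE.
  have -> : \sum_j grad sphere u ord0 j * u^T j ord0 = 2 * \sum_j u ord0 j ^+ 2.
    rewrite mulr_sumr; apply: eq_bigr => j _; rewrite !mxE /sphere.
    rewrite mderivB (mderiv_sum j (index_enum 'I_n.+1)) -mpolyC1 mderivC subr0.
    rewrite (bigD1 j) //= big1 ?addr0.
      rewrite mpolyXn mderivX mulmnE mnm1E eqxx mevalZ.
      have -> : (U_(j) *+ 2 - U_(j))%MM = U_(j)%MM.
        by apply/mnmP => k; rewrite mnmBE mulmnE mnm1E; case: (_ == _).
      by rewrite mevalXU expr2 mulrA.
    move=> k /negbTE kj; rewrite mpolyXn mderivX mulmnE mnm1E kj mul0n scale0r.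
    by [].
  have -> : \sum_j u ord0 j ^+ 2 = 1.
    by move: sph; rewrite meval_sphere => /eqP; rewrite subr_eq0 => /eqP.
  rewrite mulr1 => /eqP; rewrite mulf_eq0 pnatr_eq0 orbF => /eqP al0.
  by move: v0; rewrite vE omz al0 scale0r add0r eqxx.
have wact i : i \in active c x -> (grad (c i) x *m w^T) ord0 ord0 = 0.
  rewrite unfold_in /active /= => ci.
  have := gom i; rewrite /gc => /(_ (eqP _)); rewrite cu0 => /(_ ci).
  rewrite mxE big_ord_recl [om^T _ _]mxE om0 mulr0 add0r.
  move/(congr1 ( *%R u0)); rewrite mulr0 mulr_sumr => S0.
  apply: (mulfI (expf_neq0 (dc i) u0N)); rewrite mulr0 -S0 mxE mulr_sumr.
  apply: eq_bigr => a _.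
  rewrite [grad (c i) _ _ _]mxE [grad (homogenize _) _ _ _]mxE [w^T _ _]mxE.
  by rewrite [om^T _ _]mxE [w _ _]mxE (mulrA (u0 ^+ _)) -dC mulrA.
have := sosc w w0 wact.
suff BomE : u0 ^+ 2 * B om om = u0 ^+ d *
    (w *m hessian (lagrangian f c lam) x *m w^T) ord0 ord0.
  move=> Q; have : 0 < u0 ^+ 2 * B om om by rewrite BomE mulr_gt0 // exprn_gt0.
  by rewrite -BE pmulr_rgt0 // exprn_gt0.
rewrite /B !quadratic_formE big_ord_recl big1 ?add0r; last first.
  by move=> b _; rewrite om0 !mul0r.
rewrite !mulr_sumr; apply: eq_bigr => a _.
rewrite big_ord_recl om0 mulr0 mul0r add0r !mulr_sumr; apply: eq_bigr => b _.
have -> : om ord0 (lift ord0 a) = w ord0 a by rewrite [RHS]mxE.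
have -> : om ord0 (lift ord0 b) = w ord0 b by rewrite [RHS]mxE.
rewrite HE [hessian (lagrangian f c lam) _ _ _]mxE mderiv_hobj.
suff -> : u0 ^+ 2 * (w ord0 a * w ord0 b *
    (((homogenize f)^`M(lift ord0 a)^`M(lift ord0 b)).@[u ord0] -
    \sum_i mu i * ((homogenize (c i))^`M(lift ord0 a)^`M(lift ord0 b)).@[u ord0])) =
   w ord0 a * w ord0 b * (u0 ^+ d * ((lagrangian f c lam)^`M(a)^`M(b)).@[x ord0]).
  by rewrite mulrCA.
rewrite mulrCA; congr (_ * _); rewrite mulrBr mderiv2_homogenize // -/u0 -/x -/d.
rewrite /lagrangian !mderivB mevalB mulrBr; congr (_ - _).
rewrite (mderiv_sum a (index_enum (E + I)%type)).
rewrite (mderiv_sum b (index_enum (E + I)%type)).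
rewrite (meval_sum _ (index_enum (E + I)%type)) !mulr_sumr.
apply: eq_bigr => i _; rewrite mulrCA mderiv2_homogenize // -/u0 -/x -/(dc i).
by rewrite mu_mul !mderivZ mevalZ.
Qed.

End Transfer.

(** * Membership in the quadratic module *)

Section FiniteZeros.
Context {R : realType} {m : nat} {E I : finType}.
Variables (h : E + I -> {mpoly R[m]}) (e0 : E).
Hypothesis he0 : h (inl e0) = \sum_(i < m) 'X_i ^+ 2 - 1.
Variable F : {mpoly R[m]}.
Hypothesis F_local : forall u, feasible h u -> F.@[u ord0] = 0 -> locally_quadratic h F u.

Lemma finite_zeros : exists s : seq 'rV[R]_m, uniq s /\
  forall u, u \in s <-> feasible h u /\ F.@[u ord0] = 0.
Proof.
pose Z := feasible h `&` [set u | F.@[u ord0] = 0].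
have cZ : compact Z.
  by apply: compact_level; [exact: (compact_feasible he0)|exact: continuous_meval].
have /choice[r rP] : forall u : 'rV[R]_m, exists r : R, 0 < r /\ (Z u ->
    forall v, Z v -> (dist2 u).@[v ord0] < r -> v = u).
  move=> u; have [[fu Fu]|nZ] := pselect (Z u); last by exists 1.
  have [d [A [d0 qF]]] := F_local fu Fu.
  (* At another zero v the certificate reads D (A D - d) >= 0 with D = |v - u|^2, which excludes 0 <
     D < d / (|A| + 1). *)
  exists (d / (`|A| + 1)); split; first by rewrite divr_gt0 // ltr_wpDl.
  move=> _ v [fv Fv]; rewrite ltr_pdivlMr ?ltr_wpDl // => Dv.
  apply: dist2_eq0; have := qmodule_ge0 fv qF.
  rewrite mevalD mevalB Fv !mevalM !mevalC sub0r.
  move: Dv; have : 0 <= (dist2 u).@[v ord0] by exact/sos_ge0/dist2_sos.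
  move: (_.@[_]) => D D0 Dv H; apply/eqP; rewrite eq_le D0 andbT leNgt; apply/negP => Dp.
  have := ler_norm A => hA.
  have h1 : A * D < d by have := normr_ge0 A; nra.
  by have : D * (A * D) < D * d; [rewrite ltr_pM2l|move: H; lra].
have openU u : open [set v : 'rV[R]_m | (dist2 u).@[v ord0] < r u].
  exact: ((continuousP _).1 (@continuous_meval R m (dist2 u)) _ (@open_lt _ (r u))).
move: cZ; rewrite compact_cover => /(_ _ Z
   (fun u => [set v : 'rV[R]_m | (dist2 u).@[v ord0] < r u])) [||D' D'Z cov].
- by move=> u _; exact: openU.
- by move=> u Zu; exists u => //=; rewrite dist2_id; case: (rP u).
exists (enum_fset D'); split; first exact: fset_uniq.
move=> u; split=> [uD|Zu]; first exact: (set_mem (D'Z u uD)).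
have [v /= vD Dv] := cov u Zu.
have Zv : Z v by exact: (set_mem (D'Z v vD)).
by have [_ /(_ Zv u Zu Dv) ->] := rP v.
Qed.

Theorem qmodule_of_locally_quadratic :
  (forall u, feasible h u -> 0 <= F.@[u ord0]) -> qmodule h F.
Proof.
move=> F0; have [s [us sP]] := finite_zeros.
have [|u us'|Y [B [qF Y0]]] := glue_locally_quadratic he0 (F := F) us.
- by move=> u /sP[].
- by have /sP[fu Fu] := us'; exact: F_local.
have D0 (u : 'rV[R]_m) : (\prod_(w <- s) dist2 w).@[u ord0] = 0 -> u \in s.
  move/eqP; rewrite meval_prod prodf_seq_eq0 => /hasP[w ws /= /eqP].
  by move/dist2_eq0 ->.
apply: (qmodule_of_local he0 _ F0 _ _ qF).
- by apply: sos_prod => w _; exact: dist2_sos.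
- move=> u fu Fu; apply/eqP; rewrite meval_prod prodf_seq_eq0.
  apply/hasP; exists u; last by rewrite /= dist2_id.
  exact/sP.
- by move=> u _ /D0; exact: Y0.
Qed.

End FiniteZeros.

(** * Relaxations *)

Section Truncation.
Context {R : realType} {n : nat} {E I : finType}.
Variable c : E + I -> {mpoly R[n]}.
Implicit Types (p q : {mpoly R[n.+1]}) (k : nat).

Definition qmodule_le k p : Prop := exists p1 p2,
  [/\ ideal_trunc (heq c) k p1, qmodule_trunc (hineq c) k p2 & p = p1 + p2].

Lemma qmodule_le_exists p : qmodule (hconstr c) p ->
  exists N, forall k, (N <= k)%N -> qmodule_le k p.
Proof.
move=> [q [s0 [s [ss0 ss ->]]]].
exists (msize s0 + \sum_(l : option E) (msize (q l) + mdegree (heq c l)) +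
  \sum_(l : option I) (msize (s l) + (2 * uphalf (mdegree (hineq c l)))))%N => k Nk.
exists (\sum_l heq c l * q l), (s0 + \sum_l hineq c l * s l); split=> //.
- exists q; split=> // l; move: Nk; rewrite (bigD1 l) //=.
  by set X := (\sum_(_ | _) _)%N; set Y := (\sum_(_ | _) _)%N; lia.
exists s0, s; split=> //; first by split=> //; move: Nk;
  set X := (\sum_(_ | _) _)%N; set Y := (\sum_(_ | _) _)%N; lia.
move=> l; split=> //; move: Nk; rewrite [X in (_ + X <= _)%N](bigD1 l) //=.
by set X := (\sum_(_ | _) _)%N; set Y := (\sum_(_ | _) _)%N; lia.
Qed.

Lemma qmodule_leD k p q : qmodule_le k p -> qmodule_le k q -> qmodule_le k (p + q).
Proof.
move=> [p1 [p2 [[q1 [sq1 ->]] [s1 [t1 [[ss1 ls1] st1 ->]]] ->]]].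
move=> [p3 [p4 [[q2 [sq2 ->]] [s2 [t2 [[ss2 ls2] st2 ->]]] ->]]].
have ms (a b : {mpoly R[n.+1]}) M : (msize a <= M)%N -> (msize b <= M)%N ->
    (msize (a + b) <= M)%N.
  by move=> ha hb; apply: leq_trans (msizeD_le _ _) _; rewrite geq_max ha.
exists (\sum_j heq c j * (q1 j + q2 j)),
  (s1 + s2 + \sum_j hineq c j * (t1 j + t2 j)); split.
- by exists (fun j => q1 j + q2 j); split=> // j; exact: ms.
- exists (s1 + s2), (fun j => t1 j + t2 j); split=> //.
    by split; [exact: sosD|exact: ms].
  move=> j; have [a1 b1] := st1 j; have [a2 b2] := st2 j.
  by split; [exact: sosD|exact: ms].
under [X in _ = X + _]eq_bigr do rewrite mulrDr.
under [X in _ = _ + (_ + X)]eq_bigr do rewrite mulrDr.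
by rewrite !big_split /=; ring.
Qed.

Lemma qmodule_leZ k (a : R) p : 0 <= a -> qmodule_le k p -> qmodule_le k (a *: p).
Proof.
move=> a0 [p1 [p2 [[q1 [sq1 ->]] [s1 [t1 [[ss1 ls1] st1 ->]]] ->]]].
have ms (b : {mpoly R[n.+1]}) M : (msize b <= M)%N -> (msize (a *: b) <= M)%N.
  by apply: leq_trans; exact: msizeZ_le.
have sZ (b : {mpoly R[n.+1]}) : sos b -> sos (a *: b).
  by move=> sb; rewrite -mul_mpolyC; apply: sosM => //; exact: sosC.
exists (\sum_j heq c j * (a *: q1 j)),
  (a *: s1 + \sum_j hineq c j * (a *: t1 j)); split.
- by exists (fun j => a *: q1 j); split=> // j; exact: ms.
- exists (a *: s1), (fun j => a *: t1 j); split=> //.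
    by split; [exact: sZ|exact: ms].
  by move=> j; have [a1 b1] := st1 j; split; [exact: sZ|exact: ms].
rewrite !scalerDr !scaler_sumr; congr (_ + (_ + _)).
  by apply: eq_bigr => j _; rewrite scalerAr.
by apply: eq_bigr => j _; rewrite scalerAr.
Qed.

End Truncation.

Section Pairing.
Context {R : realType} {m : nat}.
Implicit Types (p q : {mpoly R[m]}).

Lemma pairingD k p q (y : @tms R m k) : pairing (p + q) y = pairing p y + pairing q y.
Proof.
by rewrite /pairing -big_split; apply: eq_bigr => a _; rewrite mcoeffD mulrDl.
Qed.

Lemma pairingZ k (a : R) p (y : @tms R m k) : pairing (a *: p) y = a * pairing p y.
Proof. by rewrite /pairing mulr_sumr; apply: eq_bigr => i _; rewrite mcoeffZ mulrA. Qed.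

Lemma pairing0 k (y : @tms R m k) : pairing 0 y = 0.
Proof. by rewrite /pairing big1 // => i _; rewrite mcoeff0 mul0r. Qed.

Lemma pairing_sum k (J : Type) (r : seq J) (f : J -> {mpoly R[m]}) (y : @tms R m k) :
  pairing (\sum_(j <- r) f j) y = \sum_(j <- r) pairing (f j) y.
Proof.
elim: r => [|j r IH]; first by rewrite !big_nil pairing0.
by rewrite !big_cons pairingD IH.
Qed.

Lemma locpoly_surj k g q : (msize q <= k.+1 - uphalf (mdegree g))%N ->
  exists v : 'rV[R]_#|locbasis k g|, locpoly v = q.
Proof.
move=> sq; exists (\row_i q@_(bmnm (enum_val i))).
rewrite {2}(mpolywE sq) (reindex (fun i : 'I_#|locbasis k g| => enum_val i)) /=.
  by apply: eq_bigr => i _; rewrite mxE.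
by exists enum_rank => a _; [exact: enum_valK|exact: enum_rankK].
Qed.

Lemma pairing_locmx k g q (y : @tms R m k) : (msize q <= k.+1 - uphalf (mdegree g))%N ->
  exists v : 'rV[R]_#|locbasis k g|,
    pairing (g * q ^+ 2) y = (v *m locmx g y *m v^T) ord0 ord0.
Proof. by move=> /locpoly_surj[v <-]; exists v; rewrite locmxE. Qed.

(** [sos] carries no degree bound, so the threshold is built from the degrees of one decomposition:
    each of its squares must fit into the localizing matrix. *)
Lemma pairing_psd_ge0 g s : sos s -> exists N, forall k (y : @tms R m k), (N <= k)%N ->
  psd (locmx g y) -> 0 <= pairing (g * s) y.
Proof.
move=> [r ->]; elim: r => [|q r [N HN]].
  by exists 0%N => k y _ _; rewrite big_nil mulr0 pairing0.
exists (N + (msize q + uphalf (mdegree g)))%N => k y Nk ps.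
rewrite big_cons mulrDr pairingD addr_ge0 //; last first.
  by apply: HN => //; apply: leq_trans Nk; exact: leq_addr.
have [|v ->] := @pairing_locmx k g q y; last exact: ps.
by move: Nk; set M := uphalf _; lia.
Qed.

(* The localizing matrix only controls squares: use
   [4 q = (q + 1)^2 - (q - 1)^2]. *)
Lemma pairing_loc0 g q : exists N, forall k (y : @tms R m k), (N <= k)%N ->
  locmx g y = 0 -> pairing (g * q) y = 0.
Proof.
exists (msize (q + 1) + msize (q - 1) + uphalf (mdegree g))%N => k y Nk l0.
have -> : g * q = (4^-1 : R) *: (g * (q + 1) ^+ 2 + (- 1 : R) *: (g * (q - 1) ^+ 2)).
  apply: (@scalerI _ _ (4 : R)); first by rewrite pnatr_eq0.
  rewrite scalerA divff ?pnatr_eq0 // scale1r scaleN1r -mul_mpolyC (mpolyC_nat _ _ 4).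
  by ring.
rewrite pairingZ pairingD pairingZ.
have [|v ->] := @pairing_locmx k g (q + 1) y.
  by move: Nk; set M := uphalf _; lia.
have [|w ->] := @pairing_locmx k g (q - 1) y.
  by move: Nk; set M := uphalf _; lia.
by rewrite l0 !mulmx0 !mul0mx !mxE !(mulr0, addr0).
Qed.

(* The moments of the Dirac mass at [u] divided by [s]. *)
Definition point_tms k (u : 'rV[R]_m) (s : R) : tms k :=
  fun a => 'X_[a].@[u ord0] / s.

Arguments point_tms k u s : clear implicits.

Lemma pairing_point k (u : 'rV[R]_m) (s : R) p : (msize p <= (2 * k).+1)%N ->
  pairing p (point_tms k u s) = p.@[u ord0] / s.
Proof.
move=> sp; rewrite {2}(mpolywE sp) meval_sum mulr_suml; apply: eq_bigr => a _.
by rewrite mevalZ mulrA.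
Qed.

Lemma locmx_point k (u : 'rV[R]_m) (s : R) g i j : locmx g (point_tms k u s) i j =
  g.@[u ord0] / s *
   ('X_[bmnm (enum_val i)].@[u ord0] * 'X_[bmnm (enum_val j)].@[u ord0]).
Proof.
rewrite mxE pairing_point; last first.
  have [g0|g0] := boolP (g == 0).
    have -> : g * 'X_[(bmnm (enum_val i) + bmnm (enum_val j))%MM] = 0.
      by apply/eqP; rewrite mulf_eq0 g0.
    by rewrite msize0.
  have XN0 (a : 'X_{1..m}) : ('X_[a] : {mpoly R[m]}) != 0.
    by rewrite -msize_poly_eq0 msizeX.
  rewrite msizeM // msizeX mdegD.
  have := bmdeg (enum_val i); have := bmdeg (enum_val j); rewrite /mdegree.
  move: (mdeg (enum_val i)) (mdeg (enum_val j)) => a b.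
  (* Rounding deg g / 2 up ensures that the matrix entries only involve moments of order at most 2
     k, so the pairing cuts nothing off. *)
  have uh d : (d <= 2 * uphalf d)%N.
    rewrite -{1}[d]odd_double_half uphalf_half mul2n doubleD leq_add2r.
    by case: (odd d).
  have := uh (msize g).-1; move: (msize g) (uphalf _) => d e; lia.
rewrite mevalM mpolyXD mevalM; ring.
Qed.

Lemma locmx_point_psd k (u : 'rV[R]_m) (s : R) g :
  0 <= g.@[u ord0] / s -> psd (locmx g (point_tms k u s)).
Proof.
move=> g0 v; rewrite quadratic_formE.
have -> : \sum_a \sum_b v ord0 a * v ord0 b * locmx g (point_tms k u s) a b =
  g.@[u ord0] / s * (\sum_a v ord0 a * 'X_[bmnm (enum_val a)].@[u ord0]) ^+ 2.
  rewrite expr2 mulr_suml mulr_sumr; apply: eq_bigr => a _.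
  rewrite mulr_sumr mulr_sumr; apply: eq_bigr => b _; rewrite locmx_point.
  have alg (x1 x2 x3 x4 x5 : R) :
    x1 * x2 * (x3 * (x4 * x5)) = x3 * (x1 * x4 * (x2 * x5)) by ring.
  exact: alg.
by apply: mulr_ge0 => //; exact: sqr_ge0.
Qed.

End Pairing.

Arguments point_tms {R m} k u s.

Section MomentPositivity.
Context {R : realType} {n : nat} {E I : finType}.
Variables (f : {mpoly R[n]}) (c : E + I -> {mpoly R[n]}).

(* At a fixed order this may fail for members of the truncated ideal when an
   equality has odd degree; a fixed certificate is tested for large [k]. *)
Lemma mom_feasible_ge0 p : qmodule (hconstr c) p ->
  exists N, forall k (y : @tms R n.+1 k), (N <= k)%N -> mom_feasible f c y -> 0 <= pairing p y.
Proof.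
move=> [q [s0 [s [ss0 ss ->]]]].
have /choice[Ne hNe] := fun l => pairing_loc0 (hconstr c (inl l)) (q l).
have /choice[Ni hNi] := fun l => pairing_psd_ge0 (hconstr c (inr l)) (ss l).
have [N0 hN0] := pairing_psd_ge0 1 ss0.
exists (N0 + \sum_l Ne l + \sum_l Ni l)%N => k y Nk [ye yi ym _].
rewrite !pairingD !pairing_sum; apply: addr_ge0; last apply: addr_ge0.
- rewrite big1 // => l _; apply: hNe; last exact: (ye l).
  by move: Nk; rewrite (bigD1 l) //=; set X := (\sum_(_ | _) _)%N;
    set Y := (\sum_(_ | _) _)%N; lia.
- rewrite -[s0]mul1r; apply: hN0 => //.
  by move: Nk; set X := (\sum_(_ | _) _)%N; set Y := (\sum_(_ | _) _)%N; lia.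
apply: sumr_ge0 => l _; apply: hNi; last exact: (yi l).
by move: Nk; rewrite [X in (_ + X <= _)%N](bigD1 l) //=;
  set X := (\sum_(_ | _) _)%N; set Y := (\sum_(_ | _) _)%N; lia.
Qed.

Lemma point_mom_feasible k (u : 'rV[R]_n.+1) : feasible (hconstr c) u -> 0 < u ord0 ord0 ->
  (mdegree f <= 2 * k)%N ->
  mom_feasible f c (point_tms k u (u ord0 ord0 ^+ mdegree f)).
Proof.
move=> [hE hI] u0 dk; have s0 : 0 < u ord0 ord0 ^+ mdegree f by rewrite exprn_gt0.
split.
- move=> l; apply/matrixP => i j; rewrite locmx_point [heq c l]/= (hE l).
  by rewrite !mul0r mxE.
- by move=> l; apply: locmx_point_psd; apply: divr_ge0; [exact: (hI l)|exact: ltW].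
- by apply: locmx_point_psd; rewrite meval1 divr_ge0 // ltW.
rewrite pairing_point; last by rewrite mpolyXn msizeX mdegMn mdeg1 mul1n ltnS.
by rewrite mevalXn mevalXU divff // gt_eqF.
Qed.

End MomentPositivity.

(** * Upper bounds on both values from feasible points of (P) *)

Section Values.
Context {R : realType} {n : nat} {E I : finType}.
Variables (f : {mpoly R[n]}) (c : E + I -> {mpoly R[n]}).
Implicit Types (u : 'rV[R]_n.+1) (x : 'rV[R]_n).

Lemma feasible_dehomogenize u : hcone c u -> 0 < u ord0 ord0 ->
  feasible c ((u ord0 ord0)^-1 *: tail u).
Proof.
move=> [hE hI _] u0; have u0N : u ord0 ord0 != 0 by rewrite gt_eqF.
split=> [i|j].
  have /eqP := hE i; rewrite meval_homogenize // mulf_eq0 expf_eq0 (negbTE u0N).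
  by rewrite andbF => /eqP.
by have := hI j; rewrite meval_homogenize // pmulr_rge0 // exprn_gt0.
Qed.

(** Take (1, x) divided by its Euclidean norm. *)
Lemma feasible_normalize x : feasible c x ->
  exists u, [/\ feasible (hconstr c) u, 0 < u ord0 ord0 &
                x = (u ord0 ord0)^-1 *: tail u].
Proof.
move=> [hE hI]; pose N := 1 + \sum_i x ord0 i ^+ 2.
have N0 : 0 < N.
  by rewrite ltr_pwDl // sumr_ge0 // => i _; exact: sqr_ge0.
pose s := (Num.sqrt N)^-1; have s0 : 0 < s by rewrite invr_gt0 sqrtr_gt0.
pose u := hpoint s (s *: x).
have u0 : u ord0 ord0 = s by rewrite mxE unlift_none.
have ul i : u ord0 (lift ord0 i) = s * x ord0 i by rewrite mxE liftK /= mxE.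
have xE : x = (u ord0 ord0)^-1 *: tail u.
  by apply/rowP => i; rewrite u0 !mxE liftK /= mxE mulrA mulVf ?mul1r // gt_eqF.
have uN : u ord0 ord0 != 0 by rewrite u0 gt_eqF.
exists u; split=> //; last by rewrite u0.
apply/feasible_hsphere; split; first split.
- by move=> i; rewrite meval_homogenize // -xE hE mulr0.
- move=> j; rewrite meval_homogenize // -xE mulr_ge0 // exprn_ge0 // u0.
  exact: ltW.
- by rewrite u0 ltW.
rewrite /= big_ord_recl u0; under eq_bigr do rewrite ul exprMn.
rewrite -mulr_sumr -[X in X + _]mulr1 -mulrDr -/N exprVn sqr_sqrtr ?ltW //.
by rewrite mulVf // gt_eqF.
Qed.

Lemma meval_hobj u : u ord0 ord0 != 0 -> (hobj f c).@[u ord0] =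
  u ord0 ord0 ^+ mdegree f *
    (f.@[((u ord0 ord0)^-1 *: tail u) ord0] - fine (fmin f c)).
Proof.
move=> u0; rewrite /hobj mevalB mevalZ mevalXn mevalXU meval_homogenize //.
by rewrite mulrBr [X in _ - X]mulrC.
Qed.

Lemma fmin_le x : feasible c x -> (fmin f c <= (f.@[x ord0])%:E)%E.
Proof. by move=> fx; apply: ereal_inf_lbound; exists x. Qed.

Lemma sos_value_le k : (sos_value f c k <= fmin f c)%E.
Proof.
apply: ge_ereal_sup => _ [g [p [q [[q1 [_ pE]] [s0 [s1 [[ss0 _] ss1 qE]]] fE]]] <-].
apply: le_ereal_inf_tmp => _ [x fx <-]; rewrite lee_fin.
have [u [fu u0 xE]] := feasible_normalize fx.
have uN : u ord0 ord0 != 0 by rewrite gt_eqF.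
have qm : qmodule (hconstr c) (p + q).
  by exists q1, s0, s1; split=> //; [move=> j; exact: (ss1 j).1|rewrite pE qE].
have := qmodule_ge0 fu qm; rewrite -fE mevalB mevalZ mevalXn mevalXU.
rewrite meval_homogenize // -xE mulrC -mulrBl pmulr_lge0 ?exprn_gt0 //.
by rewrite subr_ge0.
Qed.

Lemma mom_value_le k : (mdegree f <= 2 * k)%N ->
  (msize (homogenize f) <= (2 * k).+1)%N -> (mom_value f c k <= fmin f c)%E.
Proof.
move=> dk sk; apply: le_ereal_inf_tmp => _ [x fx <-].
have [u [fu u0 xE]] := feasible_normalize fx.
have uN : u ord0 ord0 != 0 by rewrite gt_eqF.
apply: ereal_inf_lbound.
exists (point_tms k u (u ord0 ord0 ^+ mdegree f)); first exact: point_mom_feasible.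
rewrite pairing_point // meval_homogenize // -xE mulrAC divff ?mul1r //.
by rewrite expf_neq0.
Qed.

End Values.

Section Tightness.
Context {R : realType} {n : nat} {E I : finType}.
Variables (f : {mpoly R[n]}) (c : E + I -> {mpoly R[n]}).
Implicit Types (u : 'rV[R]_n.+1) (x : 'rV[R]_n).

Lemma multipliers_strict_kkt (m : nat) (E' I' : finType) (phi : {mpoly R[m]})
    (h : E' + I' -> {mpoly R[m]}) (v : 'rV[R]_m) :
  minimizer phi h v -> optimality_conditions phi h v ->
  exists lam, strict_kkt h phi v lam.
Proof.
move=> vmin [licq opt]; have [lam mult] := licq_multipliers vmin licq.
have [scc sosc] := opt lam mult; have [gradE _ compl] := mult.
exists lam; split=> // j.
  by move=> hj; have := scc j; rewrite hj addr0.
by move=> hj; have /eqP := compl j; rewrite mulf_eq0 (negbTE hj) orbF => /eqP.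
Qed.

Lemma hobj_ge0 u : closed_at_infinity c -> fmin f c \is a fin_num ->
  feasible (hconstr c) u -> 0 <= (hobj f c).@[u ord0].
Proof.
move=> cl ff /feasible_hsphere[cu _]; move: cu; rewrite -cl.
have -> : 0 <= (hobj f c).@[u ord0] <->
  [set v : 'rV[R]_n.+1 | 0 <= (hobj f c).@[v ord0]] u by [].
move: u; have cg : closed [set v : 'rV[R]_n.+1 | 0 <= (hobj f c).@[v ord0]].
  exact: ((continuous_closedP _).1 (@continuous_meval R n.+1 (hobj f c)) _ (@closed_ge _ 0)).
apply: subset_trans
  (_ : closure [set v : 'rV[R]_n.+1 | 0 <= (hobj f c).@[v ord0]] `<=` _); last first.
  by rewrite -(closure_id _).1.
apply: closure_subset => v [hv v0]; have v0N : v ord0 ord0 != 0 by rewrite gt_eqF.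
rewrite /= meval_hobj // mulr_ge0 ?exprn_ge0 ?(ltW v0) // subr_ge0 -lee_fin fineK //.
exact/fmin_le/feasible_dehomogenize.
Qed.

Lemma hobj_qmodule : fmin f c \is a fin_num -> closed_at_infinity c ->
  (forall x, minimizer f c x -> optimality_conditions f c x) ->
  (forall x, minimizer_at_infinity f c x ->
     optimality_conditions (hobj f c) (hconstr c) (hpoint 0 x)) ->
  qmodule (hconstr c) (hobj f c).
Proof.
move=> ff cl opt_fin opt_inf.
have he0 : hconstr c (inl None) = \sum_(i < n.+1) 'X_i ^+ 2 - 1 by [].
have F0 u : feasible (hconstr c) u -> 0 <= (hobj f c).@[u ord0] by exact: hobj_ge0.
apply: (qmodule_of_locally_quadratic he0) => // u fu Fu.
suff [lam kkt] : exists lam, strict_kkt (hconstr c) (hobj f c) u lam.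
  exact: (strict_kkt_locally_quadratic he0 fu Fu kkt).
have /feasible_hsphere su := fu; have [cu _] := su.
have [_ _ u0] := cu.
(* At infinity the conditions are assumed for (H) itself; otherwise u comes from a minimizer of (P),
   whose multipliers are found first and then homogenized. *)
have [u00|u0N] := eqVneq (u ord0 ord0) 0.
  have uE : hpoint 0 (tail u) = u by rewrite -{2}(hpoint_tail u) u00.
  rewrite -uE; apply: multipliers_strict_kkt.
    by rewrite uE; split=> // v fv; rewrite Fu; exact: F0.
  by apply: opt_inf; rewrite /minimizer_at_infinity uE.
have u0p : 0 < u ord0 ord0 by rewrite lt_def u0N.
pose x := (u ord0 ord0)^-1 *: tail u.
have fx : feasible c x by exact: feasible_dehomogenize.
have fxE : f.@[x ord0] = fine (fmin f c).
  move: Fu; rewrite meval_hobj // => /eqP; rewrite mulf_eq0 expf_eq0 (negbTE u0N) andbF.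
  by rewrite subr_eq0 => /eqP.
have xmin : minimizer f c x.
  by split=> // y fy; rewrite fxE -lee_fin fineK //; exact: fmin_le.
have [lam kkt] := multipliers_strict_kkt xmin (opt_fin _ xmin).
exact: (strict_kkt_homogenize u0p fu Fu kkt).
Qed.

Lemma tight_of_hobj_qmodule : fmin f c \is a fin_num ->
  qmodule (hconstr c) (hobj f c) ->
  exists N : nat, forall k : nat, (N <= k)%N ->
    sos_value f c k = fmin f c /\ mom_value f c k = fmin f c.
Proof.
move=> ff qF; have [N1 hN1] := qmodule_le_exists qF.
have [N2 hN2] := mom_feasible_ge0 f qF.
exists (N1 + N2 + mdegree f + msize (homogenize f))%N => k Nk.
have k1 : (N1 <= k)%N by lia.
have k2 : (N2 <= k)%N by lia.
split; apply/eqP; rewrite eq_le.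
  rewrite sos_value_le /=; apply: ereal_sup_ubound.
  exists (fine (fmin f c)); last by rewrite fineK.
  by have [p [q [ip qq e]]] := hN1 k k1; exists p, q.
rewrite mom_value_le /=; [|by lia|by lia].
apply: le_ereal_inf_tmp => _ [y my <-]; have := hN2 k y k2 my.
have [_ _ _ y1] := my.
rewrite /hobj -scaleN1r scalerA pairingD pairingZ y1 mulr1 mulN1r subr_ge0.
by rewrite -lee_fin fineK.
Qed.

(** Closedness at infinity passes emptiness from K to (H), the closure of the empty set being empty;
    [putinar] then puts every polynomial into the quadratic module. *)
Lemma tight_of_infeasible : (forall x, ~ feasible c x) -> closed_at_infinity c ->
  exists N : nat, forall k : nat, (N <= k)%N ->
    sos_value f c k = +oo%E /\ mom_value f c k = +oo%E.
Proof.
move=> nK cl.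
have he0 : hconstr c (inl None) = \sum_(i < n.+1) 'X_i ^+ 2 - 1 by [].
have nH u : ~ feasible (hconstr c) u.
  move=> /feasible_hsphere[cu _]; move: cu; rewrite -cl.
  have -> : hcone_pos c = set0.
    apply/seteqP; split=> v // [hv v0]; exact: (nK _ (feasible_dehomogenize hv v0)).
  by rewrite closure0.
have qall p : qmodule (hconstr c) p by apply: (putinar he0) => u /nH.
(* The order must not depend on gamma: certificates for the homogenized f and for plus and minus
   x_0^d combine with nonnegative weights for every gamma. Testing - x_0^d against moments
   contradicts the normalization. *)
have [N1 hN1] := qmodule_le_exists (qall (homogenize f)).
have [N2 hN2] := qmodule_le_exists (qall ('X_ord0 ^+ mdegree f)).
have [N3 hN3] := qmodule_le_exists (qall (- 'X_ord0 ^+ mdegree f)).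
have [N4 hN4] := mom_feasible_ge0 f (qall (- 'X_ord0 ^+ mdegree f)).
exists (N1 + N2 + N3 + N4)%N => k Nk.
have k1 : (N1 <= k)%N by lia.
have k2 : (N2 <= k)%N by lia.
have k3 : (N3 <= k)%N by lia.
have k4 : (N4 <= k)%N by lia.
split.
  have sosT g : sos_feasible f c k g.
    suff [p [q [ip qq e]]] : qmodule_le c k (homogenize f - g *: 'X_ord0 ^+ mdegree f).
      by exists p, q.
    apply: qmodule_leD; first exact: hN1.
    have [g0|g0] := leP 0 g.
      by rewrite -scalerN; apply: qmodule_leZ => //; exact: hN3.
    by rewrite -scaleNr; apply: qmodule_leZ; [rewrite oppr_ge0 ltW|exact: hN2].
  by apply: eq_infty => t; apply: ereal_sup_ubound; exists t.
rewrite /mom_value.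
have -> : [set (pairing (homogenize f) y)%:E | y in mom_feasible f c (k := k)] = set0.
  apply/seteqP; split=> // z [y my _]; have := hN4 k y k4 my.
  have [_ _ _ y1] := my; rewrite -scaleN1r pairingZ y1; lra.
exact: ereal_inf0.
Qed.

End Tightness.

Theorem theorem4p3 (R : realType) (n : nat) (E I : finType)
    (f : {mpoly R[n]}) (c : E + I -> {mpoly R[n]})
    (f_bounded : (-oo < fmin f c)%E)
    (K_closed : closed_at_infinity c)
    (E_real_radical : real_radical (heq c))
    (opt_finite : forall x : 'rV[R]_n,
       minimizer f c x -> optimality_conditions f c x)
    (opt_infinity : forall x : 'rV[R]_n,
       minimizer_at_infinity f c x ->
       optimality_conditions (hobj f c) (hconstr c) (hpoint 0 x)) :
  exists N : nat, forall k : nat, (N <= k)%N ->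
    sos_value f c k = fmin f c /\ mom_value f c k = fmin f c.
Proof.
have [ff|nff] := boolP (fmin f c \is a fin_num).
  exact: tight_of_hobj_qmodule ff (hobj_qmodule ff K_closed opt_finite opt_infinity).
(* With -oo excluded only +oo remains, and a feasible point would bound the infimum by a real
   number. *)
have fy : fmin f c = +oo%E.
  by move: f_bounded nff; case: (fmin f c).
rewrite fy; apply: tight_of_infeasible => // x fx.
by have := fmin_le f fx; rewrite fy leye_eq.
Qed.
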